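(* Let $d$ and $s$ be such that $d\le 2s$, or $d>2s$ and $\frac{2d}{d-2s}>4$. Let $(\bar u,\bar w)\in K$ be a local solution of $$\min_{(u,w)\in K}\; \Phi_0(u,w):=f(u)+\frac{\alpha}{2}\|u\|_U^2+\frac{\beta}{2}\|w\|_W^2+\gamma\int_\Omega |w|^p\,dx .$$ Then $\bar w\in L^\infty(\Omega)$ and $\bar u\in L^\infty(I\times\Omega)$.
   Context: Setting. $\Omega\subset\mathbb{R}^d$ is a bounded Lipschitz domain, $I=(0,T)$ with $T>0$, and $U:=L^2(I\times\Omega)$. All functions are real valued. The space $W$ is one of the Hilbert spaces $H^s(\Omega)$, $H^s_0(\Omega)$, $\tilde H^s(\Omega)$, $\mathbb{H}^s(\Omega)$ for some $s\in(0,1)$ (this is the $s$ in the claim), where: (1) $H^s(\Omega)$ is the set of $w\in L^2(\Omega)$ with $\int_\Omega\int_\Omega \frac{|w(x)-w(y)|^2}{|x-y|^{d+2s}}\,dy\,dx<\infty$, with inner product $(u,w)_{H^s(\Omega)}=\int_\Omega uw\,dx+\frac{c_{d,s}}{2}\int_\Omega\int_\Omega\frac{(u(x)-u(y))(w(x)-w(y))}{|x-y|^{d+2s}}\,dy\,dx$, $c_{d,s}=\frac{s2^{2s}\Gamma(s+d/2)}{\pi^{d/2}\Gamma(1-s)}$; (2) $H^s_0(\Omega)$ is the closure of $C_c^\infty(\Omega)$ in $H^s(\Omega)$, with the $H^s(\Omega)$-inner product; (3) $\tilde H^s(\Omega)=\{w\in H^s(\mathbb{R}^d): w=0 \text{ on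 } \mathbb{R}^d\setminus\Omega\}$, with the $H^s(\mathbb{R}^d)$-inner product (same formula as in (1) with $\mathbb{R}^d$ in place of $\Omega$); (4) $\mathbb{H}^s(\Omega)=\{w=\sum_n w_n\phi_n\in L^2(\Omega): \|w\|^2_{\mathbb{H}^s}=\sum_n\lambda_n^s w_n^2<\infty\}$, where $w_n=\int_\Omega w\phi_n\,dx$ and $(\phi_n,\lambda_n)$ are the ($L^2$-orthonormal) eigenfunctions and eigenvalues of the Laplacian with zero Dirichlet boundary conditions, with inner product $\sum_n\lambda_n^s u_nw_n$. The admissible set is $K:=\{(u,w)\in U\times W: |u(t,x)|\le w(x) \text{ for a.a. } (t,x)\in I\times\Omega\}$. A local solution is a pair $(\bar u,\bar w)\in K$ for which there is $\rho>0$ with $\Phi_0(\bar u,\bar w)\le\Phi_0(u,w)$ for all $(u,w)\in K$ with $\|u-\bar u\|_U\le\rho$, $\|w-\bar w\|_W\le\rho$. Standing assumptions. $f:U\to\mathbb{R}$ is weakly lower semicontinuous, bounded from below by an affine function (there are $g\in U^*$, $c\in\mathbb{R}$ with $f(u)\ge g(u)+c$ for all $u\in U$), and continuously Fréchet differentiable. $\alpha,\beta,\gamma>0$ and $p\in(0,1)$. *)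

(* Defs.v *)
From HB Require Import structures.
From mathcomp Require Import all_boot all_order all_algebra.
From mathcomp Require Import all_classical all_reals all_analysis.
Set Implicit Arguments.
Unset Strict Implicit.
Unset Printing Implicit Defensive.
Import Order.TTheory GRing.Theory Num.Theory.
Import numFieldNormedType.Exports.
Local Open Scope classical_set_scope.
Local Open Scope ring_scope.

(** Product sigma-algebra on ['rV[R]_n], i.e. the Borel sets of R^n (as the
    library does for tuples). *)
Definition rV_display : measure_display. Proof. exact. Qed.

Section rV_measurable.
Context {R : realType} {n : nat}.

Definition rV_coord (i : 'I_n) (x : 'rV[R]_n) : measurableTypeR R := x ord0 i.

Let rV_set0 : g_sigma_preimage rV_coord set0.
Proof. exact: sigma_algebra0. Qed.

Let rV_setC A : g_sigma_preimage rV_coord A -> g_sigma_preimage rV_coord (~` A).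
Proof. exact: sigma_algebraC. Qed.

Let rV_bigcup (F : _^nat) : (forall i, g_sigma_preimage rV_coord (F i)) ->
  g_sigma_preimage rV_coord (\bigcup_i (F i)).
Proof. exact: sigma_algebra_bigcup. Qed.

HB.instance Definition _ := @isMeasurable.Build rV_display
  'rV[R]_n (g_sigma_preimage rV_coord) rV_set0 rV_setC rV_bigcup.
End rV_measurable.

Section rV_measurability.
Context {R : realType} {d} {T : measurableType d}.

Lemma measurable_rV_coord n (i : 'I_n) :
  measurable_fun [set: 'rV[R]_n] (fun x : 'rV[R]_n => x ord0 i).
Proof.
move=> _ Y mY; rewrite setTI; apply: sub_sigma_algebra => /=.
rewrite -bigcup_seq/=; exists i => /=; first by rewrite mem_index_enum.
by exists Y => //; rewrite setTI.
Qed.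

Lemma measurable_fun_rV n (f : T -> 'rV[R]_n) :
  (forall i, measurable_fun [set: T] (fun x => f x ord0 i)) ->
  measurable_fun [set: T] f.
Proof.
move=> mf _ Y mY; rewrite setTI.
have : preimage_set_system [set: T] f (g_sigma_preimage (@rV_coord R n))
  (f @^-1` Y) by exists Y => //; rewrite setTI.
rewrite -g_sigma_preimage_comp; apply: smallest_sub.
  exact: sigma_algebra_measurable.
case: n => [|n] in f mf Y mY *; first by rewrite big_ord0.
rewrite -bigcup_mkord_ord; apply: bigcup_sub => i Ii.
by move=> A [B mB <-]; exact: mf.
Qed.

End rV_measurability.

Section lebesgue_rV.
Context {R : realType}.
Local Open Scope ereal_scope.

Definition rV_cons n (p : measurableTypeR R * 'rV[R]_n) : 'rV[R]_n.+1 :=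
  \row_j oapp (fun k => p.2 ord0 k) p.1 (unlift ord0 j).

Lemma measurable_rV_cons n : measurable_fun setT (@rV_cons n).
Proof.
apply: measurable_fun_rV => i; case: (unliftP ord0 i) => [j ->|->].
  rewrite [X in measurable_fun _ X](_ : _ = (fun x : 'rV[R]_n => x ord0 j) \o snd).
    exact: (measurableT_comp (measurable_rV_coord j) measurable_snd).
  by apply/funext => p; rewrite mxE liftK.
rewrite [X in measurable_fun _ X](_ : _ = fst); first exact: measurable_fst.
by apply/funext => p; rewrite mxE unlift_none.
Qed.

Let rV_uncons n (x : 'rV[R]_n.+1) : measurableTypeR R * 'rV[R]_n :=
  (x ord0 ord0, \row_j x ord0 (lift ord0 j)).

Let measurable_rV_uncons n : measurable_fun setT (@rV_uncons n).
Proof.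
apply/measurable_fun_pair; first exact: measurable_rV_coord.
apply: measurable_fun_rV => i.
rewrite [X in measurable_fun _ X](_ : _ = fun x : 'rV[R]_n.+1 => x ord0 (lift ord0 i)).
  exact: measurable_rV_coord.
by apply/funext => x; rewrite mxE.
Qed.

Let rV_consK n : cancel (@rV_cons n) (@rV_uncons n).
Proof.
move=> [t x]; congr pair; first by rewrite mxE unlift_none.
by apply/rowP => j; rewrite !mxE liftK.
Qed.


Section step.
Variables (n : nat) (m1 : {sigma_finite_measure set (measurableTypeR R) -> \bar R}).
Variable m2 : {sigma_finite_measure set 'rV[R]_n -> \bar R}.

Definition rV_cons_measure : set 'rV[R]_n.+1 -> \bar R :=
  pushforward (m1 \x m2) (@rV_cons n).

Let rV_cons_measure0 : rV_cons_measure set0 = 0.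
Proof. by rewrite /rV_cons_measure /pushforward preimage_set0 measure0. Qed.

Let rV_cons_measure_ge0 A : 0 <= rV_cons_measure A.
Proof. by rewrite /rV_cons_measure /pushforward; apply: measure_ge0. Qed.

Let preimage_rV_cons A : measurable A -> measurable (@rV_cons n @^-1` A).
Proof. by move=> mA; rewrite -[X in measurable X]setTI; exact: measurable_rV_cons. Qed.

Let rV_cons_measure_sigma_additive : semi_sigma_additive rV_cons_measure.
Proof.
move=> F mF tF mUF; rewrite /rV_cons_measure /pushforward preimage_bigcup.
apply: measure_semi_sigma_additive.
- by move=> k; exact: preimage_rV_cons.
- apply/trivIsetP => /= i j _ _ ij; rewrite -preimage_setI.
  by move/trivIsetP : tF => /(_ _ _ _ _ ij) ->//; rewrite preimage_set0.
- by rewrite -preimage_bigcup; exact: preimage_rV_cons.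
Qed.

HB.instance Definition _ := isMeasure.Build _ _ _ rV_cons_measure
  rV_cons_measure0 rV_cons_measure_ge0 rV_cons_measure_sigma_additive.

Let rV_cons_measure_sigma_finite : sigma_finite setT rV_cons_measure.
Proof.
have /sigma_finiteP[F [FT ndF Foo]] := sigma_finiteT m1.
have /sigma_finiteP[G [GT ndG Goo]] := sigma_finiteT m2.
exists (fun k => @rV_uncons n @^-1` (F k `*` G k)).
  apply/esym; rewrite -subTset => x _.
  have [i _ Fi] : (\bigcup_i F i) (rV_uncons x).1 by rewrite -FT.
  have [j _ Gj] : (\bigcup_i G i) (rV_uncons x).2 by rewrite -GT.
  exists (maxn i j) => //; split.
    by move: Fi; exact/subsetPset/ndF/leq_maxl.
  by move: Gj; exact/subsetPset/ndG/leq_maxr.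
move=> k; have [mF Fk] := Foo k; have [mG Gk] := Goo k; split.
  rewrite -[X in measurable X]setTI; apply: measurable_rV_uncons => //.
  exact: measurableX.
rewrite /rV_cons_measure /pushforward -comp_preimage.
rewrite (_ : _ \o _ = id); last by apply/funext => p /=; exact: rV_consK.
by rewrite preimage_id product_measure1E// lte_mul_pinfty// ge0_fin_numE.
Qed.

HB.instance Definition _ := Measure_isSigmaFinite.Build _ _ _ rV_cons_measure
  rV_cons_measure_sigma_finite.

End step.

(** Lebesgue measure on R^n, as an iterated product; see [lebesgue_rV_box]. *)
Fixpoint lebesgue_rV n : {sigma_finite_measure set 'rV[R]_n -> \bar R} :=
  match n with
  | 0 => \d_(0%R : 'rV[R]_0)
  | n'.+1 => rV_cons_measure lebesgue_measure (lebesgue_rV n')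
  end.


Lemma lebesgue_rV_box n (A : 'I_n -> set R) : (forall i, measurable (A i)) ->
  lebesgue_rV n [set x | forall i, A i (x ord0 i)] =
  \prod_(i < n) lebesgue_measure (A i).
Proof.
elim: n A => [|n IH] A mA.
  rewrite big_ord0 /= diracE mem_set//=; by case.
rewrite big_ord_recl /= /rV_cons_measure /pushforward -IH//.
have mB : measurable [set x : 'rV[R]_n | forall i, A (lift ord0 i) (x ord0 i)].
  rewrite [X in measurable X](_ : _ = \bigcap_(i in [set: 'I_n])
     [set x : 'rV[R]_n | A (lift ord0 i) (x ord0 i)]).
    apply: fin_bigcap_measurable => // i _.
    by rewrite -[X in measurable X]setTI; exact: measurable_rV_coord.
  by apply/seteqP; split => x /= h i; [move=> _|]; exact: h.
have mA0 : measurable (A ord0 : set (measurableTypeR R)) by exact: mA.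
rewrite -(product_measure1E _ _ mA0 mB).
congr (product_measure1 _ _ _); apply/seteqP; split=> [[t x]/= h|[t x]/= [h0 h] i].
  split; first by have := h ord0; rewrite mxE unlift_none.
  by move=> i; have := h (lift ord0 i); rewrite mxE liftK.
by rewrite mxE; case: unliftP => [j ->|->].
Qed.

End lebesgue_rV.

(** Elements of L^2(D) and of the fractional spaces are represented by functions
    on the whole space, of which only the restriction to D matters (zero
    extension [u \_ D]); equality in the function space is equality a.e. on D,
    i.e. [L2norm mu D (u \- v) = 0]. *)
Section L2.
Context {R : realType} {disp : measure_display} {T : measurableType disp}.
Variables (mu : {measure set T -> \bar R}) (D : set T).
Implicit Types (u v h : T -> R) (f g : (T -> R) -> R).

Definition L2 : set (T -> R) := [set u | u \_ D \in Lfun mu 2%:E].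

Definition Linfty : set (T -> R) := [set u | u \_ D \in Lfun mu +oo%E].

Definition L2norm u : R := fine ('N[mu]_2%:E[EFin \o (u \_ D)])%E.

(** [f] is well defined on a.e. equivalence classes. *)
Definition on_L2 f : Prop :=
  forall u v, L2 u -> L2 v ->
    {ae mu, forall x, D x -> u x = v x} -> f u = f v.

Definition L2_dual g : Prop :=
  (forall a u v, L2 u -> L2 v ->
     g (fun x => a * u x + v x) = a * g u + g v) /\
  (exists C : R, forall u, L2 u -> `|g u| <= C * L2norm u).

Definition weak_cvg (u_ : nat -> T -> R) u : Prop :=
  forall g, L2_dual g -> g (u_ n) @[n --> \oo] --> g u.

(** Lower semicontinuity along weakly convergent sequences, which is implied by
    lower semicontinuity for the weak topology. *)
Definition weakly_lsc f : Prop :=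
  forall (u_ : nat -> T -> R) u, (forall n, L2 (u_ n)) -> L2 u ->
    weak_cvg u_ u -> ((f u)%:E <= limn_einf (fun n => (f (u_ n))%:E))%E.

Definition affinely_bounded_below f : Prop :=
  exists g, exists c : R, L2_dual g /\ forall u, L2 u -> g u + c <= f u.

Definition frechet_derivative f u (L : (T -> R) -> R) : Prop :=
  L2_dual L /\
  forall e : R, 0 < e -> exists2 r : R, 0 < r &
    forall h, L2 h -> L2norm h <= r ->
      `|f (u \+ h) - f u - L h| <= e * L2norm h.

Definition continuously_frechet_differentiable f : Prop :=
  exists df : (T -> R) -> (T -> R) -> R,
    (forall u, L2 u -> frechet_derivative f u (df u)) /\
    (forall u, L2 u -> forall e : R, 0 < e -> exists2 r : R, 0 < r &
       forall v, L2 v -> L2norm (v \- u) <= r ->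
         forall h, L2 h -> `|df v h - df u h| <= e * L2norm h).

End L2.

Section euclidean_space.
Context {R : realType} {d : nat}.
Implicit Types (Om D : set 'rV[R]_d) (phi v w : 'rV[R]_d -> R).

(** The library norm on ['rV[R]_d] is the sup norm. *)
Definition enorm n (x : 'rV[R]_n) : R := Num.sqrt (\sum_i x ord0 i ^+ 2).

(** Near each boundary point, in rotated coordinates [x *m Q], the set is the
    strict epigraph of a Lipschitz function of the other coordinates. *)
Definition lipschitz_boundary Om : Prop :=
  forall x0, closure Om x0 -> ~ Om x0 ->
  exists (Q : 'M[R]_d) (i : 'I_d) (h : 'rV[R]_(d.-1) -> R) (L r : R),
    [/\ Q *m Q^T = 1%:M, 0 < r,
        forall y z, `|h y - h z| <= L * enorm (y - z) &
        forall x, enorm (x - x0) < r ->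
          (Om x <-> h (col' i (x *m Q)) < (x *m Q) ord0 i)].

Definition bounded_lipschitz_domain Om : Prop :=
  [/\ open Om, connected Om, Om !=set0, bounded_set Om & lipschitz_boundary Om].

Definition partial_derivative (i : 'I_d) phi : 'rV[R]_d -> R :=
  fun x => 'D_(delta_mx ord0 i) phi x.

Definition smooth phi : Prop :=
  forall l : seq 'I_d, let psi := foldr partial_derivative phi l in
    continuous psi /\ forall i x, derivable psi x (delta_mx ord0 i).

Definition test_function Om phi : Prop :=
  let supp := closure [set x | phi x != 0] in
  [/\ smooth phi, compact supp & supp `<=` Om].

Notation leb := (lebesgue_rV d : {measure set 'rV[R]_d -> \bar R}).

Definition L2inner D v w : R := \int[leb]_(x in D) (v x * w x).

(** [v] is in H^1_0(Om), the closure of the test functions in H^1(Om), with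
    weak gradient [G]. *)
Definition H10 Om v (G : 'I_d -> 'rV[R]_d -> R) : Prop :=
  [/\ L2 leb Om v, forall i, L2 leb Om (G i),
      forall i phi, test_function Om phi ->
        L2inner Om v (partial_derivative i phi) = - L2inner Om (G i) phi &
      forall e : R, 0 < e -> exists2 phi, test_function Om phi &
        L2norm leb Om (v \- phi) <= e /\
        forall i, L2norm leb Om (G i \- partial_derivative i phi) <= e].

(** An L^2(Om)-orthonormal basis of eigenfunctions of the Dirichlet Laplacian
    [- Delta] (weak formulation), with the eigenvalues repeated according to
    multiplicity. *)
Record dirichlet_eigensystem Om := DirichletEigensystem {
  eigfun : nat -> 'rV[R]_d -> R ;
  eiggrad : nat -> 'I_d -> 'rV[R]_d -> R ;
  eigval : nat -> R ;
  eigfun_H10 : forall n, H10 Om (eigfun n) (eiggrad n) ;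
  eigfunE : forall n v G, H10 Om v G ->
    \sum_i L2inner Om (eiggrad n i) (G i) = eigval n * L2inner Om (eigfun n) v ;
  eigfun_orthonormal : forall m n,
    L2inner Om (eigfun m) (eigfun n) = (m == n)%:R ;
  eigfun_complete : forall w, L2 leb Om w ->
    L2norm leb Om (fun x => w x -
      \sum_(n < N) L2inner Om w (eigfun n) * eigfun n x) @[N --> \oo] --> (0 : R)
}.

Definition Gamma (a : R) : R :=
  \int[lebesgue_measure]_(t in `]0, +oo[) (t `^ (a - 1) * expR (- t)).

Definition frac_const (s : R) : R :=
  s * 2 `^ (2 * s) * Gamma (s + d%:R / 2) /
  (pi `^ (d%:R / 2) * Gamma (1 - s)).

(** At [x = y] the integrand is [0]. *)
Definition gagliardo D (s : R) v w : \bar R :=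
  (\int[leb]_(x in D) \int[leb]_(y in D)
    ((v x - v y) * (w x - w y) / enorm (x - y) `^ (d%:R + 2 * s))%:E)%E.

Definition Hs_mem D (s : R) w : Prop :=
  L2 leb D w /\ (gagliardo D s w w < +oo)%E.

Definition Hs_inner D (s : R) v w : R :=
  L2inner D v w + frac_const s / 2 * fine (gagliardo D s v w).

(** The spaces H^s(Om), H^s_0(Om), the space of elements of H^s(R^d) vanishing
    outside Om, and the spectral space of a given Dirichlet eigensystem. *)
Variant frac_space Om :=
  | HsOm
  | Hs0Om
  | HstildeOm
  | HspectralOm of dirichlet_eigensystem Om.

Definition W_inner Om (s : R) (W : frac_space Om) v w : R :=
  match W with
  | HsOm | Hs0Om => Hs_inner Om s v w
  | HstildeOm => Hs_inner setT s v w
  | HspectralOm E => limn (series (fun n => eigval E n `^ s *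
      L2inner Om v (eigfun E n) * L2inner Om w (eigfun E n)))
  end.

Definition W_norm Om (s : R) (W : frac_space Om) w : R :=
  Num.sqrt (W_inner s W w w).

Definition W_mem Om (s : R) (W : frac_space Om) w : Prop :=
  match W with
  | HsOm => Hs_mem Om s w
  | Hs0Om => Hs_mem Om s w /\
      forall e : R, 0 < e -> exists2 phi, test_function Om phi &
        Num.sqrt (Hs_inner Om s (w \- phi) (w \- phi)) <= e
  | HstildeOm => Hs_mem setT s w /\ {ae leb, forall x, ~ Om x -> w x = 0}
  | HspectralOm E => L2 leb Om w /\
      (\sum_(0 <= n <oo)
         (eigval E n `^ s * L2inner Om w (eigfun E n) ^+ 2)%:E < +oo)%E
  end.

End euclidean_space.

Section control_problem.
Context {R : realType} {d : nat}.
Variables (Om : set 'rV[R]_d) (T s : R) (W : frac_space Om).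
Notation spacetime := (measurableTypeR R * 'rV[R]_d)%type.
Implicit Types (u : spacetime -> R) (w : 'rV[R]_d -> R).

Definition leb_spacetime : {measure set spacetime -> \bar R} :=
  (lebesgue_measure \x lebesgue_rV d)%E.

Definition cylinder : set spacetime := [set` `]0, T[] `*` Om.

Definition U_mem u : Prop := L2 leb_spacetime cylinder u.
Definition U_norm u : R := L2norm leb_spacetime cylinder u.

Definition admissible u w : Prop :=
  [/\ U_mem u, W_mem s W w &
      {ae leb_spacetime, forall tx, cylinder tx -> `|u tx| <= w tx.2}].

Definition Phi0 (f : (spacetime -> R) -> R) (alpha beta gamma p : R) u w : R :=
  f u + alpha / 2 * U_norm u ^+ 2 + beta / 2 * W_norm s W w ^+ 2 +
  gamma * \int[lebesgue_rV d]_(x in Om) (`|w x| `^ p).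

Definition local_solution (Phi : (spacetime -> R) -> ('rV[R]_d -> R) -> R)
    ubar wbar : Prop :=
  admissible ubar wbar /\
  exists2 rho : R, 0 < rho &
    forall u w, admissible u w ->
      U_norm (u \- ubar) <= rho -> W_norm s W (w \- wbar) <= rho ->
      Phi ubar wbar <= Phi u w.

End control_problem.

(* Main.v *)
(** Comparison with truncated competitors.  For [k > 0] put [v := (w - k)^+] and replace
    [(u, w)] by [(u - t h, w - t v)], where [u - h] is [u] clipped to [[-k, k]]; this pair is
    admissible and decreases the norms of [u] and the [L^p] term.  Truncation gives
    [|w - t v|_W^2 <= |w|_W^2 - (2 t - t^2) |v|_W^2], so for small [t] the differentiability of
    [f] and [|h| <= v] yield [|v|_W^2 <= C |v|_2], with [C] independent of [k].  A Faber-Krahn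
    inequality [|v|_2^2 <= C m^(2s/d) |v|_W^2], for small measure [m] of [{w > k}], then gives
    [|v|_2^2 <= C m^(4s/d)].  Both alternatives for [d] and [s] amount to [d < 4s], so that
    Stampacchia's iteration shows that [{w > k}] is null for some [k].  No Sobolev embedding is
    used: for the Gagliardo spaces the Faber-Krahn inequality follows from the measure density
    of Lipschitz domains, and for the spectral space from averaging over translations.

    Truncation is a pointwise inequality for the Gagliardo seminorms.  In the spectral space it
    follows from the weak maximum principle for the resolvents of the Dirichlet Laplacian and
    [l^s = c \int_R e^(s t) l / (l + e^t) dt].  In the closure of the test functions one must also
    approximate [(w - k)^+], which is done by smooth truncations of test functions, separating
    the pairs of points near the diagonal from the others. *)
Require Import Defs.
From mathcomp Require Import all_boot all_order all_algebra.
From mathcomp Require Import all_classical all_reals all_analysis.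
From mathcomp Require Import measurable_realfun ess_sup_inf ring lra.
Set Implicit Arguments.
Unset Strict Implicit.
Unset Printing Implicit Defensive.
Import Order.TTheory GRing.Theory Num.Theory.
Import numFieldNormedType.Exports.
Local Open Scope classical_set_scope.
Local Open Scope ring_scope.

(** * Lebesgue measure on R^n *)

(** All truncation inequalities have one algebraic source. With [a = min w k] and [v = (w - k)^+], a
    quadratic form satisfies [Q(w - t v) = Q(w) - (2 t - t^2) Q(v) - 2 t Q(a, v)], so the point is
    always [Q(a, v) >= 0]. The solution being local, [t] has to be small depending on [k]; but gain
    and error are both linear in [t], since [2 t - t^2 >= t], hence [t] cancels and the constant
    stays independent of [k]. The term in [|w|^p] is neither convex nor differentiable at [0]; it
    enters through its monotonicity under truncation. By Chebyshev's inequality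
    [(h - k)^2 |{w > h}|] is at most [|v|_2^2], so the measure of the level sets decays with
    exponent [4 s / d], and the iteration needs an exponent above [1]. A recurrent obstacle is that
    real-valued integrals and seminorms are [fine] parts, equal to [0] when the integral is
    infinite: comparisons are made in the extended reals, and finiteness is proved before passing to
    real numbers. *)

Section rV_measure.
Context {R : realType}.

(** The pushforward under the translation gives half-open intervals their length, which
    characterizes Lebesgue measure. *)
Lemma lebesgue_measure_shift (a : R) (A : set (measurableTypeR R)) :
  measurable A -> lebesgue_measure [set x | A (x + a)] = lebesgue_measure A.
Proof.
move=> mA; pose phi (x : measurableTypeR R) : measurableTypeR R := x + a.
have mphi : measurable_fun setT phi by exact: measurable_funD.
pose m : {measure set (measurableTypeR R) -> \bar R} :=
  measure_function_pushforward__canonical__measure_function_Measure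
    lebesgue_measure mphi.
rewrite -[LHS]/(m A); apply/esym/(lebesgue_measure_unique (mu := m)) => //.
move=> _ [[b c] bc <-]; rewrite /m /= /pushforward.
rewrite (_ : phi @^-1` _ = `]b - a, c - a]%classic).
  rewrite !lebesgue_measure_itv/= !lte_fin ltrD2r; case: ifPn => // _.
  by congr (_%:E); lra.
by apply/seteqP; split => x; rewrite /phi /= !in_itv/= ltrBlDr lerBrDr.
Qed.

Definition rV_head n (a : 'rV[R]_n.+1) : R := a ord0 ord0.
Definition rV_tail n (a : 'rV[R]_n.+1) : 'rV[R]_n := \row_j a ord0 (lift ord0 j).

Lemma rV_consD n (t : R) (x : 'rV[R]_n) (a : 'rV[R]_n.+1) :
  rV_cons (t, x) + a = rV_cons (t + rV_head a, x + rV_tail a).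
Proof.
apply/rowP => j; rewrite !mxE; case: unliftP => [k ->|->] /=; by rewrite ?mxE.
Qed.

Lemma measurable_shift n (a : 'rV[R]_n) :
  measurable_fun setT (fun x : 'rV[R]_n => x + a).
Proof.
apply: measurable_fun_rV => i; under eq_fun do rewrite mxE.
by apply: measurable_funD => //; exact: measurable_rV_coord.
Qed.

Lemma measurable_preimage_shift n (a : 'rV[R]_n) (A : set 'rV[R]_n) :
  measurable A -> measurable [set x | A (x + a)].
Proof.
by move=> mA; rewrite -[X in measurable X]setTI; exact: measurable_shift.
Qed.

(** By induction on the dimension: the section at [t] of the shifted set is a shift of the section
    at [t + rV_head a], so the induction hypothesis treats the inner measure and one-dimensional
    invariance the outer integral. *)
Lemma lebesgue_rV_shift n (a : 'rV[R]_n) (A : set 'rV[R]_n) :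
  measurable A -> lebesgue_rV n [set x | A (x + a)] = lebesgue_rV n A.
Proof.
elim: n a A => [|n IH] a A mA.
  by congr (lebesgue_rV 0 _); apply/seteqP; split => x /=;
    rewrite (_ : x + a = x)//; apply/rowP => -[].
rewrite /= /rV_cons_measure /pushforward /product_measure1 /=.
have mcons B : measurable B -> measurable (@rV_cons R n @^-1` B).
  by move=> mB; rewrite -[X in measurable X]setTI; exact: measurable_rV_cons.
pose g t := lebesgue_rV n (xsection (@rV_cons R n @^-1` A) t).
have mg : measurable_fun setT g by apply: measurable_fun_xsection; exact: mcons.
transitivity (\int[lebesgue_measure]_t g (t + rV_head a)%R)%E.
  apply: eq_integral => t _ /=.
  rewrite /g /= -[RHS](IH (rV_tail a)); last by apply: measurable_xsection; exact: mcons.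
  congr (lebesgue_rV n _); apply/seteqP; split => x;
    by rewrite /xsection /= !inE /= rV_consD.
pose phi (x : measurableTypeR R) : measurableTypeR R := x + rV_head a.
have mphi : measurable_fun setT phi by exact: measurable_funD.
have := @ge0_integral_pushforward _ _ _ _ _ _ mphi lebesgue_measure setT g
  measurableT mg (fun _ _ => measure_ge0 _ _).
rewrite preimage_setT => <-.
apply: eq_measure_integral => B mB _.
by rewrite /= -[RHS](lebesgue_measure_shift (rV_head a)).
Qed.

Lemma ge0_integral_shift n (a : 'rV[R]_n) (f : 'rV[R]_n -> \bar R) :
  measurable_fun setT f -> (forall x, 0 <= f x)%E ->
  (\int[lebesgue_rV n]_x f (x + a)%R = \int[lebesgue_rV n]_x f x)%E.
Proof.
move=> mf f0.
have := @ge0_integral_pushforward _ _ _ _ _ _ (measurable_shift a)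
  (lebesgue_rV n) setT f measurableT mf (fun x _ => f0 x).
rewrite preimage_setT => <-.
apply: eq_measure_integral; first exact: measurable_shift.
by move=> ? B mB _; rewrite /= -[RHS](lebesgue_rV_shift a).
Qed.

(** Ball of the sup norm when [r > 0], written coordinatewise so that [lebesgue_rV_box] gives its
    volume. *)
Definition cube n (x : 'rV[R]_n) (r : R) : set 'rV[R]_n :=
  [set y | forall i, `|y ord0 i - x ord0 i| < r].

Lemma measurable_forall_coord n (A : 'I_n -> set 'rV[R]_n) :
  (forall i, measurable (A i)) -> measurable [set x | forall i, A i x].
Proof.
move=> mA; rewrite [X in measurable X](_ : _ = \bigcap_(i in [set: 'I_n]) A i).
  exact: fin_bigcap_measurable.
by apply/seteqP; split => x /= h i; [move=> _|]; exact: h.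
Qed.

Lemma cubeE n (x : 'rV[R]_n) r :
  cube x r = [set y | forall i, (ball (x ord0 i) r) (y ord0 i)].
Proof. by apply/seteqP; split => y h i; have := h i; rewrite /ball/= distrC. Qed.

Lemma measurable_cube n (x : 'rV[R]_n) r : measurable (cube x r).
Proof.
rewrite cubeE; apply: measurable_forall_coord => i.
rewrite -[X in measurable X]setTI; apply: measurable_rV_coord => //.
exact: measurable_ball.
Qed.

Lemma lebesgue_cube n (x : 'rV[R]_n) r : 0 <= r ->
  lebesgue_rV n (cube x r) = ((2 * r) ^+ n)%:E.
Proof.
move=> r0; rewrite cubeE (@lebesgue_rV_box R n (fun i => ball (x ord0 i) r)).
  under eq_bigr do rewrite lebesgue_measure_ball// -mulr_natl.
  by rewrite prodEFin prodr_const card_ord.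
by move=> i; exact: measurable_ball.
Qed.

Lemma open_measurable_rV n (A : set 'rV[R]_n) : open A -> measurable A.
Proof.
move=> oA.
(* Rational centres and radii [1 / (k + 1)] make the family countable; cubes not contained in [A]
   are replaced by the empty set, so that the union runs over all indices. *)
pose c (q : 'rV[rat]_n * nat) := cube (map_mx ratr q.1) (q.2.+1%:R^-1 : R).
pose F q := if `[< c q `<=` A >] then c q else set0.
rewrite (_ : A = \bigcup_q F q); last first.
  apply/seteqP; split => [x Ax|x [q _]]; last first.
    by rewrite /F; case: asboolP => // cA cx; exact: cA.
  have /nbhs_ballP[e /= e0 eA] : nbhs x A by apply: open_nbhs_nbhs; split.
  have [k ke] : exists k : nat, k.+1%:R^-1 < e / 2.
    have e20 : 0 < e / 2 by rewrite divr_gt0.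
    have [k _ hk] := near_infty_natSinv_lt (PosNum e20).
    by exists k; exact: hk (leqnn _).
  have /choice[q hq] : forall i : 'I_n, exists q : rat, `|x ord0 i - ratr q| < k.+1%:R^-1.
    move=> i; have kp : 0 < k.+1%:R^-1 :> R by rewrite invr_gt0.
    have hlt : x ord0 i - k.+1%:R^-1 < x ord0 i + k.+1%:R^-1.
      by rewrite ltrBlDr -addrA ltrDl addr_gt0.
    have [q] := rat_in_itvoo hlt.
    by rewrite in_itv/= => /andP[h1 h2]; exists q; rewrite ltr_distlC; apply/andP; split.
  exists (\row_i q i, k) => //; rewrite /F; case: asboolP => [_|].
    by rewrite /c /cube /= => i; rewrite !mxE; exact: hq.
  case; apply: subset_trans eA => y; rewrite /c/cube/= => hy.
  rewrite mx_norm_ball /ball_ /=.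
  apply: (@le_lt_trans _ _ (2 * k.+1%:R^-1)); last by rewrite mulrC -ltr_pdivlMr.
  rewrite /Num.norm/= mx_normrE; apply: bigmax_le => [|[i j] _].
    by rewrite mulr_ge0.
  rewrite !mxE /= (ord1 i); have := hy j; have := hq j; rewrite !mxE => h1 h2.
  rewrite -(subrKA (ratr (q j))); apply: le_trans (ler_normD _ _) _.
  by rewrite (distrC (ratr _)) mulr_natl mulr2n lerD// ltW.
apply: countable_bigcupT_measurable => [|q]; first exact: countableP.
by rewrite /F; case: ifPn => _ //; exact: measurable_cube.
Qed.

Lemma continuous_measurable_rV n (f : 'rV[R]_n -> R) :
  continuous f -> measurable_fun setT f.
Proof.
move=> cf; apply: (measurability _ (RGenOInfty.measurableE R)).
move=> _ [_ [a ->] <-]; rewrite setTI; apply: open_measurable_rV.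
by apply: open_comp => //; exact: interval_open.
Qed.

Lemma bounded_lebesgue_rV n (A : set 'rV[R]_n) : measurable A -> bounded_set A ->
  (lebesgue_rV n A < +oo)%E.
Proof.
move=> mA [M [Mr hM]].
pose r := `|M| + 1.
have Mr' : M < r by rewrite /r (le_lt_trans (ler_norm _))// ltrDl.
apply: (@le_lt_trans _ _ (lebesgue_rV n (cube 0 (r + 1)))).
  apply: le_measure; rewrite ?inE//; first exact: measurable_cube.
  move=> x Ax i; rewrite mxE subr0.
  apply: (@le_lt_trans _ _ `|x|); last by rewrite (le_lt_trans (hM _ Mr' _ Ax))// ltrDl.
  rewrite [leRHS]/Num.norm/= mx_normrE.
  exact: (le_bigmax _ (fun ij => `|x ij.1 ij.2|) (ord0, i)).
by rewrite lebesgue_cube ?ltry// addr_ge0// /r addr_ge0.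
Qed.

Lemma normr_coord_le n (x : 'rV[R]_n) i : `|x ord0 i| <= `|x|.
Proof.
rewrite [leRHS]/Num.norm/= mx_normrE.
exact: (le_bigmax _ (fun ij => `|x ij.1 ij.2|) (ord0, i)).
Qed.

End rV_measure.

(** * Square-integrable functions *)

Section L2_theory.
Context {R : realType} {disp : measure_display} {T : measurableType disp}.
Variables (mu : {measure set T -> \bar R}) (D : set T) (mD : measurable D).
Implicit Types (u v w : T -> R).

(** The squared norm in the extended reals, where infinite values stay visible; [L2_sqint] links it
    to [L2norm]. *)
Definition sqint u : \bar R := (\int[mu]_(x in D) (u x ^+ 2)%:E)%E.
Definition ip u v : R := \int[mu]_(x in D) (u x * v x).

Lemma sqint_ge0 u : (0 <= sqint u)%E.
Proof. by apply: integral_ge0 => x _; rewrite lee_fin sqr_ge0. Qed.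

Lemma sqint_Lnorm u : ('N[mu]_2%:E[EFin \o (u \_ D)] `^ 2 = sqint u)%E.
Proof.
rewrite poweR_Lnorm// /sqint [RHS]integral_mkcond; apply: eq_integral => x _ /=.
rewrite /patch/=; case: ifPn => _.
  by rewrite powR_mulrn// real_normK// num_real.
by rewrite normr0 powR0.
Qed.

Lemma L2_measurable u : L2 mu D u -> measurable_fun D u.
Proof.
rewrite /L2/= inE => /andP[]; rewrite inE/= => mu_ _.
exact/measurable_restrictT.
Qed.

Lemma L2_fin u : L2 mu D u -> (sqint u < +oo)%E.
Proof.
rewrite /L2/= inE => /andP[_]; rewrite inE/= /finite_norm => h.
by rewrite -sqint_Lnorm poweR_lty.
Qed.

Lemma L2P u : L2 mu D u <-> measurable_fun D u /\ (sqint u < +oo)%E.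
Proof.
split=> [h|[mu_ h]]; first by split; [exact: L2_measurable|exact: L2_fin].
rewrite /L2/= inE; apply/andP; split; rewrite inE/=; first exact/(measurable_restrictT _ mD).1.
by rewrite /finite_norm; move: h; rewrite -sqint_Lnorm; by apply: lty_poweRy; rewrite ?pnatr_eq0.
Qed.

Lemma measurable_sqr u : measurable_fun D u -> measurable_fun D (fun x => (u x ^+ 2)%:E).
Proof. by move=> m; apply/measurable_EFinP; exact: measurable_funX. Qed.

Lemma L2_sqint u : L2 mu D u -> sqint u = (L2norm mu D u ^+ 2)%:E.
Proof.
move=> h; rewrite -sqint_Lnorm /L2norm.
move: h; rewrite /L2/= inE => /andP[_]; rewrite inE/= /finite_norm => h.
rewrite -[in LHS](@fineK _ ('N[mu]_2%:E[_])%E).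
  by rewrite poweR_EFin powR_mulrn// fine_ge0// Lnorm_ge0.
by rewrite ge0_fin_numE// Lnorm_ge0.
Qed.

Lemma L2norm_ge0 u : 0 <= L2norm mu D u.
Proof. by rewrite /L2norm fine_ge0// Lnorm_ge0. Qed.

Lemma le_sqint u v : measurable_fun D u -> measurable_fun D v ->
  (forall x, D x -> `|u x| <= `|v x|) -> (sqint u <= sqint v)%E.
Proof.
move=> mu_ mv uv; apply: ge0_le_integral => //.
- by move=> x _; rewrite lee_fin sqr_ge0.
- exact: measurable_sqr.
- exact: measurable_sqr.
move=> x Dx; rewrite lee_fin -(real_normK (num_real (u x))).
by rewrite -(real_normK (num_real (v x))) lerXn2r ?nnegrE// uv.
Qed.

Lemma L2_le u v : measurable_fun D u -> L2 mu D v ->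
  (forall x, D x -> `|u x| <= `|v x|) -> L2 mu D u.
Proof.
move=> mu_ /L2P[mv vfin] uv; apply/L2P; split => //.
exact: le_lt_trans (le_sqint mu_ mv uv) vfin.
Qed.

Lemma L2norm_le u v : measurable_fun D u -> L2 mu D v ->
  (forall x, D x -> `|u x| <= `|v x|) -> L2norm mu D u <= L2norm mu D v.
Proof.
move=> mu_ v2 uv; have u2 := L2_le mu_ v2 uv.
rewrite -(@ler_pXn2r _ 2) ?nnegrE ?L2norm_ge0// -lee_fin -!L2_sqint//.
exact: le_sqint mu_ (L2_measurable v2) uv.
Qed.

Lemma eq_L2 u v : (forall x, D x -> u x = v x) -> L2 mu D u -> L2 mu D v.
Proof.
move=> uv; rewrite /L2/= [X in X \in _](_ : _ = v \_ D)//.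
by apply/funext => x; rewrite /patch; case: ifPn => // /set_mem /uv.
Qed.

Lemma eq_L2norm u v : (forall x, D x -> u x = v x) ->
  L2norm mu D u = L2norm mu D v.
Proof.
move=> uv; rewrite /L2norm [X in EFin \o X](_ : _ = v \_ D)//.
by apply/funext => x; rewrite /patch; case: ifPn => // /set_mem /uv.
Qed.

Lemma L2Z a u : L2 mu D u -> L2 mu D (fun x => a * u x).
Proof.
move=> /L2P[mu_ ufin]; apply/L2P; split; first exact: measurable_funM.
rewrite /sqint; under eq_integral do rewrite exprMn EFinM.
rewrite ge0_integralZl ?lee_fin ?sqr_ge0//.
- by rewrite lte_mul_pinfty// ?lee_fin ?sqr_ge0.
- exact: measurable_sqr.
- by move=> x _; rewrite lee_fin sqr_ge0.
Qed.

Lemma L2D u v : L2 mu D u -> L2 mu D v -> L2 mu D (fun x => u x + v x).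
Proof.
move=> /L2P[mu_ ufin] /L2P[mv vfin]; apply/L2P; split; first exact: measurable_funD.
apply: (@le_lt_trans _ _ (\int[mu]_(x in D) (2%:E * ((u x ^+ 2)%:E + (v x ^+ 2)%:E)))%E).
  apply: ge0_le_integral => //.
  - by move=> x _; rewrite lee_fin sqr_ge0.
  - by apply: measurable_sqr; exact: measurable_funD.
  - apply: measurable_funeM; apply: emeasurable_funD; exact: measurable_sqr.
  - move=> x _; rewrite -EFinD -EFinM lee_fin; move: (u x) (v x) => a b.
    by have := sqr_ge0 (a - b); nra.
rewrite ge0_integralZl//; last 2 first.
- by apply: emeasurable_funD; exact: measurable_sqr.
- by move=> x _; rewrite -EFinD lee_fin addr_ge0 ?sqr_ge0.
rewrite ge0_integralD//; last 4 first.
- by move=> x _; rewrite lee_fin sqr_ge0.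
- exact: measurable_sqr.
- by move=> x _; rewrite lee_fin sqr_ge0.
- exact: measurable_sqr.
by rewrite lte_mul_pinfty// ?lee_fin// lte_add_pinfty.
Qed.

Lemma L2N u : L2 mu D u -> L2 mu D (fun x => - u x).
Proof. by move/(L2Z (-1)); apply: eq_L2 => x _; rewrite mulN1r. Qed.

Lemma L2B u v : L2 mu D u -> L2 mu D v -> L2 mu D (fun x => u x - v x).
Proof. by move=> hu hv; apply: L2D => //; exact: L2N. Qed.

Lemma L2_cst0 : L2 mu D (fun=> 0).
Proof.
apply/L2P; split; first exact: measurable_cst.
by rewrite /sqint integral0_eq// => x _; rewrite expr0n.
Qed.

Lemma L2_sum I (r : seq I) (F : I -> T -> R) : (forall i, L2 mu D (F i)) ->
  L2 mu D (fun x => \sum_(i <- r) F i x).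
Proof.
move=> h; elim: r => [|i r IH].
  by apply: eq_L2 L2_cst0 => x _; rewrite big_nil.
by apply: eq_L2 (L2D (h i) IH) => x _; rewrite big_cons.
Qed.

Lemma L2_integrableM u v : L2 mu D u -> L2 mu D v ->
  mu.-integrable D (fun x => (u x * v x)%:E).
Proof.
move=> hu hv; have [mu_ ufin] := (L2P u).1 hu; have [mv vfin] := (L2P v).1 hv.
apply: (@le_integrable _ _ _ _ _ mD _ (fun x => (u x ^+ 2)%:E + (v x ^+ 2)%:E)%E).
- by apply/measurable_EFinP; exact: measurable_funM.
- move=> x _ /=; rewrite lee_fin [leRHS]ger0_norm ?addr_ge0 ?sqr_ge0// normrM.
  rewrite -(real_normK (num_real (u x))) -(real_normK (num_real (v x))).
  move: (normr_ge0 (u x)) (normr_ge0 (v x)); move: `|u x| `|v x| => a b a0 b0.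
  by have := sqr_ge0 (a - b); nra.
by apply: integrableD => //; apply/integrableP; split;
  [exact: measurable_sqr|under eq_integral do rewrite gee0_abs ?lee_fin ?sqr_ge0//|
   exact: measurable_sqr|under eq_integral do rewrite gee0_abs ?lee_fin ?sqr_ge0//].
Qed.

Lemma ipC u v : ip u v = ip v u.
Proof. by apply: eq_Rintegral => x _; rewrite mulrC. Qed.

Lemma eq_ip u u' v v' : (forall x, D x -> u x = u' x) -> (forall x, D x -> v x = v' x) ->
  ip u v = ip u' v'.
Proof. by move=> h h'; apply: eq_Rintegral => x /set_mem Dx; rewrite h// h'. Qed.

Lemma ipDl u v w : L2 mu D u -> L2 mu D v -> L2 mu D w ->
  ip (fun x => u x + v x) w = ip u w + ip v w.
Proof.
move=> hu hv hw; rewrite /ip -RintegralD//; last 2 first.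
- exact: L2_integrableM.
- exact: L2_integrableM.
by apply: eq_Rintegral => x _; rewrite mulrDl.
Qed.

Lemma ipZl a u v : L2 mu D u -> L2 mu D v -> ip (fun x => a * u x) v = a * ip u v.
Proof.
move=> hu hv; rewrite /ip -RintegralZl//; last exact: L2_integrableM.
by apply: eq_Rintegral => x _; rewrite mulrA.
Qed.

Lemma ipBl u v w : L2 mu D u -> L2 mu D v -> L2 mu D w ->
  ip (fun x => u x - v x) w = ip u w - ip v w.
Proof.
move=> hu hv hw; rewrite (@eq_ip _ (fun x => u x + -1 * v x) w w)//; last first.
  by move=> x _; rewrite mulN1r.
by rewrite ipDl// ?ipZl ?mulN1r//; exact: L2Z.
Qed.

Lemma ipDr u v w : L2 mu D u -> L2 mu D v -> L2 mu D w ->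
  ip w (fun x => u x + v x) = ip w u + ip w v.
Proof. by move=> hu hv hw; rewrite ipC ipDl// ![ip w _]ipC. Qed.

Lemma ipZr a u v : L2 mu D u -> L2 mu D v -> ip u (fun x => a * v x) = a * ip u v.
Proof. by move=> hu hv; rewrite ipC ipZl// ipC. Qed.

Lemma ipBr u v w : L2 mu D u -> L2 mu D v -> L2 mu D w ->
  ip w (fun x => u x - v x) = ip w u - ip w v.
Proof. by move=> hu hv hw; rewrite ipC ipBl// ![ip w _]ipC. Qed.

Lemma ip0l w : ip (fun=> 0) w = 0.
Proof. by rewrite /ip; under eq_Rintegral do rewrite mul0r; rewrite /Rintegral integral0. Qed.

Lemma ip_suml I (r : seq I) (F : I -> T -> R) v : (forall i, L2 mu D (F i)) -> L2 mu D v ->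
  ip (fun x => \sum_(i <- r) F i x) v = \sum_(i <- r) ip (F i) v.
Proof.
move=> h hv; elim: r => [|i r IH].
  rewrite big_nil -[RHS](ip0l v); apply: eq_ip => // x _; by rewrite big_nil.
rewrite big_cons -IH -ipDl//; last exact: L2_sum.
by apply: eq_ip => // x _; rewrite big_cons.
Qed.

Lemma ip_norm u : L2 mu D u -> ip u u = L2norm mu D u ^+ 2.
Proof.
move=> hu; apply: EFin_inj; rewrite -L2_sqint// /ip /Rintegral fineK//.
exact: integrable_fin_num (L2_integrableM hu hu).
Qed.

(** Cauchy-Schwarz, from the nonnegativity in [t] of the squared norm of [u + t v]. *)
Lemma normr_ip_le u v : L2 mu D u -> L2 mu D v ->
  `|ip u v| <= L2norm mu D u * L2norm mu D v.
Proof.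
move=> hu hv.
have key t : 0 <= L2norm mu D u ^+ 2 + 2 * t * ip u v + t ^+ 2 * L2norm mu D v ^+ 2.
  have htv := L2Z t hv; have hs := L2D hu htv.
  have := sqr_ge0 (L2norm mu D (fun x => u x + t * v x)).
  by rewrite -(ip_norm hs) ipDl// !ipDr// !ipZl// !ipZr// !ip_norm// (ipC v u); lra.
rewrite -(@ler_pXn2r _ 2) ?nnegrE ?mulr_ge0 ?L2norm_ge0// real_normK ?num_real//.
rewrite exprMn; set a := ip u v in key *.
set p := L2norm mu D u ^+ 2 in key *; set q := L2norm mu D v ^+ 2 in key *.
have p0 : 0 <= p by exact: sqr_ge0. have q0 : 0 <= q by exact: sqr_ge0.
have [q_0|qn0] := eqVneq q 0.
  have [a_0|an0] := eqVneq a 0; first by rewrite a_0; nra.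
  (* With [q = 0] the polynomial is affine, and this [t] would give it the value [-1]. *)
  have := key (- (p + 1) / (2 * a)); rewrite q_0 mulr0 addr0.
  rewrite (_ : 2 * _ * a = - (p + 1)); first by lra.
  by field.
have qp : 0 < q by rewrite lt_neqAle eq_sym qn0.
have := key (- a / q).
rewrite (_ : _ + _ = (p * q - a ^+ 2) / q); last by field.
by rewrite pmulr_lge0 ?invr_gt0// subr_ge0.
Qed.

Lemma L2norm_sqrD u v : L2 mu D u -> L2 mu D v ->
  L2norm mu D (fun x => u x + v x) ^+ 2 =
  L2norm mu D u ^+ 2 + 2 * ip u v + L2norm mu D v ^+ 2.
Proof.
move=> hu hv; have hs := L2D hu hv.
by rewrite -(ip_norm hs) ipDl// !ipDr// !ip_norm// (ipC v u); lra.
Qed.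

Lemma L2normZ a u : L2 mu D u -> L2norm mu D (fun x => a * u x) = `|a| * L2norm mu D u.
Proof.
move=> hu; have ha := L2Z a hu.
apply/eqP; rewrite -(@eqrXn2 _ 2) ?mulr_ge0 ?L2norm_ge0//; apply/eqP.
by rewrite -(ip_norm ha) ipZl// ipZr// ip_norm// exprMn real_normK ?num_real// mulrA.
Qed.

Lemma L2normD u v : L2 mu D u -> L2 mu D v ->
  L2norm mu D (fun x => u x + v x) <= L2norm mu D u + L2norm mu D v.
Proof.
move=> hu hv; rewrite -(@ler_pXn2r _ 2) ?nnegrE ?addr_ge0 ?L2norm_ge0//.
rewrite L2norm_sqrD//; have := normr_ip_le hu hv; have := ler_norm (ip u v).
by set a := ip u v; set p := L2norm _ _ u; set q := L2norm _ _ v => ? ?; nra.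
Qed.

Lemma L2normN u : L2 mu D u -> L2norm mu D (fun x => - u x) = L2norm mu D u.
Proof.
move=> hu; rewrite (@eq_L2norm _ (fun x => -1 * u x)); last by move=> x _; rewrite mulN1r.
by rewrite L2normZ// normrN1 mul1r.
Qed.

Lemma L2normBC u v : L2 mu D u -> L2 mu D v ->
  L2norm mu D (fun x => u x - v x) = L2norm mu D (fun x => v x - u x).
Proof.
move=> hu hv; rewrite -L2normN; last exact: L2B.
by apply: eq_L2norm => x _; rewrite opprB.
Qed.

Lemma L2norm0 : L2norm mu D (fun=> 0) = 0.
Proof.
rewrite (@eq_L2norm _ (fun=> 0 * 0)); last by move=> x _; rewrite mul0r.
by rewrite (L2normZ 0 L2_cst0) normr0 mul0r.
Qed.

End L2_theory.

(** * Smooth truncations of test functions *)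

Section smooth_functions.
Context {R : realType} {d : nat}.
Implicit Types (phi psi g h : 'rV[R]_d -> R).

Lemma is_derive_line (f : 'rV[R]_d -> R) (x v : 'rV[R]_d) (df : R) (t : R) :
  is_derive (t *: v + x) v f df -> is_derive t 1 (fun h : R => f (h *: v + x)) df.
Proof.
move=> [dv <-].
suff E : (fun h : R => h^-1 *: (((fun h : R => f (h *: v + x)) \o shift t) (h *: 1)
    - f (t *: v + x))) =
    (fun h : R => h^-1 *: ((f \o shift (t *: v + x)) (h *: v) - f (t *: v + x))).
  by split; [rewrite /derivable|rewrite /derive]; rewrite E.
apply/funext => h /=; congr (_ *: (f _ - _)).
by rewrite scalerDl addrA [h *: 1]mulr1.
Qed.

Lemma is_derive_lineK (f : 'rV[R]_d -> R) (x v : 'rV[R]_d) (df : R) :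
  is_derive (0 : R) 1 (fun h : R => f (h *: v + x)) df -> is_derive x v f df.
Proof.
move=> [dv <-].
suff E : (fun h : R => h^-1 *: ((f \o shift x) (h *: v) - f x)) =
  (fun h : R => h^-1 *: (((fun h : R => f (h *: v + x)) \o shift 0) (h *: 1)
    - f (0 *: v + x))).
  by split; [rewrite /derivable|rewrite /derive]; rewrite E.
apply/funext => h /=; congr (_ *: (f _ - f _)).
  by rewrite addr0 [h *: 1]mulr1.
by rewrite scale0r add0r.
Qed.

(** Restriction to the line through [x] with direction [v] reduces this to the chain rule in one
    variable. *)
Lemma is_derive_comp_line (k : R -> R) (f : 'rV[R]_d -> R) (x v : 'rV[R]_d) (dk df : R) :
  is_derive (f x) 1 k dk -> is_derive x v f df -> is_derive x v (k \o f) (dk * df).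
Proof.
move=> hk hf; apply: is_derive_lineK.
have h1 : is_derive (f (0 *: v + x)) 1 k dk by rewrite scale0r add0r.
have h2 : is_derive (0 : R) 1 (fun h : R => f (h *: v + x)) df.
  by apply: is_derive_line; rewrite scale0r add0r.
exact: (@is_derive1_comp _ k (fun h : R => f (h *: v + x)) 0 dk df h1 h2).
Qed.

Variable G : set ('rV[R]_d -> R).

(* Smoothness of [smooth_pos e k \o phi] is proved for the algebra generated by the iterated
   partial derivatives of [phi] and by [(root_sqr e k \o phi)^-1], which is stable under
   partial derivatives. *)
Inductive generated_algebra : ('rV[R]_d -> R) -> Prop :=
| GeneratedGen g : G g -> generated_algebra g
| GeneratedCst c : generated_algebra (cst c)
| GeneratedAdd g h : generated_algebra g -> generated_algebra h ->
    generated_algebra (g \+ h)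
| GeneratedMul g h : generated_algebra g -> generated_algebra h ->
    generated_algebra (g \* h).

Definition stable_partials : Prop := forall g, G g ->
  continuous g /\ forall i : 'I_d, exists2 dg, generated_algebra dg &
    forall x, is_derive x (delta_mx ord0 i) g (dg x).

Hypothesis GP : stable_partials.

Lemma generated_algebraP g : generated_algebra g ->
  continuous g /\ forall i : 'I_d, exists2 dg, generated_algebra dg &
    forall x, is_derive x (delta_mx ord0 i) g (dg x).
Proof.
elim => {g} [g /GP//|c|g h gg [cg dg] gh [ch dh]|g h gg [cg dg] gh [ch dh]].
- split=> [|i]; first exact: cst_continuous.
  by exists (cst 0) => [|x]; [exact: GeneratedCst|exact: is_derive_cst].
- split=> [x|i]; first by apply: continuousD; [exact: cg|exact: ch].
  have [dgi ggi dgP] := dg i; have [dhi ghi dhP] := dh i.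
  by exists (dgi \+ dhi) => [|x]; [exact: GeneratedAdd|exact: is_deriveD].
split=> [x|i]; first by apply: continuousM; [exact: cg|exact: ch].
have [dgi ggi dgP] := dg i; have [dhi ghi dhP] := dh i.
exists ((g \* dhi) \+ (h \* dgi)) => [|x].
  by apply: GeneratedAdd; exact: GeneratedMul.
exact: is_deriveM.
Qed.

Lemma generated_algebra_smooth g : generated_algebra g -> smooth g.
Proof.
move=> gg l /=.
suff /generated_algebraP[c h] : generated_algebra (foldr partial_derivative g l).
  by split => // i x; have [dg _ /(_ x)[]] := h i.
elim: l => //= i l /generated_algebraP[_ /(_ i)[dg gdg dgP]].
rewrite (_ : partial_derivative _ _ = dg)//.
by apply/funext => x; have [_ <-] := dgP x.
Qed.
End smooth_functions.

Section smooth_positive_part.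
Context {R : realType}.
Implicit Types (e k t : R).

Definition root_sqr e k t : R := Num.sqrt ((t - k) ^+ 2 + e ^+ 2).

(* Normalized to vanish at [0], so that the composition with a test function is one. *)
Definition smooth_pos e k t : R :=
  (root_sqr e k t + (t - k) - (root_sqr e k 0 - k)) / 2.

Definition smooth_pos_deriv e k t : R := ((t - k) * (root_sqr e k t)^-1 + 1) / 2.

Lemma root_sqr_gt0 e k t : 0 < e -> 0 < root_sqr e k t.
Proof. by move=> e0; rewrite sqrtr_gt0 ltr_wpDl ?sqr_ge0// exprn_gt0. Qed.

Lemma sqr_root_sqr e k t : root_sqr e k t ^+ 2 = (t - k) ^+ 2 + e ^+ 2.
Proof. by rewrite sqr_sqrtr// addr_ge0 ?sqr_ge0. Qed.

Lemma smooth_pos0 e k : smooth_pos e k 0 = 0.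
Proof. by rewrite /smooth_pos sub0r subrr mul0r. Qed.

Lemma root_sqr_bounds e k t : 0 < e -> `|t - k| <= root_sqr e k t <= `|t - k| + e.
Proof.
move=> e0; have r0 := root_sqr_gt0 k t e0; have := sqr_root_sqr e k t.
rewrite -(real_normK (num_real (t - k))).
move: (root_sqr e k t) r0 (normr_ge0 (t - k)) => r; move: `|t - k| => a r0 a0 E.
by apply/andP; split; nra.
Qed.

(** Half the difference of two errors in [[0, e]]: that of [root_sqr] at [t], and that of the
    normalization at [0], where [k >= 0] identifies [|0 - k|] with [k]. *)
Lemma smooth_pos_approx e k t : 0 < e -> 0 <= k ->
  `|smooth_pos e k t - Num.max (t - k) 0| <= e.
Proof.
move=> e0 k0; have := root_sqr_bounds k t e0; have := root_sqr_bounds k 0 e0.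
rewrite /smooth_pos sub0r normrN (ger0_norm k0) => /andP[h1 h2] /andP[h3 h4].
rewrite maxEle ler_norml; case: (leP (t - k) 0) => tk.
  by move: h3 h4; rewrite ler0_norm// => h3 h4; lra.
by move: h3 h4; rewrite gtr0_norm// => h3 h4; lra.
Qed.

Lemma smooth_pos_deriv_itv e k t : 0 < e -> 0 <= smooth_pos_deriv e k t <= 1.
Proof.
move=> e0; have r0 := root_sqr_gt0 k t e0.
have /andP[+ _] := root_sqr_bounds k t e0.
have : `|t - k| <= root_sqr e k t -> `|(t - k) * (root_sqr e k t)^-1| <= 1.
  by rewrite normrM normfV (gtr0_norm r0) ler_pdivrMr// mul1r.
move=> /[apply]; rewrite ler_norml => /andP[? ?].
by rewrite /smooth_pos_deriv; apply/andP; split; lra.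
Qed.

(** For the two roots [r] and [q], [r^2 - q^2 = (t - u) ((t - k) + (u - k))], and each root
    dominates its own term; dividing by [r + q] shows that the root is 1-Lipschitz. *)
Lemma smooth_pos_lipschitz e k t u : 0 < e ->
  `|smooth_pos e k t - smooth_pos e k u| <= `|t - u|.
Proof.
move=> e0; have r0 := root_sqr_gt0 k t e0; have q0 := root_sqr_gt0 k u e0.
have r2 := sqr_root_sqr e k t; have q2 := sqr_root_sqr e k u.
have /andP[ar _] := root_sqr_bounds k t e0; have /andP[aq _] := root_sqr_bounds k u e0.
rewrite /smooth_pos; move: (root_sqr e k 0) => c.
move: (root_sqr e k t) (root_sqr e k u) r0 q0 r2 q2 ar aq => r q r0 q0 r2 q2 ar aq.
suff h : `|r - q| <= `|t - u|.
  rewrite (_ : _ - _ = ((r - q) + (t - u)) / 2); last by lra.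
  rewrite normrM [`|2^-1|]ger0_norm ?invr_ge0//; have := ler_normD (r - q) (t - u); lra.
have rq : 0 < r + q by rewrite addr_gt0.
rewrite -(ler_pM2r rq) -[in leLHS](gtr0_norm rq) -normrM.
rewrite (_ : (r - q) * (r + q) = (t - u) * ((t - k) + (u - k))); last first.
  by move: r2 q2; rewrite !expr2 => r2 q2; lra.
rewrite normrM ler_wpM2l//; apply: le_trans (ler_normD _ _) _; lra.
Qed.

(** The derivative is a polynomial in the inverse root and in [t - k], so that adjoining the inverse
    root yields an algebra stable under derivatives. *)
Lemma is_derive_root_sqrV e k t : 0 < e ->
  is_derive t 1 (fun u => (root_sqr e k u)^-1)
    (- (root_sqr e k t)^-1 ^+ 3 * (t - k)).
Proof.
move=> e0; have r0 := root_sqr_gt0 k t e0.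
have p0 : 0 < (t - k) ^+ 2 + e ^+ 2 by rewrite -sqr_root_sqr exprn_gt0.
have h1 : is_derive t 1 (fun u : R => (u - k) ^+ 2 + e ^+ 2) (2 * (t - k)).
  apply: is_derive_eq; rewrite /GRing.scale/=; ring.
have h2 : is_derive t 1 (root_sqr e k) _ :=
  @is_derive1_comp _ Num.sqrt _ t _ _ (is_derive1_sqrt p0) h1.
have r1 : root_sqr e k t != 0 by rewrite gt_eqF.
apply: is_derive_eq (is_deriveV r1 h2) _.
rewrite /GRing.scale/= -[Num.sqrt _]/(root_sqr e k t).
by field.
Qed.

Lemma is_derive_smooth_pos e k t : 0 < e ->
  is_derive t 1 (smooth_pos e k) (smooth_pos_deriv e k t).
Proof.
move=> e0; have r0 := root_sqr_gt0 k t e0.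
have p0 : 0 < (t - k) ^+ 2 + e ^+ 2 by rewrite -sqr_root_sqr exprn_gt0.
have h1 : is_derive t 1 (fun u : R => (u - k) ^+ 2 + e ^+ 2) (2 * (t - k)).
  apply: is_derive_eq; rewrite /GRing.scale/=; ring.
have h2 : is_derive t 1 (root_sqr e k) _ :=
  @is_derive1_comp _ Num.sqrt _ t _ _ (is_derive1_sqrt p0) h1.
rewrite (_ : smooth_pos e k = fun u =>
  (1/2) * (root_sqr e k u + (u - k) - (root_sqr e k 0 - k))); last first.
  by apply/funext => u; rewrite /smooth_pos mulrC div1r.
apply: is_derive_eq; rewrite /GRing.scale/= /smooth_pos_deriv.
rewrite -[Num.sqrt _]/(root_sqr e k t); field; by rewrite gt_eqF.
Qed.

Lemma continuous_smooth_pos e k : 0 < e -> continuous (smooth_pos e k).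
Proof.
move=> e0 t; apply: differentiable_continuous; apply/derivable1_diffP.
by have [] := is_derive_smooth_pos k t e0.
Qed.
End smooth_positive_part.

Section test_functions.
Context {R : realType} {d : nat}.
Implicit Types (Om : set 'rV[R]_d) (phi psi : 'rV[R]_d -> R).

Lemma smooth_is_derive phi i x : smooth phi ->
  is_derive x (delta_mx ord0 i) phi (partial_derivative i phi x).
Proof. by move=> /(_ [::])[_ /(_ i x)/derivableP]. Qed.

Lemma smooth_continuous phi : smooth phi -> continuous phi.
Proof. by move=> /(_ [::])[]. Qed.

Lemma smooth_partial phi i : smooth phi -> continuous (partial_derivative i phi).
Proof. by move=> /(_ [:: i])[]. Qed.

Lemma smooth_comp_smooth_pos (e k : R) phi : 0 < e -> smooth phi ->
  smooth (smooth_pos e k \o phi).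
Proof.
move=> e0 sphi.
pose r x := (root_sqr e k (phi x))^-1.
pose G := [set foldr partial_derivative phi l | l in [set: seq 'I_d]] `|` [set r].
have Gphi : generated_algebra G phi by apply: GeneratedGen; left; exists [::].
have Gr : generated_algebra G r by apply: GeneratedGen; right.
have GP : stable_partials G.
  move=> _ [[l _ <-]|->].
    have [cl dl] := sphi l; split=> // i.
    exists (foldr partial_derivative phi (i :: l)) => [|x].
      by apply: GeneratedGen; left; exists (i :: l).
    exact/derivableP.
  split=> [x|i].
    apply: (@continuous_comp _ _ _ phi (fun t => (root_sqr e k t)^-1)).
      exact: smooth_continuous.
    apply: differentiable_continuous; apply/derivable1_diffP.
    by have [] := is_derive_root_sqrV k (phi x) e0.
  exists ((cst (-1) \* ((r \* r) \* r)) \* (phi \+ cst (- k)) \*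
     partial_derivative i phi) => [|x].
    repeat apply: GeneratedMul => //; first exact: GeneratedCst.
      by apply: GeneratedAdd => //; exact: GeneratedCst.
    by apply: GeneratedGen; left; exists [:: i].
  have := is_derive_comp_line (is_derive_root_sqrV k (phi x) e0)
    (smooth_is_derive i x sphi).
  by move=> h; apply: (is_derive_eq h); rewrite /r /=; ring.
have GM := @GeneratedMul R d G; have GA := @GeneratedAdd R d G.
have GC := @GeneratedCst R d G.
(* The root is its square, a polynomial in [phi], times the generator [r]. *)
rewrite (_ : _ \o _ = cst (1/2) \* (((((phi \+ cst (- k)) \* (phi \+ cst (- k))) \+
   cst (e ^+ 2)) \* r) \+ (phi \+ cst (- root_sqr e k 0)))).
  apply: (generated_algebra_smooth GP); apply/GM; first exact: GC.
  apply/GA; last by apply/GA => //; exact: GC.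
  apply/GM => //; apply/GA; last exact: GC.
  by apply/GM; apply/GA => //; exact: GC.
apply/funext => x /=; rewrite /smooth_pos /r.
have := sqr_root_sqr e k (phi x); have := root_sqr_gt0 k (phi x) e0.
move: (root_sqr e k (phi x)) => q q0.
rewrite [(phi x - k) ^+ 2]expr2 => <-; field; by rewrite gt_eqF.
Qed.

Lemma test_function0 Om phi x : test_function Om phi -> ~ Om x -> phi x = 0.
Proof.
move=> [_ _ sub] nOx; apply/eqP/negPn/negP => px; apply/nOx/sub.
exact: subset_closure.
Qed.

Lemma partial_test_function0 Om phi i x : test_function Om phi ->
  ~ closure [set x | phi x != 0] x -> partial_derivative i phi x = 0.
Proof.
move=> _ nx; rewrite /partial_derivative.
rewrite -[RHS](@derive_cst _ _ _ (0 : R) x (delta_mx ord0 i)).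
apply: near_eq_derive.
have : open (~` closure [set x | phi x != 0]) by exact/closed_openC/closed_closure.
rewrite openE => /(_ x nx); rewrite /interior/=; apply: filterS => y ny.
by apply/eqP/negPn/negP => py; apply/ny/subset_closure.
Qed.

Lemma test_function_comp Om (e k : R) phi : 0 < e -> test_function Om phi ->
  test_function Om (smooth_pos e k \o phi).
Proof.
move=> e0 [sphi cphi sub].
have incl : closure [set x | (smooth_pos e k \o phi) x != 0] `<=`
    closure [set x | phi x != 0].
  apply: closure_subset => x /=; apply: contra => /eqP ->.
  by rewrite smooth_pos0.
split; first exact: smooth_comp_smooth_pos.
  by apply: subclosed_compact incl => //; exact: closed_closure.
exact: subset_trans incl sub.
Qed.

Lemma partial_smooth_pos_comp (e k : R) phi i x : 0 < e -> smooth phi ->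
  partial_derivative i (smooth_pos e k \o phi) x =
  smooth_pos_deriv e k (phi x) * partial_derivative i phi x.
Proof.
move=> e0 sphi; rewrite [LHS]/partial_derivative.
have [_ ->//] := is_derive_comp_line (is_derive_smooth_pos k (phi x) e0)
    (smooth_is_derive i x sphi).
Qed.

Lemma compact_supp_bounded (K : set 'rV[R]_d) (f : 'rV[R]_d -> R) :
  compact K -> continuous f -> (forall x, ~ K x -> f x = 0) ->
  exists2 M, 0 <= M & forall x, `|f x| <= M.
Proof.
move=> cK cf f0.
have /compact_bounded[M [Mr hM]] : compact (f @` K).
  by apply: continuous_compact => //; exact: continuous_subspaceT.
exists (`|M| + 1) => [|x]; first by rewrite addr_ge0.
have [Kx|/f0->] := pselect (K x); last by rewrite normr0 addr_ge0.
by apply: hM; [rewrite (le_lt_trans (ler_norm _))// ltrDl|exists x].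
Qed.

Lemma compact_cube (K : set 'rV[R]_d) : compact K ->
  exists2 r, 0 < r & K `<=` cube 0 r.
Proof.
move=> /compact_bounded[M [Mr hM]]; exists (`|M| + 2) => [|x Kx i].
  by rewrite ltr_wpDl.
rewrite mxE subr0; apply: le_lt_trans (normr_coord_le _ _) _.
apply: (@le_lt_trans _ _ (`|M| + 1)); last by rewrite ltrD2l ltrDl.
by apply: hM => //; rewrite (le_lt_trans (ler_norm _))// ltrDl.
Qed.

End test_functions.

(** * Translations and integration by parts *)

Section translation.
Context {R : realType} {d : nat}.
Notation leb := (lebesgue_rV d : {measure set 'rV[R]_d -> \bar R}).
Implicit Types (u v : 'rV[R]_d -> R) (a b : 'rV[R]_d).

Definition shift_fun a u := fun x : 'rV[R]_d => u (x + a).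

Lemma measurable_shift_fun a u : measurable_fun setT u ->
  measurable_fun setT (shift_fun a u).
Proof. by move=> m; exact: (measurableT_comp m (measurable_shift a)). Qed.

Lemma sqint_shift a u : measurable_fun setT u ->
  sqint leb setT (shift_fun a u) = sqint leb setT u.
Proof.
move=> m; apply: (@ge0_integral_shift _ _ a (fun x => (u x ^+ 2)%:E)).
  exact: measurable_sqr.
by move=> x; rewrite lee_fin sqr_ge0.
Qed.

Lemma L2_shift a u : L2 leb setT u -> L2 leb setT (shift_fun a u).
Proof.
move=> /(L2P _ measurableT)[m fin]; apply/(L2P _ measurableT); split.
  exact: measurable_shift_fun.
by rewrite sqint_shift.
Qed.

Lemma L2norm_shift a u : L2 leb setT u ->
  L2norm leb setT (shift_fun a u) = L2norm leb setT u.
Proof.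
move=> hu; have ha := L2_shift a hu.
apply/eqP; rewrite -(@eqrXn2 _ 2) ?L2norm_ge0//; apply/eqP/EFin_inj.
rewrite -!L2_sqint// sqint_shift//.
exact: L2_measurable hu.
Qed.

(** The [L^2] modulus of continuity of [u], subadditive in [a] by [translD]. *)
Definition transl u a : R := L2norm leb setT (fun x => u (x + a) - u x).

Lemma L2_transl u a : L2 leb setT u -> L2 leb setT (fun x => u (x + a) - u x).
Proof. by move=> hu; apply: L2B => //; exact: L2_shift. Qed.

Lemma transl_ge0 u a : 0 <= transl u a. Proof. exact: L2norm_ge0. Qed.

Lemma transl0 u : transl u 0 = 0.
Proof.
rewrite -[RHS](@L2norm0 _ _ _ leb setT measurableT); apply: eq_L2norm => x _.
by rewrite addr0 subrr.
Qed.

Lemma translD u a b : L2 leb setT u -> transl u (a + b) <= transl u a + transl u b.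
Proof.
move=> hu; have ha := L2_transl a hu; have hb := L2_transl b hu.
have hab := L2_shift b ha.
have -> : transl u (a + b) = L2norm leb setT
    (fun x => shift_fun b (fun x => u (x + a) - u x) x + (u (x + b) - u x)).
  by apply: eq_L2norm => x _; rewrite /shift_fun subrKA (addrC a b) addrA.
by apply: le_trans (L2normD measurableT hab hb) _; rewrite L2norm_shift.
Qed.

Lemma transl_sum u n (a : 'I_n -> 'rV[R]_d) : L2 leb setT u ->
  transl u (\sum_i a i) <= \sum_i transl u (a i).
Proof.
move=> hu; elim: n a => [|n IH] a; first by rewrite !big_ord0 transl0.
rewrite !big_ord_recr/=; apply: le_trans (translD _ _ hu) _.
by rewrite lerD2r; exact: IH.
Qed.

Lemma transl_lip u v a : L2 leb setT u -> L2 leb setT v ->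
  transl u a <= transl v a + 2 * L2norm leb setT (fun x => u x - v x).
Proof.
move=> hu hv; have hd := L2B measurableT hu hv; have hs := L2_shift a hd.
have -> : transl u a = L2norm leb setT (fun x => (v (x + a) - v x) +
   (shift_fun a (fun x => u x - v x) x + - (u x - v x))).
  by apply: eq_L2norm => x _; rewrite /shift_fun; lra.
have hN := L2N measurableT hd; have hv' := L2_transl a hv.
apply: le_trans (L2normD measurableT hv' (L2D measurableT hs hN)) _.
rewrite lerD2l; apply: le_trans (L2normD measurableT hs hN) _.
by rewrite L2norm_shift// L2normN// mulr_natl mulr2n.
Qed.

Lemma integral_shift a (f : 'rV[R]_d -> R) : leb.-integrable setT (EFin \o f) ->
  \int[leb]_x (f (x + a)) = \int[leb]_x f x.
Proof.
move=> /integrableP[mf _]; rewrite /Rintegral; congr fine.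
rewrite integralE [RHS]integralE; congr (_ - _)%E.
  rewrite -[RHS](@ge0_integral_shift _ _ a (EFin \o f)^\+%E)//.
    by apply: eq_integral => x _; rewrite !funeposE.
  exact: measurable_funepos.
rewrite -[RHS](@ge0_integral_shift _ _ a (EFin \o f)^\-%E)//.
  by apply: eq_integral => x _; rewrite !funenegE.
exact: measurable_funeneg.
Qed.

Lemma integrable_shift a (f : 'rV[R]_d -> R) : leb.-integrable setT (EFin \o f) ->
  leb.-integrable setT (EFin \o shift_fun a f).
Proof.
move=> /integrableP[mf fin]; apply/integrableP; split.
  by apply/measurable_EFinP; apply: measurable_shift_fun; exact/measurable_EFinP.
rewrite (@ge0_integral_shift _ _ a (fun x => `|(f x)%:E|%E))//.
exact: measurableT_comp.
Qed.

(** Differentiability in one direction only, so that a product of two test functions is an instance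
    without a proof of its smoothness. The bounds and the support provide majorants for dominated
    convergence. *)
Record compact_C1 (i : 'I_d) (chi dchi : 'rV[R]_d -> R) (M r : R) : Prop := {
  cC1_continuous : continuous chi ;
  cC1_derive : forall x, is_derive x (delta_mx ord0 i) chi (dchi x) ;
  cC1_dcontinuous : continuous dchi ;
  cC1_M : 0 <= M ;
  cC1_r : 0 <= r ;
  cC1_bound : forall x, `|chi x| <= M /\ `|dchi x| <= M ;
  cC1_supp : forall x, chi x != 0 -> cube 0 r x }.

Section compact_C1_theory.
Variables (i : 'I_d) (chi dchi : 'rV[R]_d -> R) (M r : R).
Hypothesis H : compact_C1 i chi dchi M r.
Let e : 'rV[R]_d := delta_mx ord0 i.

Lemma cC1_lipschitz (h : R) x : `|chi (x + h *: e) - chi x| <= `|h| * M.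
Proof.
have D t : is_derive t (1 : R) (fun t : R => chi (t *: e + x)) (dchi (t *: e + x)).
  by apply: is_derive_line; exact: cC1_derive H _.
have cont : continuous (fun t : R => chi (t *: e + x)).
  move=> t; apply: differentiable_continuous; apply/derivable1_diffP.
  by have [] := D t.
have [h0|h0] := leP 0 h.
  have [c _ E] := @MVT_segment R _ _ 0 h h0 (fun t _ => D t) (continuous_subspaceT cont).
  move: E; rewrite scale0r add0r subr0 (addrC _ x) => ->.
  by rewrite normrM mulrC ler_wpM2l//; have [] := cC1_bound H (c *: e + x).
have [c _ E] := @MVT_segment R _ _ h 0 (ltW h0) (fun t _ => D t) (continuous_subspaceT cont).
move: E; rewrite scale0r add0r sub0r (addrC _ x) distrC => ->.
by rewrite normrM normrN mulrC ler_wpM2l//; have [] := cC1_bound H (c *: e + x).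
Qed.

(** For [|h| <= 1] both points lie outside the support once [x] leaves the cube of radius [r + 1];
    after division by [|h|] the majorant is integrable and independent of [h]. *)
Lemma diffquot_bound (h : R) x : `|h| <= 1 ->
  `|chi (x + h *: e) - chi x| <= `|h| * (M * \1_(cube 0 (r + 1)) x).
Proof.
move=> h1; have hM := cC1_lipschitz h x.
rewrite indicE; case: (boolP (x \in cube 0 (r + 1))) => [_|nx]; first by rewrite mulr1.
rewrite mulr0 mulr0; suff [-> ->] : chi (x + h *: e) = 0 /\ chi x = 0 by rewrite subrr normr0.
split; apply/eqP/negPn/negP => /(cC1_supp H) hx; move/negP: nx; apply; rewrite inE => j.
  have E : (x + h *: e) ord0 j = x ord0 j + h * e ord0 j by rewrite !mxE.
  have hb : `|h * e ord0 j| <= 1.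
    rewrite normrM; apply: le_trans h1; rewrite -[leRHS]mulr1 ler_wpM2l// /e mxE.
    by case: (_ && _); rewrite ?normr1 ?normr0.
  have := hx j; rewrite E [X in _ - X]mxE subr0 => hj.
  rewrite [X in _ - X]mxE subr0 -(addrK (h * (e ord0 j)) (x ord0 j)).
  by apply: le_lt_trans (ler_normB _ _) _; rewrite ltr_leD.
by apply: lt_trans (hx j) _; rewrite ltrDl ltr01.
Qed.

Lemma cC1_measurable : measurable_fun setT chi.
Proof. by apply: continuous_measurable_rV; exact: cC1_continuous H. Qed.

Lemma cC1_dmeasurable : measurable_fun setT dchi.
Proof. by apply: continuous_measurable_rV; exact: cC1_dcontinuous H. Qed.

Definition diffquot (h : R) x := h^-1 * (chi (x + h *: e) - chi x).

Lemma measurable_diffquot h : measurable_fun setT (diffquot h).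
Proof.
apply: measurable_funM => //; apply: measurable_funB; last exact: cC1_measurable.
exact: measurable_shift_fun cC1_measurable.
Qed.

Lemma diffquot_le h x : h != 0 -> `|h| <= 1 ->
  `|diffquot h x| <= M * \1_(cube 0 (r + 1)) x.
Proof.
move=> h0 h1; rewrite /diffquot normrM normfV ler_pdivrMl ?normr_gt0//.
exact: diffquot_bound.
Qed.

Lemma diffquot_cvg (h : nat -> R) x : (forall n, h n != 0) -> h @ \oo --> (0 : R) ->
  diffquot (h n) x @[n --> \oo] --> dchi x.
Proof.
move=> hn0 hn; have [D E] := cC1_derive H x.
rewrite -E; have /cvgr_dnbhsP/(_ h (conj hn0 hn)) := D : cvg _.
by move=> hh; under eq_fun do rewrite /diffquot (addrC x); exact: hh.
Qed.

Let B := cube (0 : 'rV[R]_d) (r + 1).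

Let mB : measurable B. Proof. exact: measurable_cube. Qed.

Let B_fin : (leb B < +oo)%E.
Proof.
have r0 : 0 <= r + 1 by rewrite addr_ge0// (cC1_r H).
by rewrite [leb B](lebesgue_cube 0 r0) ltry.
Qed.

Lemma integrable_bump (c : R) : leb.-integrable setT (fun x => (c * \1_B x)%:E).
Proof.
under eq_fun do rewrite EFinM; apply: integrableZl => //.
apply/integrableP; split; first exact/measurable_EFinP/measurable_indic.
under eq_integral do rewrite gee0_abs ?lee_fin//.
by rewrite integral_indic// setIT.
Qed.

Let h (n : nat) : R := n.+1%:R^-1.

Let h0 n : h n != 0. Proof. by rewrite invr_eq0. Qed.

Let h1 n : `|h n| <= 1.
Proof. by rewrite ger0_norm ?invr_ge0// invf_le1// ler1n. Qed.

Lemma cC1_le x : `|chi x| <= M * \1_B x.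
Proof.
have [->|/(cC1_supp H) hx] := eqVneq (chi x) 0.
  by rewrite normr0 mulr_ge0 ?(cC1_M H)// indicE.
rewrite indicE mem_set ?mulr1; first by have [] := cC1_bound H x.
by move=> j; apply: lt_trans (hx j) _; rewrite ltrDl ltr01.
Qed.

Lemma cC1_dle x : `|dchi x| <= M * \1_B x.
Proof.
have hcvg : h @ \oo --> (0 : R) by exact: cvg_harmonic.
have dq := @diffquot_cvg h x h0 hcvg.
have : `|diffquot (h n) x| @[n --> \oo] --> `|dchi x| by exact: cvg_norm.
move=> /[dup] /cvg_lim <-//; move=> cv; apply: limr_le; first exact: cv.
by apply: nearW => n; exact: diffquot_le.
Qed.

Lemma le_bump_integrable (f : 'rV[R]_d -> R) (c : R) : measurable_fun setT f ->
  (forall x, `|f x| <= c * \1_B x) -> leb.-integrable setT (EFin \o f).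
Proof.
move=> mf hf; apply: (le_integrable measurableT) (integrable_bump c).
  exact/measurable_EFinP.
by move=> x _ /=; rewrite lee_fin; apply: le_trans (hf x) (ler_norm _).
Qed.

Lemma cC1_integrable : leb.-integrable setT (EFin \o chi).
Proof. exact: le_bump_integrable cC1_measurable cC1_le. Qed.

Lemma integral_diffquot t : \int[leb]_x diffquot t x = 0.
Proof.
have hs := integrable_shift (t *: e) cC1_integrable.
rewrite /diffquot RintegralZl//; last exact: (integrableB measurableT hs cC1_integrable).
rewrite RintegralB//; last exact: cC1_integrable.
by rewrite integral_shift ?subrr ?mulr0//; exact: cC1_integrable.
Qed.

(** Translation invariance makes the integral of each difference quotient zero, and dominated
    convergence passes to the derivative; integration by parts follows from this. *)
Lemma integral_partial0 : \int[leb]_x dchi x = 0.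
Proof.
have hcvg : h @ \oo --> (0 : R) by exact: cvg_harmonic.
have mq n : measurable_fun setT (EFin \o diffquot (h n)).
  by apply/measurable_EFinP; exact: measurable_diffquot.
have md : measurable_fun setT (EFin \o dchi) by apply/measurable_EFinP; exact: cC1_dmeasurable.
have := @dominated_convergence _ _ _ leb setT measurableT
  (fun n => EFin \o diffquot (h n)) (EFin \o dchi) (fun x => (M * \1_B x)%:E) mq md.
case.
- by apply: aeW => x _; apply: cvg_EFin; [exact: nearW|exact: diffquot_cvg].
- exact: integrable_bump.
- by apply: aeW => x n _; rewrite lee_fin; exact: diffquot_le.
move=> _ _ /cvg_lim; rewrite /Rintegral => <-//.
have E n : (\int[leb]_x (EFin \o diffquot (h n)) x = 0)%E.
  rewrite -[LHS]fineK; last first.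
    apply: integrable_fin_num => //; apply: le_bump_integrable (M) _ _.
      exact: measurable_diffquot.
    by move=> x; exact: diffquot_le.
  by congr EFin; exact: integral_diffquot.
by rewrite (_ : [sequence _]_n = cst 0%E) ?lim_cst//; apply/funext.
Qed.

Lemma le_bump_L2 (f : 'rV[R]_d -> R) (c : R) : measurable_fun setT f ->
  (forall x, `|f x| <= c * \1_B x) -> L2 leb setT f.
Proof.
move=> mf hf; apply/(L2P _ measurableT); split => //.
have /integrableP[_] : leb.-integrable setT (EFin \o (fun x => f x ^+ 2)).
  apply: (@le_bump_integrable _ (c ^+ 2)); first exact: measurable_funX.
  move=> x; rewrite normrX; have := hf x; rewrite indicE.
  case: (_ \in _); rewrite ?mulr1 ?mulr0 => hx.
    by rewrite lerXn2r ?nnegrE// (le_trans _ hx).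
  by rewrite normr_le0 in hx; rewrite (eqP hx) normr0 expr0n.
by apply: le_lt_trans; apply: ge0_le_integral => //;
  [move=> x _; rewrite lee_fin sqr_ge0|exact: measurable_sqr|
   apply: measurableT_comp => //; exact: measurable_sqr|move=> x _; exact: lee_abs].
Qed.

Lemma cC1_L2 : L2 leb setT chi.
Proof. exact: le_bump_L2 cC1_measurable cC1_le. Qed.

Lemma cC1_dL2 : L2 leb setT dchi.
Proof. exact: le_bump_L2 cC1_dmeasurable cC1_dle. Qed.

Lemma diffquot_L2 t : t != 0 -> `|t| <= 1 -> L2 leb setT (diffquot t).
Proof.
move=> t0 t1; apply: le_bump_L2 (measurable_diffquot t) _ => x.
exact: diffquot_le.
Qed.

Lemma L2norm_diffquot_cvg (t : nat -> R) : (forall n, t n != 0) -> (forall n, `|t n| <= 1) ->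
  t @ \oo --> (0 : R) ->
  L2norm leb setT (diffquot (t n)) @[n --> \oo] --> L2norm leb setT dchi.
Proof.
move=> t0 t1 tcvg.
have mq n : measurable_fun setT (fun x => (diffquot (t n) x ^+ 2)%:E).
  by apply: measurable_sqr; exact: measurable_diffquot.
have md : measurable_fun setT (fun x => (dchi x ^+ 2)%:E).
  by apply: measurable_sqr; exact: cC1_dmeasurable.
have := @dominated_convergence _ _ _ leb setT measurableT
  (fun n x => (diffquot (t n) x ^+ 2)%:E) (fun x => (dchi x ^+ 2)%:E)
  (fun x => (M ^+ 2 * \1_B x)%:E) mq md.
case.
- apply: aeW => x _; apply: cvg_EFin; first exact: nearW.
  rewrite /comp/=; under eq_fun do rewrite expr2.
  by rewrite expr2; apply: cvgM; exact: diffquot_cvg.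
- exact: integrable_bump.
- apply: aeW => x n _; rewrite lee_fin ger0_norm ?sqr_ge0//.
  have := diffquot_le x (t0 n) (t1 n); rewrite -(real_normK (num_real (diffquot (t n) x))).
  rewrite indicE; case: (_ \in _); rewrite ?mulr1 ?mulr0 => hx.
    by rewrite lerXn2r ?nnegrE// (le_trans _ hx).
  by rewrite normr_le0 in hx; rewrite (eqP hx) normr0 expr0n.
move=> _ _ hcv.
have E u : L2 leb setT u -> L2norm leb setT u = Num.sqrt (fine (sqint leb setT u)).
  by move=> hu; rewrite L2_sqint//= sqrtr_sqr ger0_norm// L2norm_ge0.
rewrite E; last exact: cC1_dL2.
under eq_fun => n do rewrite (E _ (diffquot_L2 (t0 n) (t1 n))).
apply: (@cvg_comp _ _ _ _ Num.sqrt); last exact: sqrt_continuous.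
apply: fine_cvg; rewrite fineK; last by rewrite L2_sqint//; exact: cC1_dL2.
exact: hcv.
Qed.

Lemma transl_natmul n a : transl chi (n%:R *: a) <= n%:R * transl chi a.
Proof.
have := @transl_sum chi n (fun=> a) cC1_L2.
by rewrite !sumr_const card_ord scaler_nat mulr_natl.
Qed.

(** A translation by [t] is a chain of [n] translations by [t / n], each costing [|t| / n] times the
    norm of a difference quotient; then [n] tends to infinity. *)
Lemma transl_cC1_le t : transl chi (t *: e) <= `|t| * L2norm leb setT dchi.
Proof.
have [->|t0] := eqVneq t 0; first by rewrite scale0r transl0 normr0 mul0r.
have [K hK] : exists K : nat, `|t| <= K%:R.
  by exists (Num.truncn `|t|).+1; rewrite ltW// truncnS_gt.
(* Starting at [K >= |t|] keeps the step sizes at most [1], where the majorant of the difference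
   quotients is valid. *)
pose u n := t / (n + K).+1%:R.
have u0 n : u n != 0 by rewrite mulf_neq0// invr_eq0.
have u1 n : `|u n| <= 1.
  rewrite normrM normfV normr_nat ler_pdivrMr ?mul1r//.
  by apply: le_trans hK _; rewrite ler_nat leqW// leq_addl.
have ucvg : u @ \oo --> (0 : R).
  rewrite -[X in _ --> X](mulr0 t); apply: cvgM; first exact: cvg_cst.
  have := @cvg_harmonic R; rewrite -(cvg_shiftn K).
  by apply: cvg_trans; apply: near_eq_cvg; exact: nearW.
have hcv := L2norm_diffquot_cvg u0 u1 ucvg.
have hcv' : `|t| * L2norm leb setT (diffquot (u n)) @[n --> \oo] -->
    `|t| * L2norm leb setT dchi by apply: cvgM => //; exact: cvg_cst.
rewrite -(cvg_lim _ hcv')//; apply: limr_ge; first by apply/cvg_ex; eexists; exact: hcv'.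
apply: nearW => n.
have -> : t *: e = (n + K).+1%:R *: (u n *: e).
  by rewrite scalerA /u mulrC divfK// pnatr_eq0.
apply: le_trans (transl_natmul _ _) _.
have -> : transl chi (u n *: e) = `|u n| * L2norm leb setT (diffquot (u n)).
  rewrite -L2normZ//; last exact: diffquot_L2.
  by apply: eq_L2norm => x _; rewrite /diffquot mulrA mulfV// mul1r.
by rewrite mulrA /u normrM normfV normr_nat [X in X * _]mulrC divfK// pnatr_eq0.
Qed.

End compact_C1_theory.
End translation.

Section L2_restriction.
Context {R : realType} {disp : measure_display} {T : measurableType disp}.
Variables (mu : {measure set T -> \bar R}).
Implicit Types (u v : T -> R) (D : set T).

Lemma L2_restrict D u : L2 mu setT (u \_ D) = L2 mu D u.
Proof. by rewrite /L2/= patch_setT. Qed.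

Lemma L2norm_restrict D u : L2norm mu setT (u \_ D) = L2norm mu D u.
Proof. by rewrite /L2norm patch_setT. Qed.

Lemma restrict_id D u : (forall x, ~ D x -> u x = 0) -> u \_ D = u.
Proof.
move=> u0; apply/funext => x; rewrite /patch; case: ifPn => // /negP.
by rewrite inE => /u0.
Qed.

Lemma Rintegral_restrict D u : (forall x, ~ D x -> u x = 0) ->
  \int[mu]_(x in D) u x = \int[mu]_x u x.
Proof. by move=> u0; rewrite Rintegral_mkcond restrict_id. Qed.

Lemma L2S D u : measurable D -> L2 mu setT u -> L2 mu D u.
Proof.
move=> mD hu; rewrite -L2_restrict.
have m := L2_measurable measurableT hu.
apply: (L2_le measurableT _ hu).
  by apply/(measurable_restrictT _ mD).1; exact: measurable_funS m.
by move=> x _; rewrite /patch; case: ifPn; rewrite ?normr0.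
Qed.
End L2_restriction.

(** * Weak gradients and translation estimates in [H^1_0] *)

Section H10_theory.
Context {R : realType} {d : nat}.
Notation leb := (lebesgue_rV d : {measure set 'rV[R]_d -> \bar R}).
Variable Om : set 'rV[R]_d.
Hypotheses (d_gt0 : (0 < d)%N) (oOm : open Om).
Implicit Types (phi psi v : 'rV[R]_d -> R).

Let mOm : measurable Om. Proof. exact: open_measurable_rV. Qed.

Lemma test_partial0 phi i x : test_function Om phi -> ~ Om x ->
  partial_derivative i phi x = 0.
Proof.
move=> tphi nOx; apply: (partial_test_function0 _ tphi) => cx; apply: nOx.
by case: tphi => _ _; exact.
Qed.

Lemma test_compact_C1 phi i : test_function Om phi ->
  exists M r, compact_C1 i phi (partial_derivative i phi) M r.
Proof.
move=> tphi; have [sphi cphi sub] := tphi.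
have [r r0 hr] := compact_cube cphi.
have phi0 x : ~ closure [set x | phi x != 0] x -> phi x = 0.
  move=> nx; apply/eqP/negPn/negP => px; apply: nx; exact: subset_closure.
have [M1 M10 hM1] := compact_supp_bounded cphi (smooth_continuous sphi) phi0.
have [M2 M20 hM2] := compact_supp_bounded cphi (@smooth_partial _ _ phi i sphi)
  (fun x nx => @partial_test_function0 _ _ _ _ i _ tphi nx).
exists (M1 + M2), r; split.
- exact: smooth_continuous.
- by move=> x; exact: smooth_is_derive.
- exact: smooth_partial.
- exact: addr_ge0.
- exact: ltW.
- by move=> x; split; [rewrite ler_wpDr//|rewrite ler_wpDl].
- by move=> x px; apply: hr; exact: subset_closure.
Qed.

Lemma test_L2T phi : test_function Om phi -> L2 leb setT phi.
Proof.
move=> tphi; have [M [r H]] := test_compact_C1 (Ordinal d_gt0) tphi.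
exact: cC1_L2 H.
Qed.

Lemma test_partial_L2T phi i : test_function Om phi ->
  L2 leb setT (partial_derivative i phi).
Proof. by move=> tphi; have [M [r H]] := test_compact_C1 i tphi; exact: cC1_dL2 H. Qed.

Lemma test_L2 phi : test_function Om phi -> L2 leb Om phi.
Proof. by move=> ?; apply: L2S => //; exact: test_L2T. Qed.

Lemma test_partial_L2 phi i : test_function Om phi ->
  L2 leb Om (partial_derivative i phi).
Proof. by move=> ?; apply: L2S => //; exact: test_partial_L2T. Qed.

Lemma L2norm_test_partialT phi i : test_function Om phi ->
  L2norm leb setT (partial_derivative i phi) = L2norm leb Om (partial_derivative i phi).
Proof.
by move=> t; rewrite -[RHS]L2norm_restrict restrict_id// => x; exact: test_partial0.
Qed.

Lemma test_mul_compact_C1 phi psi i : test_function Om phi -> test_function Om psi ->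
  exists M r, compact_C1 i (fun x => phi x * psi x)
    (fun x => phi x * partial_derivative i psi x + psi x * partial_derivative i phi x) M r.
Proof.
move=> tphi tpsi.
have [M [r [cp dp dcp M0 r0 bp sp]]] := test_compact_C1 i tphi.
have [N [q [cq dq dcq N0 q0 bq sq]]] := test_compact_C1 i tpsi.
exists (M * N + N * M), r; split => //.
- by move=> x; apply: continuousM; [exact: cp|exact: cq].
- by move=> x; exact: is_deriveM (dp x) (dq x).
- by move=> x; exact: (cvgD (cvgM (cp x) (dcq x)) (cvgM (cq x) (dcp x))).
- by rewrite addr_ge0// mulr_ge0.
- move=> x; have [p1 p2] := bp x; have [q1 q2] := bq x; split.
    by rewrite normrM ler_wpDr ?mulr_ge0// ler_pM.
  by apply: le_trans (ler_normD _ _) _; rewrite !normrM lerD// ler_pM.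
- move=> x pq; apply: sp; apply: contra pq => /eqP ->; by rewrite mul0r.
Qed.

Lemma test_by_parts phi psi i : test_function Om phi -> test_function Om psi ->
  L2inner Om phi (partial_derivative i psi) = - L2inner Om (partial_derivative i phi) psi.
Proof.
move=> tphi tpsi; have [M [r H]] := test_mul_compact_C1 i tphi tpsi.
have := integral_partial0 H.
rewrite /L2inner !(@Rintegral_restrict _ _ _ leb Om); last 2 first.
- by move=> x nx; rewrite (test_function0 tpsi nx) mulr0.
- by move=> x nx; rewrite (test_function0 tphi nx) mul0r.
rewrite RintegralD//; last 2 first.
- exact: L2_integrableM (test_L2T tphi) (test_partial_L2T i tpsi).
- exact: L2_integrableM (test_L2T tpsi) (test_partial_L2T i tphi).
move/eqP; rewrite addr_eq0 => /eqP ->; congr (- _).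
by apply: eq_Rintegral => x _; rewrite mulrC.
Qed.

Lemma test_H10 phi : test_function Om phi ->
  H10 Om phi (fun i => partial_derivative i phi).
Proof.
move=> tphi; split.
- exact: test_L2.
- by move=> i; exact: test_partial_L2.
- by move=> i psi tpsi; exact: test_by_parts.
move=> e e0; exists phi => //.
have z (u : 'rV[R]_d -> R) : L2norm leb Om (u \- u) <= e.
  rewrite (@eq_L2norm _ _ _ _ _ _ (fun=> 0)); first by rewrite L2norm0// ltW.
  by move=> x _; rewrite /= subrr.
by split => // i; exact: z.
Qed.

(** For test functions this is [transl_cC1_le]; both sides are continuous for the convergence that
    defines [H10], the left one by [transl_lip]. *)
Lemma H10_transl v (G : 'I_d -> 'rV[R]_d -> R) i t : H10 Om v G ->
  transl (v \_ Om) (t *: delta_mx ord0 i) <= `|t| * L2norm leb Om (G i).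
Proof.
move=> [hv hG _ happ]; apply/ler_addgt0Pr => e e0.
(* The error [e'] of the gradient gets multiplied by [|t|], and [transl_lip] costs [2 e'] more. *)
have e'0 : 0 < e / (`|t| + 2) by rewrite divr_gt0// ltr_wpDl.
set e' := e / _ in e'0.
have [phi tphi [vphi Gphi]] := happ _ e'0.
have hvT : L2 leb setT (v \_ Om) by rewrite L2_restrict.
apply: le_trans (transl_lip _ hvT (test_L2T tphi)) _.
have -> : L2norm leb setT (fun x => (v \_ Om) x - phi x) = L2norm leb Om (v \- phi).
  rewrite -[RHS]L2norm_restrict; apply: eq_L2norm => x _; rewrite /patch.
  by case: ifPn => // /negP; rewrite inE => /(test_function0 tphi) ->; rewrite subrr.
have [M [r H]] := test_compact_C1 i tphi.
have h1 := transl_cC1_le H t; rewrite (L2norm_test_partialT _ tphi) in h1.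
have h2 : L2norm leb Om (partial_derivative i phi) <= L2norm leb Om (G i) + e'.
  have hN := L2N mOm (L2B mOm (hG i) (test_partial_L2 i tphi)).
  rewrite (@eq_L2norm _ _ _ _ _ _ (fun x => G i x + - (G i x - partial_derivative i phi x))).
    apply: le_trans (L2normD mOm (hG i) hN) _; rewrite lerD2l L2normN; first exact: Gphi.
      exact: mOm.
    exact: (L2B mOm (hG i) (test_partial_L2 i tphi)).
  by move=> x _; rewrite opprB addrC subrK.
have -> : e = `|t| * e' + 2 * e' by rewrite -mulrDl mulrC divfK// gt_eqF// ltr_wpDl.
rewrite addrA -mulrDr lerD//; last by rewrite ler_wpM2l.
by apply: le_trans h1 _; rewrite ler_wpM2l.
Qed.

End H10_theory.

(** * Linear combinations in [H^1_0] *)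

Section spectral.
Context {R : realType} {d : nat}.
Notation leb := (lebesgue_rV d : {measure set 'rV[R]_d -> \bar R}).
Variable Om : set 'rV[R]_d.
Hypotheses (d_gt0 : (0 < d)%N) (oOm : open Om) (bOm : bounded_set Om).
Implicit Types (phi psi u v w : 'rV[R]_d -> R) (c : nat -> R).

Let mOm : measurable Om. Proof. exact: open_measurable_rV. Qed.

Lemma L2innerE (D : set 'rV[R]_d) u v : L2inner D u v = ip leb D u v.
Proof. by []. Qed.

Lemma test_function_lin (a b : R) phi psi : test_function Om phi -> test_function Om psi ->
  test_function Om (fun x => a * phi x + b * psi x).
Proof.
move=> [sphi cphi subphi] [spsi cpsi subpsi].
have incl : closure [set x | a * phi x + b * psi x != 0] `<=`
    closure [set x | phi x != 0] `|` closure [set x | psi x != 0].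
  rewrite -closureU; apply: closure_subset => x /= h.
  have [p0|p0] := eqVneq (phi x) 0; last by left.
  right; apply: contra h => /eqP ->; by rewrite p0 !mulr0 addr0.
split.
- pose G := [set foldr partial_derivative phi l | l in [set: seq 'I_d]] `|`
    [set foldr partial_derivative psi l | l in [set: seq 'I_d]].
  have GP : stable_partials G.
    move=> _ [[l _ <-]|[l _ <-]].
      have [cl dl] := sphi l; split=> // i.
      exists (foldr partial_derivative phi (i :: l)) => [|x].
        by apply: GeneratedGen; left; exists (i :: l).
      exact/derivableP.
    have [cl dl] := spsi l; split=> // i.
    exists (foldr partial_derivative psi (i :: l)) => [|x].
      by apply: GeneratedGen; right; exists (i :: l).
    exact/derivableP.
  apply: (generated_algebra_smooth GP).
  apply: (@GeneratedAdd _ _ G (cst a \* phi) (cst b \* psi)).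
    apply: GeneratedMul; first exact: GeneratedCst.
    by apply: GeneratedGen; left; exists [::].
  apply: GeneratedMul; first exact: GeneratedCst.
  by apply: GeneratedGen; right; exists [::].
- apply: subclosed_compact incl; first exact: closed_closure.
  exact: compactU.
- by apply: subset_trans incl _ => x [/subphi|/subpsi].
Qed.

Lemma partial_lin (a b : R) phi psi i x : smooth phi -> smooth psi ->
  partial_derivative i (fun x => a * phi x + b * psi x) x =
  a * partial_derivative i phi x + b * partial_derivative i psi x.
Proof.
move=> sphi spsi.
have h1 := is_deriveZ a (smooth_is_derive i x sphi).
have h2 := is_deriveZ b (smooth_is_derive i x spsi).
by have [_ <-] := is_deriveD h1 h2.
Qed.

Lemma H10_lin (a b : R) u v (G H : 'I_d -> 'rV[R]_d -> R) : H10 Om u G -> H10 Om v H ->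
  H10 Om (fun x => a * u x + b * v x) (fun i x => a * G i x + b * H i x).
Proof.
move=> [hu hG pG aG] [hv hH pH aH].
have hau := L2Z mOm a hu; have hbv := L2Z mOm b hv.
have haG i := L2Z mOm a (hG i); have hbH i := L2Z mOm b (hH i).
split.
- exact: L2D.
- by move=> i; exact: L2D.
- move=> i phi tphi; have t2 := test_L2 d_gt0 oOm tphi.
  have t2' := test_partial_L2 oOm i tphi.
  have := pG i phi tphi; have := pH i phi tphi.
  by rewrite !L2innerE !ipDl// !ipZl// => -> ->; lra.
move=> e e0; have e'0 : 0 < e / (`|a| + `|b| + 1).
  by rewrite divr_gt0// ltr_wpDl// addr_ge0.
set e' := e / _ in e'0.
have e'e : `|a| * e' + `|b| * e' <= e.
  rewrite -mulrDl /e' mulrA ler_pdivrMr; last by rewrite ltr_wpDl// addr_ge0.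
  by rewrite mulrC ler_wpM2l ?(ltW e0)// lerDl.
have [phi tphi [up Gp]] := aG _ e'0; have [psi tpsi [vp Hp]] := aH _ e'0.
exists (fun x => a * phi x + b * psi x); first exact: test_function_lin.
have key (f g h k : 'rV[R]_d -> R) : L2 leb Om f -> L2 leb Om g -> L2 leb Om h -> L2 leb Om k ->
   L2norm leb Om (f \- h) <= e' -> L2norm leb Om (g \- k) <= e' ->
   L2norm leb Om (fun x => (a * f x + b * g x) - (a * h x + b * k x)) <= e.
  move=> hf hg hh hk fh gk; apply: le_trans e'e.
  have d1 := L2B mOm hf hh; have d2 := L2B mOm hg hk.
  rewrite (@eq_L2norm _ _ _ _ _ _ (fun x => a * (f x - h x) + b * (g x - k x))); last first.
    by move=> x _; ring.
  apply: le_trans (L2normD mOm (L2Z mOm a d1) (L2Z mOm b d2)) _.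
  by rewrite !L2normZ// lerD// ler_wpM2l.
split; first by apply: key => //; exact: test_L2.
move=> i; rewrite (@eq_L2norm _ _ _ _ _ _ (fun x => a * G i x + b * H i x -
  (a * partial_derivative i phi x + b * partial_derivative i psi x))).
  by apply: key (hG i) (hH i) _ _ (Gp i) (Hp i); exact: test_partial_L2.
by move=> x _ /=; rewrite partial_lin//; [case: tphi|case: tpsi].
Qed.

Lemma H10_0 : H10 Om (fun=> 0) (fun _ _ => 0).
Proof.
have t0 : test_function Om (fun=> 0).
  split.
  - move=> l; have -> : foldr partial_derivative (fun=> 0 : R) l = (fun=> 0 : R).
      elim: l => //= i l ->; apply/funext => x; exact: derive_cst.
    by split=> [x|i x]; [exact: cst_continuous|exact: derivable_cst].
  - rewrite (_ : [set _ | _] = set0) ?closure0; first exact: compact0.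
    by apply/seteqP; split => x //=; rewrite eqxx.
  - rewrite (_ : [set _ | _] = set0) ?closure0//.
    by apply/seteqP; split => x //=; rewrite eqxx.
have := test_H10 d_gt0 oOm t0.
rewrite (_ : (fun i : 'I_d => _) = (fun _ _ => 0))//.
by apply/funext => i; apply/funext => x; exact: derive_cst.
Qed.

End spectral.

(** * The maximum principle for the Dirichlet eigensystem *)

Definition pos_above {R : realType} {T : Type} (k : R) (w : T -> R) : T -> R :=
  fun x => Num.max (w x - k) 0.

Section pos_above_theory.
Context {R : realType} {disp : measure_display} {T : measurableType disp}.
Variables (mu : {measure set T -> \bar R}) (D : set T) (mD : measurable D).
Implicit Types (k : R) (w : T -> R).

Lemma pos_above_ge0 k w x : 0 <= pos_above k w x.
Proof. by rewrite /pos_above le_max lexx orbT. Qed.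

Lemma pos_above_le k w x : 0 <= k -> `|pos_above k w x| <= `|w x|.
Proof.
move=> k0; rewrite ger0_norm ?pos_above_ge0// /pos_above ge_max normr_ge0 andbT.
by have := ler_norm (w x); lra.
Qed.

Lemma measurable_pos_above k w : measurable_fun D w -> measurable_fun D (pos_above k w).
Proof. by move=> m; apply: measurable_maxr => //; exact: measurable_funB. Qed.

Lemma L2_pos_above k w : 0 <= k -> L2 mu D w -> L2 mu D (pos_above k w).
Proof.
move=> k0 hw; apply: (L2_le mD _ hw); last by move=> x _; exact: pos_above_le.
by apply: measurable_pos_above; exact: L2_measurable hw.
Qed.

Lemma pos_above_lip k (a b : R) : `|Num.max (a - k) 0 - Num.max (b - k) 0| <= `|a - b|.
Proof.
by rewrite !maxEle; case: (leP (a - k) 0); case: (leP (b - k) 0);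
  rewrite ler_norml => h1 h2; have := ler_norm (a - b); have := ler_norm (b - a);
  rewrite (distrC b); move: `|a - b| => q h3 h4; lra.
Qed.

Lemma L2_abs w : L2 mu D w -> L2 mu D (fun x => `|w x|).
Proof.
move=> hw; apply: (L2_le mD _ hw); last by move=> x _; rewrite normr_id.
by apply: measurableT_comp => //; exact: L2_measurable hw.
Qed.

Lemma L2norm_abs w : L2norm mu D (fun x => `|w x|) = L2norm mu D w.
Proof.
rewrite /L2norm -Lnorm_abse -[in RHS]Lnorm_abse; congr (fine (Lnorm _ _ _)).
apply/funext => x /=; rewrite /patch; case: ifPn => //= _.
by rewrite normr_id.
Qed.

(** Taking positive parts does not increase distances, and smoothing costs at most [e] at each
    point. *)
Lemma L2norm_smooth_pos k e u v : 0 <= k -> 0 < e -> L2 mu D (fun=> 1) ->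
  L2 mu D u -> L2 mu D v ->
  L2norm mu D (fun x => pos_above k u x - smooth_pos e k (v x)) <=
    L2norm mu D (fun x => u x - v x) + e * L2norm mu D (fun=> 1).
Proof.
move=> k0 e0 h1 hu hv.
have -> : e * L2norm mu D (fun=> 1) = L2norm mu D (fun=> e * 1) by rewrite L2normZ// gtr0_norm.
have hd := L2B mD hu hv; have hd' := L2_abs hd; have h1' := L2Z mD e h1.
have hs := L2D mD hd' h1'.
have ms : measurable_fun D (fun x => smooth_pos e k (v x)).
  apply: (measurableT_comp (f := smooth_pos e k)); last exact: L2_measurable hv.
  by apply: continuous_measurable_fun; exact: continuous_smooth_pos.
apply: (@le_trans _ _ (L2norm mu D (fun x => `|u x - v x| + e * 1))).
  apply: (L2norm_le mD _ hs).
    by apply: measurable_funB => //; exact: L2_measurable (L2_pos_above k0 hu).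
  move=> x _; rewrite mulr1 [leRHS]ger0_norm ?addr_ge0 ?(ltW e0)//.
  rewrite -(subrKA (pos_above k v x)); apply: le_trans (ler_normD _ _) _.
  by rewrite lerD ?pos_above_lip// distrC smooth_pos_approx.
apply: le_trans (L2normD mD hd' h1') _.
by rewrite lerD2r L2norm_abs.
Qed.
End pos_above_theory.

Section spectral.
Context {R : realType} {d : nat}.
Notation leb := (lebesgue_rV d : {measure set 'rV[R]_d -> \bar R}).
Variable Om : set 'rV[R]_d.
Hypotheses (d_gt0 : (0 < d)%N) (oOm : open Om) (bOm : bounded_set Om).
Variable E : dirichlet_eigensystem Om.
Implicit Types (phi psi u v w : 'rV[R]_d -> R) (c : nat -> R).

Let mOm : measurable Om. Proof. exact: open_measurable_rV. Qed.
Let f := eigfun E.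
Let G := eiggrad E.
Let lam := eigval E.

Let Hf n : H10 Om (f n) (G n). Proof. exact: eigfun_H10. Qed.
Let f2 n : L2 leb Om (f n). Proof. by case: (Hf n). Qed.
Let G2 n i : L2 leb Om (G n i). Proof. by case: (Hf n). Qed.

Definition coef u n : R := ip leb Om u (f n).

Definition comb c N : 'rV[R]_d -> R := fun x => \sum_(n < N) c n * f n x.

Definition gradcomb c N : 'I_d -> 'rV[R]_d -> R := fun i x => \sum_(n < N) c n * G n i x.

Lemma combS c N : comb c N.+1 = (fun x => comb c N x + c N * f N x).
Proof. by apply/funext => x; rewrite /comb big_ord_recr. Qed.

Lemma gradcombS c N i : gradcomb c N.+1 i = (fun x => gradcomb c N i x + c N * G N i x).
Proof. by apply/funext => x; rewrite /gradcomb big_ord_recr. Qed.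

Lemma comb_L2 c N : L2 leb Om (comb c N).
Proof. by apply: L2_sum => // n; exact: L2Z. Qed.

Lemma gradcomb_L2 c N i : L2 leb Om (gradcomb c N i).
Proof. by apply: L2_sum => // n; exact: L2Z. Qed.

Lemma comb_H10 c N : H10 Om (comb c N) (gradcomb c N).
Proof.
elim: N => [|N IH].
  rewrite (_ : comb c 0 = fun=> 0); last by apply/funext => x; rewrite /comb big_ord0.
  rewrite (_ : gradcomb c 0 = fun _ _ => 0); first exact: H10_0.
  by apply/funext => i; apply/funext => x; rewrite /gradcomb big_ord0.
have := H10_lin d_gt0 oOm 1 (c N) IH (Hf N).
rewrite (_ : (fun x => _) = comb c N.+1); last first.
  by apply/funext => x; rewrite combS mul1r.
rewrite (_ : (fun i x => _) = gradcomb c N.+1)//.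
by apply/funext => i; apply/funext => x; rewrite gradcombS mul1r.
Qed.

Lemma ip_comb c N v : L2 leb Om v -> ip leb Om (comb c N) v = \sum_(n < N) c n * coef v n.
Proof.
move=> hv; rewrite /comb (@ip_suml _ _ _ leb Om mOm _ _ (fun n : 'I_N => fun x => c n * f n x))//.
  by apply: eq_bigr => n _; rewrite ipZl// ipC.
by move=> n; exact: L2Z.
Qed.

Lemma ip_gradcomb c N i v : L2 leb Om v ->
  ip leb Om (gradcomb c N i) v = \sum_(n < N) c n * ip leb Om (G n i) v.
Proof.
move=> hv; rewrite /gradcomb (@ip_suml _ _ _ leb Om mOm _ _ (fun n : 'I_N => fun x => c n * G n i x))//.
  by apply: eq_bigr => n _; rewrite ipZl.
by move=> n; exact: L2Z.
Qed.

Lemma coef_comb c N n : coef (comb c N) n = if (n < N)%N then c n else 0.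
Proof.
rewrite /coef ip_comb//.
under eq_bigr do rewrite /coef -L2innerE eigfun_orthonormal mulr_natr mulrb.
rewrite -big_mkcond/=; case: ifPn => nN.
  by rewrite (big_pred1 (Ordinal nN))// => m; rewrite /= eq_sym -val_eqE.
rewrite big1// => m /eqP nm; move: nN; by rewrite nm ltn_ord.
Qed.

Lemma comb_norm c N : L2norm leb Om (comb c N) ^+ 2 = \sum_(n < N) c n ^+ 2.
Proof.
rewrite -ip_norm//; last exact: comb_L2.
rewrite ip_comb; last exact: comb_L2.
by apply: eq_bigr => n _; rewrite coef_comb ltn_ord expr2.
Qed.

Lemma coefB u v n : L2 leb Om u -> L2 leb Om v ->
  coef (fun x => u x - v x) n = coef u n - coef v n.
Proof. by move=> hu hv; rewrite /coef ipBl. Qed.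

Lemma coefZ a u n : L2 leb Om u -> coef (fun x => a * u x) n = a * coef u n.
Proof. by move=> hu; rewrite /coef ipZl. Qed.

Lemma coef_norm_cvg u : L2 leb Om u ->
  L2norm leb Om (fun x => u x - comb (coef u) N x) @[N --> \oo] --> (0 : R).
Proof. exact: eigfun_complete. Qed.

(** The weak equation is tested with the eigenfunction itself. *)
Lemma eig_ge0 n : 0 <= lam n.
Proof.
rewrite /lam; have := @eigfunE _ _ _ E n _ _ (Hf n); rewrite eigfun_orthonormal eqxx mulr1 => <-.
by apply: sumr_ge0 => i _; rewrite L2innerE ip_norm ?sqr_ge0.
Qed.

(** The Dirichlet energy is diagonal in the eigenbasis: the weak equation for each mode is tested
    with the whole combination, which lies in [H10]. *)
Lemma gradcomb_norm c N :
  \sum_i L2norm leb Om (gradcomb c N i) ^+ 2 = \sum_(n < N) lam n * c n ^+ 2.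
Proof.
transitivity (\sum_(n < N) c n * \sum_i L2inner Om (G n i) (gradcomb c N i)).
  under eq_bigr => i _.
    rewrite -ip_norm//; last exact: gradcomb_L2.
    rewrite ip_gradcomb; last exact: gradcomb_L2.
    over.
  rewrite exchange_big/=; apply: eq_bigr => n _; rewrite mulr_sumr.
  by apply: eq_bigr => i _; rewrite L2innerE.
apply: eq_bigr => n _; rewrite (@eigfunE _ _ _ E n _ _ (comb_H10 c N)) L2innerE ipC -/(coef _ n).
rewrite coef_comb ltn_ord /lam expr2; ring.
Qed.

(** The sum is the Dirichlet form of [z] and [(z - k)^+], formally the integral of [|grad z|^2] over
    [{z > k}]. To avoid weak derivatives of the positive part, [z] is replaced by a test function
    [psi] close to it in [H^1], and the positive part by [smooth_pos e k], whose derivative is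
    nonnegative; a negative sum contradicts this for small [e]. *)
Lemma max_principle c N k : 0 <= k ->
  0 <= \sum_(n < N) lam n * c n * coef (pos_above k (comb c N)) n.
Proof.
move=> k0; pose z := comb c N.
have hz : L2 leb Om z := comb_L2 c N.
have hv := L2_pos_above mOm k0 hz.
pose m := L2norm leb Om (fun=> 1).
have h1 : L2 leb Om (fun=> 1).
  apply/(L2P _ mOm); split; first exact: measurable_cst.
  rewrite /sqint expr1n integral_cst// mul1e.
  exact: bounded_lebesgue_rV.
have [hz10 _ _ happ] := comb_H10 c N.
(* The total factor of [e] in the two errors below: [energy_ge] for the gradients, [diff_le] for the
   coefficients. *)
pose C := \sum_i (L2norm leb Om (gradcomb c N i) + 1) +
  \sum_(n < N) `|lam n * c n| * (1 + m).
have C0 : 0 <= C.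
  apply: addr_ge0; apply: sumr_ge0 => ? _; first by rewrite addr_ge0// L2norm_ge0.
  by rewrite mulr_ge0// addr_ge0// L2norm_ge0.
rewrite leNgt; apply/negP; set S := \sum_(_ < _) _ => S0.
pose e := Num.min 1 (- S / (2 * (C + 1))).
have e0 : 0 < e by rewrite lt_min ltr01 divr_gt0 ?oppr_gt0// mulr_gt0// ltr_wpDl.
have e1 : e <= 1 by rewrite ge_min lexx.
have eS : e * (C + 1) < - S.
  have : e <= - S / (2 * (C + 1)) by rewrite ge_min lexx orbT.
  rewrite ler_pdivlMr ?mulr_gt0 ?ltr_wpDl// => h.
  by have := mulr_gt0 e0 (ltr_wpDl C0 (@ltr01 R)); lra.
have [psi tpsi [zp Gp]] := happ _ e0.
have hpsi := test_L2 d_gt0 oOm tpsi.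
have hdpsi i := test_partial_L2 oOm i tpsi.
pose zeta := smooth_pos e k \o psi.
have tz : test_function Om zeta := test_function_comp k e0 tpsi.
have hzeta := test_L2 d_gt0 oOm tz.
have hdz i := test_partial_L2 oOm i tz.
have approx : L2norm leb Om (fun x => pos_above k z x - zeta x) <= e * (1 + m).
  rewrite mulrDr mulr1; apply: le_trans (L2norm_smooth_pos mOm k0 e0 h1 hz hpsi) _.
  by rewrite lerD2r.
have dz_le i : L2norm leb Om (partial_derivative i zeta) <= L2norm leb Om (gradcomb c N i) + 1.
  apply: (@le_trans _ _ (L2norm leb Om (partial_derivative i psi))).
    apply: (L2norm_le mOm _ (hdpsi i)); first exact: L2_measurable (hdz i).
    move=> x _; rewrite partial_smooth_pos_comp//; last by case: tpsi.
    rewrite normrM ler_piMl//.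
    by have /andP[? ?] := smooth_pos_deriv_itv k (psi x) e0; rewrite ger0_norm.
  have hb := L2B mOm (gradcomb_L2 c N i) (hdpsi i).
  rewrite (@eq_L2norm _ _ _ _ _ _ (fun x => gradcomb c N i x +
      - (gradcomb c N i x - partial_derivative i psi x))); last first.
    by move=> x _; rewrite opprB addrC subrK.
  apply: le_trans (L2normD mOm (gradcomb_L2 c N i) (L2N mOm hb)) _.
  rewrite lerD2l L2normN//; apply: le_trans e1; exact: Gp.
have energy : \sum_(n < N) lam n * c n * coef zeta n =
    \sum_i ip leb Om (gradcomb c N i) (partial_derivative i zeta).
  under [RHS]eq_bigr do rewrite ip_gradcomb//.
  rewrite exchange_big/=; apply: eq_bigr => n _.
  have hE : \sum_i ip leb Om (G n i) (partial_derivative i zeta) = lam n * ip leb Om (f n) zeta.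
    exact: (@eigfunE _ _ _ E n _ _ (test_H10 d_gt0 oOm tz)).
  by rewrite -mulr_sumr hE /coef (ipC _ _ zeta); ring.
have energy_ge : - (e * \sum_i (L2norm leb Om (gradcomb c N i) + 1)) <=
    \sum_(n < N) lam n * c n * coef zeta n.
  rewrite energy mulr_sumr -sumrN; apply: ler_sum => i _.
  have hb := L2B mOm (gradcomb_L2 c N i) (hdpsi i).
  have -> : ip leb Om (gradcomb c N i) (partial_derivative i zeta) =
      ip leb Om (fun x => gradcomb c N i x - partial_derivative i psi x)
        (partial_derivative i zeta) +
      ip leb Om (partial_derivative i psi) (partial_derivative i zeta).
    by rewrite ipBl//; [ring|exact: gradcomb_L2].
  (* The gradient of [zeta] is a nonnegative multiple of that of [psi]. *)
  have h2 : 0 <= ip leb Om (partial_derivative i psi) (partial_derivative i zeta).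
    apply: Rintegral_ge0 => x _; rewrite partial_smooth_pos_comp//; last by case: tpsi.
    have /andP[? ?] := smooth_pos_deriv_itv k (psi x) e0.
    by rewrite mulrCA mulr_ge0// -expr2 sqr_ge0.
  have h3 := normr_ip_le mOm hb (hdz i).
  have h4 : L2norm leb Om (fun x => gradcomb c N i x - partial_derivative i psi x) *
      L2norm leb Om (partial_derivative i zeta) <=
      e * (L2norm leb Om (gradcomb c N i) + 1).
    by apply: ler_pM; rewrite ?L2norm_ge0//; exact: Gp.
  have := ler_norm (- ip leb Om (fun x => gradcomb c N i x - partial_derivative i psi x)
     (partial_derivative i zeta)).
  by rewrite normrN; lra.
have diff_le : `|\sum_(n < N) lam n * c n * coef zeta n - S| <=
    e * \sum_(n < N) `|lam n * c n| * (1 + m).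
  rewrite /S -sumrB mulr_sumr; apply: le_trans (ler_norm_sum _ _ _) _.
  apply: ler_sum => n _; rewrite -mulrBr normrM mulrCA ler_wpM2l//.
  rewrite -coefB// /coef; apply: le_trans (normr_ip_le mOm (L2B mOm hzeta hv) (f2 n)) _.
  have -> : L2norm leb Om (f n) = 1.
    apply/eqP; rewrite -(@eqrXn2 _ 2) ?L2norm_ge0// -ip_norm// -L2innerE.
    by rewrite eigfun_orthonormal eqxx expr1n.
  by rewrite mulr1 L2normBC.
move: energy_ge diff_le eS; rewrite /C ler_norml => h1' /andP[h2' h3'] h4'.
nra.
Qed.

(* As [N] tends to infinity this says [(a - S a, v) >= 0] for [a = min u k] and the resolvent
   [S = mu (A + mu)^-1]: since [v] lives where [a = k], [S] maps [a] below [k]. *)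
Lemma submarkov (b : nat -> R) u k (mu : R) : 0 < mu -> 0 <= k -> L2 leb Om u ->
  (forall n, b n = mu / (lam n + mu)) ->
  let v := pos_above k u in let a := fun x => u x - v x in
  forall N, ip leb Om a v - \sum_(n < N) b n * coef a n * coef v n >=
   - (L2norm leb Om (fun x => a x - comb (coef a) N x) * L2norm leb Om v).
Proof.
move=> mu0 k0 hu hb v a N.
have hv : L2 leb Om v by exact: L2_pos_above.
have ha : L2 leb Om a by exact: L2B.
pose z := comb (fun n => b n * coef a n) N.
pose g := comb (coef a) N.
have hz : L2 leb Om z by exact: comb_L2.
have hg : L2 leb Om g by exact: comb_L2.
pose zk := pos_above k z.
have hzk : L2 leb Om zk by exact: L2_pos_above.
have lm n : 0 < lam n + mu by rewrite ltr_wpDl// eig_ge0.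
(* Coefficientwise [g - z = lam z / mu], because [1 - b = lam b / mu]; this is the resolvent
   equation for [z]. *)
have hmax : 0 <= ip leb Om (fun x => g x - z x) zk.
  have -> : ip leb Om (fun x => g x - z x) zk =
      mu^-1 * \sum_(n < N) lam n * (b n * coef a n) * coef zk n.
    rewrite ipBl// !ip_comb// -sumrB mulr_sumr; apply: eq_bigr => n _.
    rewrite hb; have := lm n; move: (lam n) => l l0.
    by field; rewrite !gt_eqF.
  by rewrite mulr_ge0 ?invr_ge0 ?(ltW mu0)//; exact: max_principle.
have ak x : a x <= k.
  rewrite /a /v /pos_above /= maxEle; case: (leP (u x - k) 0) => h; lra.
(* As [a <= k], on [{z > k}] one has [zk <= (g - a) + (z - g)]; pairing with [zk] removes [z - g] by
   [hmax]. *)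
have zk_le : L2norm leb Om zk <= L2norm leb Om (fun x => a x - g x).
  have [->|zk0] := eqVneq (L2norm leb Om zk) 0; first exact: L2norm_ge0.
  have zkp : 0 < L2norm leb Om zk by rewrite lt_neqAle eq_sym zk0 L2norm_ge0.
  rewrite -(ler_pM2r zkp) -expr2 -ip_norm//.
  have hag := L2B mOm ha hg.
  have h1 := normr_ip_le mOm hag hzk.
  have h2 : ip leb Om zk zk <= ip leb Om (fun x => (g x - a x) + (z x - g x)) zk.
    apply: le_Rintegral => //; first exact: L2_integrableM.
      by apply: L2_integrableM => //; apply: L2D => //; exact: L2B.
    move=> x _; rewrite addrC subrKA.
    rewrite /zk /pos_above maxEle; rewrite /=; case: (leP (z x - k) 0) => h; first by rewrite !mulr0.
    by rewrite ler_wpM2r ?(ltW h)// lerD2l lerN2.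
  have hgz := L2B mOm hg hz; have hzg := L2B mOm hz hg; have hga := L2B mOm hg ha.
  move: h2; rewrite ipDl//.
  have -> : ip leb Om (fun x => z x - g x) zk = - ip leb Om (fun x => g x - z x) zk.
    by rewrite !ipBl//; ring.
  have -> : ip leb Om (fun x => g x - a x) zk = - ip leb Om (fun x => a x - g x) zk.
    by rewrite !ipBl//; ring.
  have := ler_norm (- ip leb Om (fun x => a x - g x) zk).
  by rewrite normrN; lra.
have -> : \sum_(n < N) b n * coef a n * coef v n = ip leb Om z v by rewrite ip_comb.
rewrite -ipBl//; have haz := L2B mOm ha hz.
(* Where [v] is nonzero [a = k], and [k - z >= - zk] holds everywhere. *)
have h3 : ip leb Om (fun x => - zk x) v <= ip leb Om (fun x => a x - z x) v.
  apply: le_Rintegral => //.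
  - by apply: L2_integrableM => //; exact: L2N.
  - exact: L2_integrableM.
  move=> x _; have := pos_above_ge0 k u x; rewrite -/v => v0.
  have [vx0|vx0] := eqVneq (v x) 0; first by rewrite vx0 !mulr0.
  rewrite ler_wpM2r//; have -> : a x = k.
    move: vx0; rewrite /a /v /pos_above /= maxEle; case: (leP (u x - k) 0) => h; rewrite ?eqxx//; lra.
  by rewrite /zk /pos_above maxEle; case: (leP (z x - k) 0) => h; lra.
apply: le_trans h3.
have hN := L2N mOm hzk.
have := normr_ip_le mOm hN hv; rewrite L2normN// => h4.
have := ler_norm (- ip leb Om (fun x => - zk x) v); rewrite normrN => h5.
have : L2norm leb Om zk * L2norm leb Om v <=
   L2norm leb Om (fun x => a x - g x) * L2norm leb Om v.
  by rewrite ler_wpM2r// L2norm_ge0.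
by rewrite -/g; lra.
Qed.

End spectral.

(** * Fractional powers and spectral truncation *)

Section subordination.
Context {R : realType}.
Notation mu := (@lebesgue_measure R).

Lemma ge0_integral_shift1 (a : R) (f : measurableTypeR R -> \bar R) :
  measurable_fun setT f -> (forall x, 0 <= f x)%E ->
  (\int[mu]_x f (x + a)%R = \int[mu]_x f x)%E.
Proof.
move=> mf f0; pose phi (x : measurableTypeR R) : measurableTypeR R := x + a.
have mphi : measurable_fun setT phi by exact: measurable_funD.
have := @ge0_integral_pushforward _ _ _ _ _ _ mphi mu setT f measurableT mf (fun x _ => f0 x).
rewrite preimage_setT => <-.
apply: eq_measure_integral => B mB _.
by rewrite /= -[RHS](lebesgue_measure_shift a).
Qed.

Lemma ge0_integral_opp1 (f : measurableTypeR R -> \bar R) :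
  measurable_fun setT f -> (forall x, 0 <= f x)%E ->
  (\int[mu]_x f (- x)%R = \int[mu]_x f x)%E.
Proof.
move=> mf f0; pose phi (x : measurableTypeR R) : measurableTypeR R := - x.
have mphi : measurable_fun setT phi by exact: measurable_funN.
have := @ge0_integral_pushforward _ _ _ _ _ _ mphi mu setT f measurableT mf (fun x _ => f0 x).
rewrite preimage_setT => <-.
apply: eq_measure_integral => B mB _.
by rewrite /= -[RHS]lebesgue_measureN.
Qed.

Variable s : R.
Hypotheses (s0 : 0 < s) (s1 : s < 1).

(** The value at [l = 1] of the integrand [e^(s t) l / (l + e^t)]; any other [l > 0] amounts to a
    shift of [t] by [ln l] and a factor [l^s]. *)
Definition subord_weight (t : R) : R := expR (s * t) / (1 + expR t).

(** Classically [pi / sin (pi s)]. The argument calls for its finiteness and positivity, as it is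
    cancelled in the end. *)
Definition subord_const : \bar R := (\int[mu]_t (subord_weight t)%:E)%E.

Lemma subord_weight_gt0 t : 0 < subord_weight t.
Proof. by rewrite divr_gt0 ?expR_gt0// addr_gt0 ?expR_gt0. Qed.

Let measurable_expZ (a : R) : measurable_fun setT (fun t : R => expR (a * t)).
Proof. by apply: (measurableT_comp (@measurable_expR R)). Qed.

Lemma measurable_inv : measurable_fun setT (fun x : R => x^-1).
Proof.
rewrite (_ : (fun x : R => x^-1) =
  (fun x => if x == 0 then 0 else if 0 <= x then x `^ (-1) else - ((- x) `^ (-1)))).
  apply: measurable_fun_ifT.
  - exact: measurable_fun_eqr.
  - exact: measurable_cst.
  - apply: measurable_fun_ifT.
    + exact: measurable_fun_ler.
    + exact: measurable_powR.
    + apply: measurable_funN; apply: (measurableT_comp (measurable_powR (-1))).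
      exact: measurable_funN.
apply/funext => x; have [->|x0] := eqVneq x 0; first by rewrite invr0.
case: (leP 0 x) => hx; first by rewrite powR_inv1.
by rewrite powR_inv1 ?oppr_ge0 ?ltW// invrN opprK.
Qed.

Lemma measurable_subord_weight : measurable_fun setT subord_weight.
Proof.
apply: measurable_funM; first exact: measurable_expZ.
apply: (measurableT_comp measurable_inv); apply: measurable_funD => //.
Qed.

Lemma subord_const_lty : (subord_const < +oo)%E.
Proof.
have s1' : 0 < 1 - s by rewrite subr_gt0.
(* The weight is at most [expR (- (1 - s) t)] for [t >= 0] and [expR (s t)] for [t < 0]; both
   majorants are rescaled exponential densities, the second one reflected. *)
pose F1 t : \bar R := ((1 - s)^-1%:E * (exponential_pdf (1 - s) t)%:E)%E.
pose F2 t : \bar R := (s^-1%:E * (exponential_pdf s (- t)%R)%:E)%E.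
have mp (r : R) : measurable_fun setT (fun t : measurableTypeR R => (exponential_pdf r t)%:E).
  by apply/measurable_EFinP; exact: measurable_exponential_pdf.
have p0 (r t : R) : 0 < r -> (0 <= (exponential_pdf r t)%:E)%E.
  by move=> r0; rewrite lee_fin exponential_pdf_ge0// ltW.
have mp' : measurable_fun setT (fun t : measurableTypeR R => (exponential_pdf s (- t)%R)%:E).
  by apply: (measurableT_comp (mp s)); exact: measurable_funN.
have i1 : (\int[mu]_t F1 t < +oo)%E.
  rewrite ge0_integralZl//; [|by move=> t _; exact: p0|by rewrite lee_fin invr_ge0 ltW].
  by rewrite integral_exponential_pdf// mule1 ltry.
have i2 : (\int[mu]_t F2 t < +oo)%E.
  rewrite ge0_integralZl//; [|by move=> t _; exact: p0|by rewrite lee_fin invr_ge0 ltW].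
  rewrite (@ge0_integral_opp1 (fun t => (exponential_pdf s t)%:E))//.
    by rewrite integral_exponential_pdf// mule1 ltry.
  by move=> t; exact: p0.
apply: (@le_lt_trans _ _ (\int[mu]_t (F1 t + F2 t))%E).
  apply: ge0_le_integral => //.
  - by move=> t _; rewrite lee_fin ltW// subord_weight_gt0.
  - by apply/measurable_EFinP; exact: measurable_subord_weight.
  - by apply: emeasurable_funD; apply: measurable_funeM.
  - move=> t _; rewrite /F1 /F2 /subord_weight -!EFinM -EFinD lee_fin.
    have [t0|t0] := leP 0 t.
      apply: ler_wpDr; first by rewrite mulr_ge0// ?invr_ge0 ?exponential_pdf_ge0// ltW.
      rewrite exponential_pdfE// mulrA mulVf ?gt_eqF// mul1r.
      rewrite ler_pdivrMr ?addr_gt0 ?expR_gt0// mulrDr mulr1.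
      apply: ler_wpDl; first exact: expR_ge0.
      by rewrite -expRD ler_expR; lra.
    apply: ler_wpDl; first by rewrite mulr_ge0// ?invr_ge0 ?exponential_pdf_ge0// ltW.
    rewrite exponential_pdfE ?oppr_ge0 ?(ltW t0)// mulrA mulVf ?gt_eqF// mul1r.
    by rewrite mulrNN ler_pdivrMr ?addr_gt0 ?expR_gt0// ler_peMr ?expR_ge0// lerDl expR_ge0.
rewrite ge0_integralD//.
- exact: lte_add_pinfty.
- by move=> t _; rewrite mule_ge0// ?p0// lee_fin invr_ge0 ltW.
- exact: measurable_funeM.
- by move=> t _; rewrite mule_ge0// ?p0// lee_fin invr_ge0 ltW.
- exact: measurable_funeM.
Qed.

Lemma subord_const_gt0 : (0 < subord_const)%E.
Proof.
rewrite lt_neqAle integral_ge0 ?andbT; last first.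
  by move=> t _; rewrite lee_fin ltW// subord_weight_gt0.
apply/eqP => /esym h.
have mw : measurable_fun setT (fun t : measurableTypeR R => (subord_weight t)%:E).
  by apply/measurable_EFinP; exact: measurable_subord_weight.
have /ae_eq_integral_abs : (\int[mu]_t `|(subord_weight t)%:E| = 0)%E.
  under eq_integral do rewrite gee0_abs ?lee_fin ?(ltW (subord_weight_gt0 _))//.
  exact: h.
move=> /(_ measurableT mw) [N [mN N0 sub]].
have : (mu (`[0%R, 1%R]%classic : set R) <= mu N)%E.
  apply: le_measure; rewrite ?inE//.
  move=> t _; apply: sub => /= /(_ I) /eqP; rewrite eqe gt_eqF//.
  exact: subord_weight_gt0.
by rewrite N0 lebesgue_measure_itv/= lte_fin ltr01 oppr0 adde0 lee_fin ler10.
Qed.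

Lemma subord_integral (l : R) : 0 <= l ->
  (\int[mu]_t (expR (s * t) * (l / (l + expR t)))%:E = (l `^ s)%:E * subord_const)%E.
Proof.
rewrite le_eqVlt => /orP[/eqP <-|l0].
  rewrite powR0 ?gt_eqF// mul0e integral0_eq// => t _.
  by rewrite mul0r mulr0.
have -> : subord_const = (\int[mu]_t (subord_weight (t - ln l)%R)%:E)%E.
  apply/esym; apply: (@ge0_integral_shift1 (- ln l) (fun t => (subord_weight t)%:E)).
    by apply/measurable_EFinP; exact: measurable_subord_weight.
  by move=> t; rewrite lee_fin ltW// subord_weight_gt0.
rewrite -ge0_integralZl//; last 3 first.
- apply/measurable_EFinP; apply: (measurableT_comp measurable_subord_weight).
  exact: measurable_funD.
- by move=> t _; rewrite lee_fin ltW// subord_weight_gt0.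
- by rewrite lee_fin powR_ge0.
apply: eq_integral => t _; rewrite -EFinM; congr EFin.
rewrite /subord_weight /powR gt_eqF// mulrDr mulrN expRD expRN expRD expRN lnK//.
field; rewrite !gt_eqF ?expR_gt0// ?addr_gt0 ?expR_gt0//.
Qed.

End subordination.

Section spectral_truncation.
Context {R : realType} {d : nat}.
Notation leb := (lebesgue_rV d : {measure set 'rV[R]_d -> \bar R}).
Notation mu1 := (@lebesgue_measure R).
Variable Om : set 'rV[R]_d.
Hypotheses (d_gt0 : (0 < d)%N) (oOm : open Om) (bOm : bounded_set Om).
Variable E : dirichlet_eigensystem Om.
Variable s : R.
Hypotheses (s0 : 0 < s) (s1 : s < 1).
Implicit Types (u v w : 'rV[R]_d -> R).

Let mOm : measurable Om. Proof. exact: open_measurable_rV. Qed.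
Let f := eigfun E.
Let lam := eigval E.
Let f2 n : L2 leb Om (f n). Proof. by case: (@eigfun_H10 _ _ _ E n). Qed.
Let l0 n : 0 <= lam n. Proof. exact: eig_ge0. Qed.

Definition spectral_form u : \bar R :=
  (\sum_(0 <= n <oo) (lam n `^ s * coef E u n ^+ 2)%:E)%E.

Lemma spectral_form_ge0 u : (0 <= spectral_form u)%E.
Proof. by apply: nneseries_ge0 => n _ _; rewrite lee_fin mulr_ge0 ?powR_ge0 ?sqr_ge0. Qed.

(** The symbol of [A (A + m)^-1], one minus that of the resolvent [m (A + m)^-1] treated in
    [submarkov]: the Yosida approximation of [A] up to the factor [m]. *)
Definition kappa (m : R) n : R := lam n / (lam n + m).

Lemma kappa_ge0 m n : 0 < m -> 0 <= kappa m n.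
Proof. by move=> m0; rewrite divr_ge0// addr_ge0// ltW. Qed.

Section truncation.
Variables (w : 'rV[R]_d -> R) (k t : R).
Hypotheses (k0 : 0 <= k) (t0 : 0 <= t) (hw : L2 leb Om w).
Let v := pos_above k w.
Let wt := fun x => w x - t * v x.

Let hv : L2 leb Om v. Proof. exact: L2_pos_above. Qed.

Let A n := coef E wt n ^+ 2 + (2 * t - t ^+ 2) * coef E v n ^+ 2.

(** For the form [Q] with symbol [kappa m], cut at [N], the left side is [Q(w) - 2 t Q(w - v, v)].
    The mixed term is at least [- 2 eps |v|]: one [eps] comes from [submarkov], the other from
    cutting Parseval's identity for [w - v] and [v] at [N]. *)
Lemma resolvent_truncation_partial (m : R) : 0 < m -> forall N,
  \sum_(n < N) kappa m n * A n <= \sum_(n < N) kappa m n * coef E w n ^+ 2 +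
    4 * t * L2norm leb Om v *
    L2norm leb Om (fun x => (w x - v x) - comb E (coef E (fun x => w x - v x)) N x).
Proof.
move=> m0 N; pose a := fun x => w x - v x; rewrite -/a.
have ha : L2 leb Om a by exact: L2B.
have htv : L2 leb Om (fun x => t * v x) by exact: L2Z.
pose b n := m / (lam n + m).
have lm n : 0 < lam n + m by rewrite ltr_wpDl.
have sm := @submarkov _ _ _ d_gt0 oOm bOm E b w k m m0 k0 hw (fun n => erefl (b n)) N.
rewrite -/v -/a in sm.
have E1 : ip leb Om a v - \sum_(n < N) coef E a n * coef E v n =
    ip leb Om (fun x => a x - comb E (coef E a) N x) v.
  by rewrite ipBl// ?ip_comb//; exact: comb_L2.
have hres := L2B mOm ha (comb_L2 oOm E (coef E a) N).
have h1 := normr_ip_le mOm hres hv.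
set eps := L2norm leb Om (fun x => a x - comb E (coef E a) N x) in sm h1 *.
have h2 : \sum_(n < N) kappa m n * coef E a n * coef E v n >= - (2 * (eps * L2norm leb Om v)).
  have -> : \sum_(n < N) kappa m n * coef E a n * coef E v n =
      \sum_(n < N) coef E a n * coef E v n - \sum_(n < N) b n * coef E a n * coef E v n.
    rewrite -sumrB; apply: eq_bigr => n _; rewrite /kappa /b.
    by field; rewrite gt_eqF.
  move: h1; rewrite -E1; set q := ip leb Om a v - _ => h1.
  by have := ler_norm q; rewrite /q in h1 *; move: sm h1; lra.
have -> : \sum_(n < N) kappa m n * A n = \sum_(n < N) kappa m n * coef E w n ^+ 2 -
    2 * t * \sum_(n < N) kappa m n * coef E a n * coef E v n.
  rewrite mulr_sumr -sumrB; apply: eq_bigr => n _.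
  rewrite /A /wt /a !coefB// coefZ//; ring.
have := mulr_ge0 t0 (L2norm_ge0 leb Om v).
have := mulr_ge0 t0 (addr_ge0 (mulr_ge0 (ler0n R 2) (mulr_ge0 (L2norm_ge0 leb Om (fun x => a x - comb E (coef E a) N x)) (L2norm_ge0 leb Om v))) (lexx 0)).
have : t * (\sum_(n < N) kappa m n * coef E a n * coef E v n + 2 * (eps * L2norm leb Om v)) >= 0.
  by rewrite mulr_ge0// -lerBlDr sub0r.
by move=> h3 _ _; lra.
Qed.

Hypothesis t2 : t <= 2.

Lemma A_ge0 n : 0 <= A n.
Proof.
have tt0 : 0 <= 2 * t - t ^+ 2 by rewrite expr2 -mulrBl mulr_ge0// subr_ge0.
by rewrite addr_ge0 ?sqr_ge0// mulr_ge0 ?sqr_ge0.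
Qed.

Lemma resolvent_truncation (m : R) : 0 < m ->
  (\sum_(0 <= n <oo) (kappa m n * A n)%:E <=
   \sum_(0 <= n <oo) (kappa m n * coef E w n ^+ 2)%:E)%E.
Proof.
move=> m0.
have kA n : (0 <= (kappa m n * A n)%:E)%E by rewrite lee_fin mulr_ge0 ?kappa_ge0 ?A_ge0.
have kw n : (0 <= (kappa m n * coef E w n ^+ 2)%:E)%E.
  by rewrite lee_fin mulr_ge0 ?kappa_ge0 ?sqr_ge0.
apply: lime_le; first exact: is_cvg_nneseries.
apply: nearW => M; apply/lee_addgt0Pr => e e0.
pose C := 4 * t * L2norm leb Om v.
have C0 : 0 <= C by rewrite !mulr_ge0// L2norm_ge0.
have ha : L2 leb Om (fun x => w x - v x) by exact: L2B.
have /cvgrPdist_lt := coef_norm_cvg E ha.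
have eC : 0 < e / (C + 1) by rewrite divr_gt0// ltr_wpDl.
move=> /(_ _ eC)[N0 _ hN0].
(* The terms on the left are nonnegative, so the partial sum up to [M] may be prolonged until the
   truncation error is below [e]. *)
pose N := maxn M N0.
have := hN0 N (leq_maxr M N0).
rewrite /= sub0r normrN ger0_norm ?L2norm_ge0// => hN.
apply: (@le_trans _ _ (\sum_(0 <= n < N) (kappa m n * A n)%:E)%E).
  apply: lee_sum_nneg_natr => //; exact: leq_maxl.
rewrite sumEFin big_mkord.
apply: (@le_trans _ _ (\sum_(n < N) kappa m n * coef E w n ^+ 2 + e)%:E).
  rewrite lee_fin; apply: le_trans (resolvent_truncation_partial m0 N) _.
  rewrite lerD2l -/C; apply: (@le_trans _ _ (C * (e / (C + 1)))).
    by rewrite ler_wpM2l// ltW.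
  by rewrite mulrA ler_pdivrMr ?ltr_wpDl// mulrC ler_wpM2l ?(ltW e0)// lerDl.
rewrite EFinD leeD2r// -(big_mkord xpredT (fun n => kappa m n * coef E w n ^+ 2)) -sumEFin.
by apply: nneseries_lim_ge.
Qed.

Lemma measurable_kappa_exp n :
  measurable_fun setT (fun r : measurableTypeR R => expR (s * r) * kappa (expR r) n).
Proof.
apply: measurable_funM.
  by apply: (measurableT_comp (@measurable_expR R)); exact: measurable_funM.
apply: measurable_funM => //; apply: (measurableT_comp measurable_inv).
by apply: measurable_funD => //; exact: measurable_expR.
Qed.

Let cfin : subord_const s \is a fin_num.
Proof. by rewrite ge0_fin_numE ?subord_const_lty// ltW// subord_const_gt0. Qed.

Lemma integral_kappa (c : nat -> R) : (forall n, 0 <= c n) ->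
  (\int[mu1]_r \sum_(0 <= n <oo) (expR (s * r) * kappa (expR r) n * c n)%:E =
   subord_const s * \sum_(0 <= n <oo) (lam n `^ s * c n)%:E)%E.
Proof.
move=> c0.
have m n : measurable_fun setT (fun r : measurableTypeR R => (expR (s * r) * kappa (expR r) n)%:E).
  by apply/measurable_EFinP; exact: measurable_kappa_exp.
have ge n r : (0 <= (expR (s * r) * kappa (expR r) n)%:E)%E.
  by rewrite lee_fin mulr_ge0 ?expR_ge0// kappa_ge0// expR_gt0.
rewrite integral_nneseries//; last 2 first.
- by move=> n; under eq_fun do rewrite mulrC EFinM; exact: measurable_funeM.
- by move=> n r _; rewrite EFinM mule_ge0// lee_fin.
rewrite -(fineK cfin) -nneseriesZl; last by move=> n _; rewrite lee_fin mulr_ge0// powR_ge0.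
apply: eq_eseriesr => n _.
under eq_integral do rewrite mulrC EFinM.
rewrite ge0_integralZl ?lee_fin//.
rewrite /kappa subord_integral// -[subord_const s in LHS](fineK cfin) -!EFinM.
by congr EFin; ring.
Qed.

(** The resolvent inequality with [m = expR r] is integrated against [expR (s r)]; by
    [integral_kappa] both sides acquire the factor [subord_const s], which is positive and
    finite. *)
Lemma spectral_truncation_le :
  (spectral_form wt + (2 * t - t ^+ 2)%:E * spectral_form v <= spectral_form w)%E.
Proof.
have tt0 : 0 <= 2 * t - t ^+ 2.
  by rewrite expr2 -mulrBl mulr_ge0// subr_ge0.
rewrite -nneseriesZl; last by move=> n _; rewrite lee_fin mulr_ge0 ?powR_ge0 ?sqr_ge0.
rewrite /spectral_form -nneseriesD; last 2 first.
- by move=> n _ _; rewrite lee_fin mulr_ge0 ?powR_ge0 ?sqr_ge0.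
- by move=> n _ _; rewrite -EFinM lee_fin mulr_ge0// mulr_ge0 ?powR_ge0 ?sqr_ge0.
rewrite (_ : (\sum_(0 <= n <oo) _)%E = (\sum_(0 <= n <oo) (lam n `^ s * A n)%:E)%E); last first.
  apply: eq_eseriesr => n _; rewrite -EFinM -EFinD /A; congr EFin; ring.
rewrite -(@lee_pmul2l _ (subord_const s))//; last exact: subord_const_gt0.
rewrite -!integral_kappa; last 2 first.
- by move=> n; exact: sqr_ge0.
- exact: A_ge0.
have ms (c : nat -> R) : (forall n, 0 <= c n) -> measurable_fun setT (fun r : measurableTypeR R =>
    \sum_(0 <= n <oo) (expR (s * r) * kappa (expR r) n * c n)%:E)%E.
  move=> c0; apply: ge0_emeasurable_sum => [n r _ _|n _].
    by rewrite lee_fin mulr_ge0// mulr_ge0 ?expR_ge0// kappa_ge0// expR_gt0.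
  by apply/measurable_EFinP; apply: measurable_funM => //; exact: measurable_kappa_exp.
have ge (c : nat -> R) r : (forall n, 0 <= c n) ->
    (0 <= \sum_(0 <= n <oo) (expR (s * r) * kappa (expR r) n * c n)%:E)%E.
  move=> c0; apply: nneseries_ge0 => n _ _.
  by rewrite lee_fin mulr_ge0// mulr_ge0 ?expR_ge0// kappa_ge0// expR_gt0.
apply: ge0_le_integral => //.
- by move=> r _; apply: ge; exact: A_ge0.
- by apply: ms; exact: A_ge0.
- by apply: ms => n; exact: sqr_ge0.
move=> r _.
have pull (c : nat -> R) : (forall n, 0 <= c n) ->
  (\sum_(0 <= n <oo) (expR (s * r) * kappa (expR r) n * c n)%:E =
   (expR (s * r))%:E * \sum_(0 <= n <oo) (kappa (expR r) n * c n)%:E)%E.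
  move=> c0; rewrite -nneseriesZl; last first.
    by move=> n _; rewrite lee_fin mulr_ge0// kappa_ge0// expR_gt0.
  by apply: eq_eseriesr => n _; rewrite -EFinM -mulrA.
rewrite !pull; [|by move=> n; exact: sqr_ge0|exact: A_ge0].
rewrite lee_wpmul2l ?lee_fin ?expR_ge0//.
by apply: resolvent_truncation; exact: expR_gt0.
Qed.

End truncation.
End spectral_truncation.

(** * Faber-Krahn inequality for the spectral form *)

Section faber_krahn_translation.
Context {R : realType} {d : nat}.
Notation leb := (lebesgue_rV d : {measure set 'rV[R]_d -> \bar R}).
Implicit Types (u : 'rV[R]_d -> R).

Lemma integral_Zindic (c : R) (A : set 'rV[R]_d) : 0 <= c -> measurable A ->
  (\int[leb]_y (c%:E * (\1_A y)%:E) = c%:E * leb A)%E.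
Proof.
move=> c0 mA; rewrite ge0_integralZl_EFin; last exact: c0.
- by rewrite integral_indic// setIT.
- exact: measurableT.
- by move=> y _; rewrite lee_fin.
- by apply/measurable_EFinP; exact: measurable_indic.
Qed.

Lemma measurable_addrV : measurable_fun setT (fun p : 'rV[R]_d * 'rV[R]_d => p.1 + p.2).
Proof.
apply: measurable_fun_rV => i; under eq_fun do rewrite mxE.
apply: measurable_funD.
  exact: (measurableT_comp (measurable_rV_coord i) measurable_fst).
exact: (measurableT_comp (measurable_rV_coord i) measurable_snd).
Qed.

(* Averaging over the translations [y] of a cube of volume [2 m]: for at least half of
   them the point [x + y] leaves the support of [u]. *)
Lemma faber_krahn_translation u (m r B : R) : L2 leb setT u -> 0 < m -> 0 <= r ->
  (leb [set x | u x != 0%R] <= m%:E)%E -> (2 * r) ^+ d = 2 * m -> 0 <= B ->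
  (forall y, cube 0 r y -> transl u y ^+ 2 <= B) ->
  L2norm leb setT u ^+ 2 <= 2 * B.
Proof.
move=> hu m0 r0 um rm B0 hB.
have mu_ : measurable_fun setT u by exact: L2_measurable hu.
pose Q := cube (0 : 'rV[R]_d) r.
have mQ : measurable Q by exact: measurable_cube.
have lQ : leb Q = (2 * m)%:E by rewrite -rm; exact: lebesgue_cube.
pose S := [set x | u x != 0].
have mS : measurable S.
  rewrite [S](_ : _ = u @^-1` (~` [set 0])); last by apply/seteqP; split => x /= /eqP.
  by rewrite -[X in measurable X]setTI; apply: mu_ => //; exact/measurableC.
pose F (p : 'rV[R]_d * 'rV[R]_d) : \bar R := (\1_Q p.2 * (u (p.1 + p.2) - u p.1) ^+ 2)%:E.
have mF : measurable_fun setT F.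
  apply/measurable_EFinP; apply: measurable_funM.
    have mi : measurable_fun setT (\1_Q : 'rV[R]_d -> R) by exact: measurable_indic.
    exact: (measurableT_comp mi measurable_snd).
  apply: measurable_funX; apply: measurable_funB.
    exact: (measurableT_comp mu_ measurable_addrV).
  exact: (measurableT_comp mu_ measurable_fst).
have F0 p : (0 <= F p)%E by rewrite lee_fin mulr_ge0 ?sqr_ge0.
have upper : (\int[leb]_y \int[leb]_x F (x, y) <= (2 * m * B)%:E)%E.
  apply: (@le_trans _ _ (\int[leb]_y (B%:E * (\1_Q y)%:E))%E).
    apply: ge0_le_integral; first exact: measurableT.
    - by move=> y _; apply: integral_ge0.
    - exact: measurable_fun_fubini_tonelli_G.
    - by apply: measurable_funeM; apply/measurable_EFinP; exact: measurable_indic.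
    move=> y _; rewrite /F/= indicE; case: (boolP (y \in Q)) => [/set_mem Qy|_].
      under eq_integral do rewrite mul1r.
      rewrite mule1 -[leLHS]/(sqint leb setT (fun x => u (x + y) - u x)).
      by rewrite L2_sqint ?lee_fin; [exact: hB|exact: L2_transl].
    by under eq_integral do rewrite mul0r; rewrite integral0 mule0.
  rewrite (integral_Zindic B0 mQ).
  by rewrite lQ -EFinM lee_fin mulrC.
have lower : ((m * L2norm leb setT u ^+ 2)%:E <= \int[leb]_x \int[leb]_y F (x, y))%E.
  clear upper; rewrite EFinM -(L2_sqint hu) /sqint -ge0_integralZl_EFin; last 4 first.
  - exact: measurableT.
  - by move=> x _; rewrite lee_fin sqr_ge0.
  - exact: measurable_sqr.
  - exact: ltW.
  apply: ge0_le_integral; first exact: measurableT.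
  - by move=> x _; rewrite -EFinM lee_fin mulr_ge0 ?sqr_ge0// ltW.
  - by apply: measurable_funeM; exact: measurable_sqr.
  - exact: measurable_fun_fubini_tonelli_F.
  move=> x _.
  pose Sx := [set y | S (y + x)].
  have mSx : measurable Sx by exact: measurable_preimage_shift.
  have lSx : (leb Sx <= m%:E)%E by rewrite [leb Sx](lebesgue_rV_shift x mS).
  have mD : measurable (Q `\` Sx) by exact: measurableD.
  (* [Q] has measure [2 m], and removing [Sx] costs at most [m]. *)
  have lD : (m%:E <= leb (Q `\` Sx))%E.
    have : (leb Q <= leb (Q `\` Sx) + leb Sx)%E.
      rewrite -[in leLHS](setUIDK Q Sx) setUC.
      apply: le_trans (measureU2 _ mD (measurableI _ _ mQ mSx)) _.
      by rewrite leeD2l// le_measure ?inE//; exact: measurableI.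
    rewrite lQ => h; have h2 := le_trans h (leeD2l _ lSx).
    by move: h2; rewrite -leeBlDr// -EFinB; apply: le_trans; rewrite lee_fin; lra.
  apply: (@le_trans _ _ (\int[leb]_y ((u x ^+ 2)%:E * (\1_(Q `\` Sx) y)%:E))%E).
    rewrite (integral_Zindic (sqr_ge0 _) mD).
    by rewrite muleC lee_wpmul2l// lee_fin sqr_ge0.
  apply: ge0_le_integral; first exact: measurableT.
  - by move=> y _; rewrite -EFinM lee_fin mulr_ge0 ?sqr_ge0.
  - by apply: measurable_funeM; apply/measurable_EFinP; exact: measurable_indic.
  - exact: measurableT_comp mF (measurable_pair1 x).
  move=> y _; rewrite /F -EFinM lee_fin/= [\1_(_ `\` _) y]indicE.
  case: (boolP (y \in _)) => [/set_mem[Qy nS]|_]; last first.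
    by rewrite mulr0 mulr_ge0 ?sqr_ge0.
  rewrite indicE mem_set// mul1r mulr1 (_ : u (x + y) = 0) ?sub0r ?sqrrN//.
  by apply/eqP/negPn/negP => h; apply: nS; rewrite /Sx /S /= addrC.
have := @fubini_tonelli _ _ _ _ _ (lebesgue_rV d) (lebesgue_rV d) F mF F0.
move=> tonelli; rewrite tonelli in lower.
have := le_trans lower upper; rewrite lee_fin (mulrC 2 m) -mulrA ler_pM2l//.
Qed.

End faber_krahn_translation.

Section spectral_faber_krahn.
Context {R : realType} {d : nat}.
Notation leb := (lebesgue_rV d : {measure set 'rV[R]_d -> \bar R}).
Variable Om : set 'rV[R]_d.
Hypotheses (d_gt0 : (0 < d)%N) (oOm : open Om).
Variable E : dirichlet_eigensystem Om.
Variable s : R.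
Hypotheses (s0 : 0 < s) (s1 : s < 1).
Implicit Types (u v w : 'rV[R]_d -> R).

Let mOm : measurable Om. Proof. exact: open_measurable_rV. Qed.
Let lam := eigval E.
Let l0 n : 0 <= lam n. Proof. exact: eig_ge0. Qed.

(** The translation is carried out along the [d] axes, each at the cost of at most [r] times one
    component of the gradient. *)
Lemma comb_transl (c : nat -> R) N (r : R) y : 0 <= r -> cube 0 r y ->
  transl (comb E c N \_ Om) y ^+ 2 <= (d%:R * r) ^+ 2 * \sum_(n < N) lam n * c n ^+ 2.
Proof.
move=> r0 hy; have H := comb_H10 d_gt0 oOm E c N.
have hu : L2 leb setT (comb E c N \_ Om) by rewrite L2_restrict; exact: comb_L2.
rewrite -(gradcomb_norm d_gt0 oOm); set S := \sum_i _.
have S0 : 0 <= S by apply: sumr_ge0 => i _; exact: sqr_ge0.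
rewrite -[S]sqr_sqrtr// -exprMn lerXn2r ?nnegrE ?transl_ge0 ?mulr_ge0 ?sqrtr_ge0//.
rewrite [y](_ : _ = \sum_i y ord0 i *: delta_mx ord0 i); last exact: row_sum_delta.
apply: le_trans (transl_sum _ hu) _.
rewrite -mulrA mulr_natl -[X in _ *+ X]card_ord -sumr_const.
apply: ler_sum => i _; have := H10_transl d_gt0 oOm i (y ord0 i) H.
move=> /le_trans; apply; apply: ler_pM => //; first exact: L2norm_ge0.
  by have := hy i; rewrite mxE subr0 => /ltW.
rewrite -[leLHS]ger0_norm ?L2norm_ge0// -sqrtr_sqr ler_sqrt//.
rewrite /S (bigD1 i)//= lerDl; apply: sumr_ge0 => j _; exact: sqr_ge0.
Qed.

(** From [(a + 2 q)^2 <= 2 a^2 + 8 q^2]: the low modes contribute [2 d^2], the high modes [8]. *)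
Let C := 2 * d%:R ^+ 2 + 8 : R.

Let C0 : 0 <= C. Proof. by rewrite addr_ge0// mulr_ge0// sqr_ge0. Qed.

(** The modes are split at [r^2 lam = 1]. The low ones are treated by the gradient bound, the high
    ones by their norm alone; [x <= x^s] for [x <= 1] and [1 <= x^s] for [x >= 1] turn both into the
    fractional form. *)
Lemma comb_transl_frac (c : nat -> R) N (r : R) y : 0 < r -> cube 0 r y ->
  transl (comb E c N \_ Om) y ^+ 2 <=
  C * (r ^+ 2) `^ s * \sum_(n < N) lam n `^ s * c n ^+ 2.
Proof.
move=> r0 hy.
pose cl n := if r ^+ 2 * lam n <= 1 then c n else 0.
pose ch n := if r ^+ 2 * lam n <= 1 then 0 else c n.
have L2c (a : nat -> R) : L2 leb setT (comb E a N \_ Om).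
  by rewrite L2_restrict; exact: comb_L2.
have h := transl_lip y (L2c c) (L2c cl).
have hd : L2norm leb setT (fun x => (comb E c N \_ Om) x - (comb E cl N \_ Om) x) ^+ 2
    = \sum_(n < N) ch n ^+ 2.
  rewrite -(comb_norm oOm E) -[in RHS]L2norm_restrict; congr (_ ^+ 2); apply: eq_L2norm => x _.
  rewrite /patch; case: ifPn => _; last by rewrite subrr.
  rewrite /comb -sumrB; apply: eq_bigr => n _; rewrite -mulrBl /cl /ch.
  by case: ifPn => _; rewrite ?subrr ?subr0.
set q := L2norm _ _ _ in h hd.
have h1 := comb_transl cl N (ltW r0) hy.
have q0 : 0 <= q by exact: L2norm_ge0.
apply: (@le_trans _ _ (2 * transl (comb E cl N \_ Om) y ^+ 2 + 8 * q ^+ 2)).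
  apply: (@le_trans _ _ ((transl (comb E cl N \_ Om) y + 2 * q) ^+ 2)).
    by rewrite lerXn2r ?nnegrE ?transl_ge0// addr_ge0 ?transl_ge0// mulr_ge0.
  move: (transl (comb E cl N \_ Om) y) => a.
  by have := sqr_ge0 (a - 2 * q); rewrite !expr2; lra.
apply: (@le_trans _ _ (2 * ((d%:R * r) ^+ 2 * \sum_(n < N) lam n * cl n ^+ 2)
    + 8 * \sum_(n < N) ch n ^+ 2)).
  by rewrite hd lerD2r ler_wpM2l.
rewrite !mulr_sumr -big_split/=; apply: ler_sum => n _.
have -> : C * (r ^+ 2) `^ s * (lam n `^ s * c n ^+ 2) =
    C * (r ^+ 2 * lam n) `^ s * c n ^+ 2.
  by rewrite powRM ?sqr_ge0//; ring.
have rl : 0 <= r ^+ 2 * lam n by rewrite mulr_ge0 ?sqr_ge0.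
rewrite /cl /ch exprMn; case: ifPn => rl1.
  rewrite [leLHS](_ : _ = 2 * d%:R ^+ 2 * (r ^+ 2 * lam n) * c n ^+ 2); last by ring.
  rewrite ler_wpM2r ?sqr_ge0//.
  have h2 : r ^+ 2 * lam n <= (r ^+ 2 * lam n) `^ s.
    have [->|rn0] := eqVneq (r ^+ 2 * lam n) 0; first by rewrite powR_ge0.
    rewrite -[leLHS]powRr1//; apply: ger_powR; last exact: ltW.
    by rewrite rl1 lt_neqAle eq_sym rn0 rl.
  have D0 : 0 <= 2 * d%:R ^+ 2 :> R by rewrite mulr_ge0// sqr_ge0.
  by apply: le_trans (ler_wpM2l D0 h2) _; rewrite ler_wpM2r ?powR_ge0 // /C lerDl.
rewrite [leLHS](_ : _ = 8 * c n ^+ 2); last by ring.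
rewrite ler_wpM2r ?sqr_ge0//.
have h2 : 1 <= (r ^+ 2 * lam n) `^ s.
  rewrite -[leLHS](powRr0 (r ^+ 2 * lam n)); apply: ler_powR; last exact: ltW.
  by rewrite ltW// ltNge.
have D0 : 0 <= 2 * d%:R ^+ 2 :> R by rewrite mulr_ge0// sqr_ge0.
rewrite /C mulrDl ler_wpDl ?mulr_ge0 ?powR_ge0//.
by rewrite -[leLHS]mulr1 ler_wpM2l.
Qed.

Lemma transl_frac u (r : R) y : L2 leb Om u -> (spectral_form E s u < +oo)%E ->
  0 < r -> cube 0 r y ->
  transl (u \_ Om) y ^+ 2 <= C * (r ^+ 2) `^ s * fine (spectral_form E s u).
Proof.
move=> hu ufin r0 hy; set B := leRHS.
have Q0 : 0 <= fine (spectral_form E s u) by rewrite fine_ge0// spectral_form_ge0.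
have B0 : 0 <= B by rewrite !mulr_ge0// powR_ge0.
rewrite -[B]sqr_sqrtr// lerXn2r ?nnegrE ?transl_ge0 ?sqrtr_ge0//.
apply/ler_addgt0Pr => e e0.
have /cvgrPdist_lt := coef_norm_cvg E hu.
have e2 : 0 < e / 2 by rewrite divr_gt0.
move=> /(_ _ e2)[N _ /(_ N (leqnn N))]; rewrite /= sub0r normrN ger0_norm ?L2norm_ge0// => hN.
have hc : L2 leb Om (comb E (coef E u) N) by exact: comb_L2.
have huT : L2 leb setT (u \_ Om) by rewrite L2_restrict.
have hcT : L2 leb setT (comb E (coef E u) N \_ Om) by rewrite L2_restrict.
apply: le_trans (transl_lip y huT hcT) _; apply: lerD.
  rewrite -[leLHS]ger0_norm ?transl_ge0// -sqrtr_sqr ler_sqrt//.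
  apply: le_trans (comb_transl_frac _ _ r0 hy) _.
  rewrite ler_wpM2l ?mulr_ge0 ?powR_ge0//.
  rewrite -lee_fin fineK; last by rewrite ge0_fin_numE// spectral_form_ge0.
  rewrite -(big_mkord xpredT (fun n => lam n `^ s * coef E u n ^+ 2)) -sumEFin.
  by apply: nneseries_lim_ge => n _ _; rewrite lee_fin mulr_ge0 ?powR_ge0 ?sqr_ge0.
rewrite -ler_pdivlMl// mulrC; apply: le_trans (ltW hN).
rewrite le_eqVlt; apply/orP; left; apply/eqP.
rewrite -[RHS]L2norm_restrict; apply: eq_L2norm => x _.
by rewrite /patch; case: ifPn => //; rewrite subrr.
Qed.

Lemma spectral_faber_krahn u (m : R) : L2 leb Om u -> (spectral_form E s u < +oo)%E ->
  0 < m -> (leb (Om `&` [set x | u x != 0%R]) <= m%:E)%E ->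
  L2norm leb Om u ^+ 2 <= 2 * C * m `^ (2 * s / d%:R) * fine (spectral_form E s u).
Proof.
move=> hu ufin m0 um.
(* The cube of half-side [r] has volume [2 m], as [faber_krahn_translation] requires. *)
pose r := ((2 * m) `^ (d%:R^-1)) / 2.
have d0 : 0 < d%:R :> R by rewrite ltr0n.
have r0 : 0 < r by rewrite divr_gt0// powR_gt0// mulr_gt0.
have rm : (2 * r) ^+ d = 2 * m.
  rewrite /r mulrC divfK// -powR_mulrn ?powR_ge0// -powRrM mulVf ?gt_eqF// powRr1//.
  by rewrite mulr_ge0// ltW.
have huT : L2 leb setT (u \_ Om) by rewrite L2_restrict.
set Q := fine _.
have Q0 : 0 <= Q by rewrite fine_ge0// spectral_form_ge0.
rewrite -L2norm_restrict.
apply: le_trans (@faber_krahn_translation _ _ _ m r (C * (r ^+ 2) `^ s * Q) huT m0 (ltW r0) _ rm _ _) _.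
- rewrite (_ : [set x | _] = Om `&` [set x | u x != 0%R])//.
  apply/seteqP; split => [x /=|x [Ox ux]] /=; rewrite /patch; last by rewrite mem_set.
  by case: ifPn => [/set_mem //|_ /eqP].
- by rewrite !mulr_ge0// powR_ge0.
- by move=> y hy; exact: transl_frac.
(* Here [r <= m^(1/d)], since [2^(1/d) <= 2]. *)
have key : (r ^+ 2) `^ s <= m `^ (2 * s / d%:R).
  have -> : 2 * s / d%:R = (d%:R^-1 * 2%:R) * s by ring.
  rewrite !powRrM ge0_ler_powR ?nnegrE ?sqr_ge0 ?powR_ge0//; first exact: ltW.
  rewrite powR_mulrn ?powR_ge0// lerXn2r ?nnegrE ?powR_ge0 ?(ltW r0)//.
  rewrite /r powRM ?(ltW m0)// mulrAC ler_piMl ?powR_ge0//.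
  rewrite ler_pdivrMr// mul1r -[leRHS]powRr1// ler_powR ?ler1n//.
  by rewrite invf_le1 ?ltr0n// ler1n.
rewrite [leLHS](_ : _ = 2 * C * (r ^+ 2) `^ s * Q); last by ring.
by rewrite ler_wpM2r// ler_wpM2l// mulr_ge0.
Qed.
End spectral_faber_krahn.

(** * Gagliardo seminorms *)

Section kernel_integral.
Context {R : realType} {d : nat}.
Notation leb := (lebesgue_rV d : {measure set 'rV[R]_d -> \bar R}).
Notation rV2 := ('rV[R]_d * 'rV[R]_d)%type.
Variables (D : set 'rV[R]_d) (kern : rV2 -> R).
Hypotheses (mD : measurable D) (mk : measurable_fun setT kern).
Hypothesis k0 : forall p, 0 <= kern p.
Implicit Types (F H : rV2 -> R).

(** The factor [F] is separated from the weight, so that sums and multiples of squared differences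
    are handled apart from the singular kernel. *)
Definition kint F : \bar R :=
  (\int[leb]_(x in D) \int[leb]_(y in D) (F (x, y) * kern (x, y))%:E)%E.

Let inner F x : \bar R := (\int[leb]_(y in D) (F (x, y) * kern (x, y))%:E)%E.

Lemma measurable_kint_section F x : measurable_fun setT F ->
  measurable_fun D (fun y => (F (x, y) * kern (x, y))%:E).
Proof.
move=> mF; apply/measurable_EFinP; apply: measurable_funTS.
have m1 := measurableT_comp mF (measurable_pair1 x).
have m2 := measurableT_comp mk (measurable_pair1 x).
exact: measurable_funM m1 m2.
Qed.

Lemma measurable_kint_inner F : measurable_fun setT F -> (forall p, 0 <= F p) ->
  measurable_fun D (fun x => \int[leb]_(y in D) (F (x, y) * kern (x, y))%:E)%E.
Proof.
move=> mF F0; apply: measurable_funTS.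
(* The indicator turns the inner integral over [D] into one over the whole space, where Tonelli's
   theorem gives measurability. *)
pose F' (p : rV2) : \bar R := ((F p * kern p) * \1_D p.2)%:E.
have mF' : measurable_fun setT F'.
  apply/measurable_EFinP; apply: measurable_funM; first exact: measurable_funM.
  have mi : measurable_fun setT (\1_D : 'rV[R]_d -> R) by exact: measurable_indic.
  exact: (measurableT_comp mi measurable_snd).
have F'0 p : (0 <= F' p)%E by rewrite lee_fin !mulr_ge0.
rewrite (_ : (fun x => _) = fubini_F leb F').
  exact: measurable_fun_fubini_tonelli_F.
apply/funext => x; rewrite /fubini_F [LHS]integral_mkcond; apply: eq_integral => y _.
by rewrite /F' /patch indicE/=; case: ifPn => _; rewrite ?mulr1 ?mulr0.
Qed.

Let inner_ge0 F x : (forall p, 0 <= F p) -> (0 <= inner F x)%E.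
Proof. by move=> F0; apply: integral_ge0 => y _; rewrite lee_fin mulr_ge0. Qed.

Lemma kint_ge0 F : (forall p, 0 <= F p) -> (0 <= kint F)%E.
Proof. by move=> F0; apply: integral_ge0 => x _; exact: inner_ge0. Qed.

Lemma le_kint F H : measurable_fun setT F -> measurable_fun setT H ->
  (forall p, 0 <= F p) -> (forall p, 0 <= H p) ->
  (forall x y, D x -> D y -> F (x, y) <= H (x, y)) -> (kint F <= kint H)%E.
Proof.
move=> mF mH F0 H0 FH; apply: ge0_le_integral; first exact: mD.
- by move=> x _; exact: inner_ge0.
- exact: measurable_kint_inner.
- exact: measurable_kint_inner.
move=> x Dx; apply: ge0_le_integral; first exact: mD.
- by move=> y _; rewrite lee_fin mulr_ge0.
- exact: measurable_kint_section.
- exact: measurable_kint_section.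
by move=> y Dy; rewrite lee_fin ler_wpM2r// FH.
Qed.

Lemma eq_kint F H : (forall x y, D x -> D y -> F (x, y) = H (x, y)) -> kint F = kint H.
Proof.
move=> FH; apply: eq_integral => x /set_mem Dx; apply: eq_integral => y /set_mem Dy.
by rewrite FH.
Qed.

Lemma kintD F H : measurable_fun setT F -> measurable_fun setT H ->
  (forall p, 0 <= F p) -> (forall p, 0 <= H p) ->
  kint (fun p => F p + H p) = (kint F + kint H)%E.
Proof.
move=> mF mH F0 H0; rewrite /kint -ge0_integralD; first last.
- exact: measurable_kint_inner.
- by move=> x _; exact: inner_ge0.
- exact: measurable_kint_inner.
- by move=> x _; exact: inner_ge0.
- exact: mD.
apply: eq_integral => x _; rewrite -ge0_integralD; first last.
- exact: measurable_kint_section.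
- by move=> y _; rewrite lee_fin mulr_ge0.
- exact: measurable_kint_section.
- by move=> y _; rewrite lee_fin mulr_ge0.
- exact: mD.
by apply: eq_integral => y _; rewrite -EFinD -mulrDl.
Qed.

Lemma kintZ c F : 0 <= c -> measurable_fun setT F -> (forall p, 0 <= F p) ->
  kint (fun p => c * F p) = (c%:E * kint F)%E.
Proof.
move=> c0 mF F0; rewrite /kint -ge0_integralZl_EFin; first last.
- exact: c0.
- exact: measurable_kint_inner.
- by move=> x _; exact: inner_ge0.
- exact: mD.
apply: eq_integral => x _; rewrite -ge0_integralZl_EFin; first last.
- exact: c0.
- exact: measurable_kint_section.
- by move=> y _; rewrite lee_fin mulr_ge0.
- exact: mD.
by apply: eq_integral => y _; rewrite -EFinM mulrA.
Qed.

(** Meant for sets [B x] where [u] vanishes: the difference is then [u x], and what enters is the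
    size of the kernel on [B x] and the measure of that set. *)
Lemma kint_lower F (u : 'rV[R]_d -> R) (m q : R) (B : 'rV[R]_d -> set 'rV[R]_d) :
  measurable_fun setT F -> (forall p, 0 <= F p) -> measurable_fun D u ->
  0 <= m -> 0 <= q -> (forall x, measurable (B x)) ->
  (forall x, D x -> u x != 0 -> (m%:E <= leb (B x))%E) ->
  (forall x, B x `<=` D) ->
  (forall x y, D x -> u x != 0 -> B x y -> q * u x ^+ 2 <= F (x, y) * kern (x, y)) ->
  ((m * q)%:E * sqint leb D u <= kint F)%E.
Proof.
move=> mF F0 mu_ m0 q0 mB hm BD hq.
rewrite /sqint -ge0_integralZl_EFin; first last.
- exact: mulr_ge0.
- exact: measurable_sqr.
- by move=> x _; rewrite lee_fin sqr_ge0.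
- exact: mD.
apply: ge0_le_integral; first exact: mD.
- by move=> x _; rewrite -EFinM lee_fin mulr_ge0 ?sqr_ge0// mulr_ge0.
- by apply: measurable_funeM; exact: measurable_sqr.
- exact: measurable_kint_inner.
move=> x Dx; have [->|ux0] := eqVneq (u x) 0.
  by rewrite expr0n mule0; exact: inner_ge0.
apply: (@le_trans _ _ (\int[leb]_(y in B x) (q * u x ^+ 2)%:E)%E).
  rewrite integral_cst; last exact: mB.
  rewrite -EFinM -mulrA EFinM muleC; apply: lee_wpmul2l; last exact: hm.
  by rewrite lee_fin mulr_ge0 ?sqr_ge0.
apply: (@le_trans _ _ (\int[leb]_(y in B x) (F (x, y) * kern (x, y))%:E)%E).
  apply: ge0_le_integral; first exact: mB.
  - by move=> y _; rewrite lee_fin mulr_ge0 ?sqr_ge0.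
  - exact: measurable_cst.
  - by apply: measurable_funS (measurable_kint_section x mF) => //; exact: BD.
  by move=> y By; rewrite lee_fin; exact: hq.
apply: ge0_subset_integral => //.
- exact: measurable_kint_section.
- by move=> y _; rewrite lee_fin mulr_ge0.
Qed.

End kernel_integral.

Section gagliardo_theory.
Context {R : realType} {d : nat}.
Notation leb := (lebesgue_rV d : {measure set 'rV[R]_d -> \bar R}).
Variables (D : set 'rV[R]_d) (s : R).
Hypotheses (mD : measurable D) (d_gt0 : (0 < d)%N) (s0 : 0 < s).
Implicit Types (u v w : 'rV[R]_d -> R).

Definition gkern (p : 'rV[R]_d * 'rV[R]_d) : R :=
  (enorm (p.1 - p.2) `^ (d%:R + 2 * s))^-1.

Lemma gkern_ge0 p : 0 <= gkern p.
Proof. by rewrite invr_ge0 powR_ge0. Qed.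

Lemma measurable_enorm : measurable_fun setT (@enorm R d).
Proof.
apply: (@measurableT_comp _ _ _ _ _ _ (@Num.sqrt R)).
  by apply: continuous_measurable_fun; exact: sqrt_continuous.
apply: measurable_sum => i; apply: measurable_funX; exact: measurable_rV_coord.
Qed.

Lemma measurable_subrV : measurable_fun setT (fun p : 'rV[R]_d * 'rV[R]_d => p.1 - p.2).
Proof.
apply: measurable_fun_rV => i; under eq_fun do rewrite !mxE.
apply: measurable_funB.
  exact: (measurableT_comp (measurable_rV_coord i) measurable_fst).
exact: (measurableT_comp (measurable_rV_coord i) measurable_snd).
Qed.

Lemma measurable_gkern : measurable_fun setT gkern.
Proof.
apply: (measurableT_comp measurable_inv).
apply: (measurableT_comp (measurable_powR _)).
exact: (measurableT_comp measurable_enorm measurable_subrV).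
Qed.

Definition sqdiff u (p : 'rV[R]_d * 'rV[R]_d) : R := (u p.1 - u p.2) ^+ 2.

Lemma sqdiff_ge0 u p : 0 <= sqdiff u p. Proof. exact: sqr_ge0. Qed.

Lemma measurable_sqdiff u : measurable_fun setT u -> measurable_fun setT (sqdiff u).
Proof.
move=> m; apply: measurable_funX; apply: measurable_funB.
  exact: (measurableT_comp m measurable_fst).
exact: (measurableT_comp m measurable_snd).
Qed.

Lemma gagliardoE u : gagliardo D s u u = kint D gkern (sqdiff u).
Proof.
by apply: eq_integral => x _; apply: eq_integral => y _; rewrite /sqdiff expr2.
Qed.

(** The functions are measurable on [D] only; extension by zero makes the integrand measurable on
    the whole product, as the lemmas on [kint] demand. *)
Lemma gagliardo_restrict u : gagliardo D s u u = gagliardo D s (u \_ D) (u \_ D).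
Proof.
apply: eq_integral => x Dx; apply: eq_integral => y Dy.
by rewrite /patch Dx Dy.
Qed.

Lemma gagliardo_ge0 u : (0 <= gagliardo D s u u)%E.
Proof. by rewrite gagliardoE; apply: kint_ge0 => p; [exact: gkern_ge0|exact: sqr_ge0]. Qed.

Let mR u : measurable_fun D u -> measurable_fun setT (u \_ D).
Proof. by move=> m; exact: ((measurable_restrictT u mD).1 m). Qed.

(** Pointwise, [(v x - v y)^2 <= (w x - w y) (v x - v y)] for [v = (w - k)^+], because the positive
    part is nondecreasing and 1-Lipschitz. *)
Lemma gagliardo_truncation w k t : measurable_fun D w -> 0 <= t -> t <= 2 ->
  (gagliardo D s (fun x => w x - t * pos_above k w x)%R (fun x => w x - t * pos_above k w x)%R +
   (2 * t - t ^+ 2)%:E * gagliardo D s (pos_above k w) (pos_above k w) <=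
   gagliardo D s w w)%E.
Proof.
move=> mw t0 t2; have mv := measurable_pos_above k mw.
have mwt : measurable_fun D (fun x => w x - t * pos_above k w x).
  by apply: measurable_funB => //; exact: measurable_funM.
have tt0 : 0 <= 2 * t - t ^+ 2 by rewrite expr2 -mulrBl mulr_ge0// subr_ge0.
rewrite (gagliardo_restrict (fun x => w x - t * pos_above k w x)).
rewrite (gagliardo_restrict (pos_above k w)) (gagliardo_restrict w) !gagliardoE.
have k0 := gkern_ge0; have mk := measurable_gkern.
have m1 := measurable_sqdiff (mR mwt); have m2 := measurable_sqdiff (mR mv).
rewrite -kintZ//; last exact: sqdiff_ge0.
have m3 : measurable_fun setT (fun p => (2 * t - t ^+ 2) * sqdiff (pos_above k w \_ D) p).
  exact: measurable_funM.
have g3 p : 0 <= (2 * t - t ^+ 2) * sqdiff (pos_above k w \_ D) p by rewrite mulr_ge0 ?sqdiff_ge0.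
rewrite -kintD//; last exact: sqdiff_ge0.
apply: le_kint => //.
- exact: measurable_funD.
- exact: measurable_sqdiff (mR mw).
- by move=> p; rewrite addr_ge0 ?sqdiff_ge0.
- exact: sqdiff_ge0.
move=> x y Dx Dy; rewrite /sqdiff /patch !mem_set//.
have key : (pos_above k w x - pos_above k w y) ^+ 2 <=
    (w x - w y) * (pos_above k w x - pos_above k w y).
  rewrite /pos_above !maxEle; case: (leP (w x - k) 0); case: (leP (w y - k) 0) => h1 h2; nra.
move: (pos_above k w x) (pos_above k w y) key => a b key.
have := ler_wpM2l t0 key; nra.
Qed.

(** Around each point of [D], at least [2 m - m] of the cube lies in [D] where [u] vanishes; there
    the difference is [u x] and the kernel is at least [(d r)^-(d + 2 s)]. *)
Lemma gagliardo_faber_krahn u (m r : R) :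
  measurable_fun D u -> 0 < m -> 0 < r ->
  (leb (D `&` [set x | u x != 0%R]) <= m%:E)%E ->
  (forall x, D x -> (2 * m)%:E <= leb (D `&` cube x r))%E ->
  (sqint leb D u <= ((d%:R * r) `^ (d%:R + 2 * s) / m)%:E * gagliardo D s u u)%E.
Proof.
move=> mu_ m0 r0 um hD.
have um' := mR mu_.
pose S := D `&` [set x | u x != 0%R].
have mS : measurable S.
  rewrite [S](_ : _ = D `&` (u @^-1` (~` [set 0]))); first by apply: mu_ => //; exact: measurableC.
  by apply/seteqP; split => x [Dx /=] h; split => //; apply/eqP.
pose B x := (D `&` cube x r) `\` S.
have mB x : measurable (B x).
  by apply: measurableD => //; apply: measurableI => //; exact: measurable_cube.
have lB x : D x -> (m%:E <= leb (B x))%E.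
  move=> Dx; have mDc : measurable (D `&` cube x r).
    by apply: measurableI => //; exact: measurable_cube.
  have : (leb (D `&` cube x r) <= leb (B x) + leb S)%E.
    rewrite -[in leLHS](setUIDK (D `&` cube x r) S) setUC.
    apply: le_trans (measureU2 _ (mB x) (measurableI _ _ mDc mS)) _.
    by rewrite leeD2l// le_measure ?inE//; exact: measurableI.
  move=> h; have := le_trans (hD x Dx) (le_trans h (leeD2l _ um)).
  by rewrite -leeBlDr// -EFinB; apply: le_trans; rewrite lee_fin; lra.
pose P := (d%:R * r) `^ (d%:R + 2 * s).
have d0 : 0 < d%:R :> R by rewrite ltr0n.
have P0 : 0 < P by rewrite powR_gt0// mulr_gt0.
have := @kint_lower R d D gkern mD measurable_gkern gkern_ge0 (sqdiff (u \_ D)) u m P^-1 B.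
rewrite gagliardo_restrict gagliardoE => /(_ (measurable_sqdiff um') (sqdiff_ge0 _) mu_ (ltW m0)).
have P0' : 0 <= P^-1 by rewrite invr_ge0 ltW.
move=> /(_ P0' mB (fun x Dx _ => lB x Dx) (fun x y => fun h => h.1.1)).
have hq x y : D x -> u x != 0 -> B x y ->
    P^-1 * u x ^+ 2 <= sqdiff (u \_ D) (x, y) * gkern (x, y).
  move=> Dx ux0 [[Dy cy] nS].
  have uy : u y = 0 by apply/eqP/negPn/negP => h; apply: nS.
  rewrite /sqdiff /patch !mem_set// uy subr0 mulrC ler_wpM2l ?sqr_ge0// /gkern /=.
  (* At [x = y] the kernel has the default value [0], which would break the lower bound. *)
  have xy : 0 < enorm (x - y).
    rewrite sqrtr_gt0 lt_neqAle eq_sym sumr_ge0 ?andbT; last by move=> i _; exact: sqr_ge0.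
    apply: contra ux0; rewrite psumr_eq0; last by move=> i _; exact: sqr_ge0.
    move=> /allP h; rewrite -uy; apply/eqP; congr u; apply/rowP => i.
    have := h i (mem_index_enum i); rewrite /= sqrf_eq0 !mxE subr_eq0 => /eqP //.
  have dr0 : 0 <= d%:R * r by rewrite mulr_ge0// ltW.
  have ds0 : 0 <= d%:R + 2 * s by rewrite addr_ge0// mulr_ge0// ltW.
  have xyP : 0 < enorm (x - y) `^ (d%:R + 2 * s) by rewrite powR_gt0.
  rewrite (lef_pV2 P0 xyP) /P (ge0_ler_powR ds0) ?nnegrE ?(ltW xy)//.
  rewrite -(ger0_norm dr0) -sqrtr_sqr ler_sqrt ?sqr_ge0//.
  apply: (@le_trans _ _ (\sum_(i < d) r ^+ 2)).
    apply: ler_sum => i _; rewrite !mxE -(real_normK (num_real (x ord0 i - y ord0 i))).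
    by rewrite lerXn2r ?nnegrE ?(ltW r0)// distrC ltW// cy.
  rewrite sumr_const card_ord exprMn -[r ^+ 2 *+ d]mulr_natl ler_wpM2r ?sqr_ge0//.
  by rewrite expr2 ler_peMl ?ler0n// ler1n.
move=> /(_ hq) h.
rewrite -(@lee_pmul2l _ (m * P^-1)%:E)//; last by rewrite lte_fin mulr_gt0// invr_gt0.
rewrite muleA -EFinM (_ : m * P^-1 * (P / m) = 1) ?mul1e//.
by field; rewrite !gt_eqF.
Qed.

End gagliardo_theory.

(** * Measure density of Lipschitz domains *)

Section euclidean_norm.
Context {R : realType} {n : nat}.
Implicit Types (x y v : 'rV[R]_n).

Lemma enorm_ge0 v : 0 <= enorm v. Proof. exact: sqrtr_ge0. Qed.

Lemma coord_le_enorm v i : `|v ord0 i| <= enorm v.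
Proof.
rewrite -sqrtr_sqr ler_sqrt ?sumr_ge0//; last by move=> j _; exact: sqr_ge0.
by rewrite (bigD1 i)//= lerDl sumr_ge0// => j _; exact: sqr_ge0.
Qed.

Lemma enorm_le_sup v (r : R) : 0 <= r -> (forall i, `|v ord0 i| <= r) -> enorm v <= n%:R * r.
Proof.
move=> r0 h; have dr0 : 0 <= n%:R * r by rewrite mulr_ge0.
rewrite -(ger0_norm dr0) -sqrtr_sqr ler_sqrt ?sqr_ge0//.
apply: (@le_trans _ _ (\sum_(i < n) r ^+ 2)).
  apply: ler_sum => i _; rewrite -(real_normK (num_real (v ord0 i))).
  by rewrite lerXn2r ?nnegrE.
rewrite sumr_const card_ord exprMn -[r ^+ 2 *+ n]mulr_natl ler_wpM2r ?sqr_ge0//.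
by case: n => [|m]; [rewrite expr0n|rewrite expr2 ler_peMl ?ler0n// ler1n].
Qed.

Lemma enorm_orthogonal (Q : 'M[R]_n) v : Q *m Q^T = 1%:M -> enorm (v *m Q) = enorm v.
Proof.
move=> QQ; rewrite /enorm; congr Num.sqrt.
have E (x : 'rV[R]_n) : \sum_i x ord0 i ^+ 2 = (x *m x^T) ord0 ord0.
  by rewrite mxE; apply: eq_bigr => i _; rewrite mxE expr2.
by rewrite !E trmx_mul mulmxA -(mulmxA v) QQ mulmx1.
Qed.

Lemma enorm_delta i : enorm (delta_mx ord0 i : 'rV[R]_n) = 1.
Proof.
rewrite /enorm (bigD1 i)//= big1 ?addr0; last first.
  by move=> j /negbTE ji; rewrite mxE eqxx ji expr0n.
by rewrite mxE !eqxx expr1n sqrtr1.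
Qed.

End euclidean_norm.

Lemma enorm_col' {R : realType} {n : nat} (i : 'I_n) (v : 'rV[R]_n) :
  enorm (col' i v) <= enorm v.
Proof.
rewrite /enorm ler_sqrt ?sumr_ge0//; last by move=> j _; exact: sqr_ge0.
case: n i v => [[]//|n] i v.
rewrite [leRHS](bigD1_ord i)//= ler_wpDl ?sqr_ge0//.
by apply: ler_sum => j _; rewrite mxE.
Qed.

Section lipschitz_density.
Context {R : realType} {d : nat}.
Notation leb := (lebesgue_rV d : {measure set 'rV[R]_d -> \bar R}).
Variable Om : set 'rV[R]_d.
Hypotheses (d_gt0 : (0 < d)%N) (oOm : open Om) (bOm : bounded_set Om).

(** An interior corkscrew condition at [x], with cubes in place of balls. *)
Definition interior_cubes (x : 'rV[R]_d) (c rho : R) : Prop :=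
  forall r, 0 < r -> r <= rho -> exists z, cube z (c * r) `<=` Om `&` cube x r.

Lemma interior_cubesS x (c rho c' rho' : R) : c' <= c -> rho' <= rho ->
  interior_cubes x c rho -> interior_cubes x c' rho'.
Proof.
move=> cc rr H r r0 rr'; have [z hz] := H r r0 (le_trans rr' rr).
exists z => y hy; apply: hz => i; apply: lt_le_trans (hy i) _.
by rewrite ler_wpM2r// ltW.
Qed.

Let d0 : 0 < d%:R :> R. Proof. by rewrite ltr0n. Qed.

(* In rotated coordinates the region above the graph contains, above each of its
   points, a cone of slope [L], hence an axis-parallel cube of comparable size. *)
Lemma epigraph_interior_cubes (x0 : 'rV[R]_d) (Q : 'M[R]_d) (i : 'I_d)
    (h : 'rV[R]_(d.-1) -> R) (L e : R) : Q *m Q^T = 1%:M -> 0 < e ->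
  (forall y z, `|h y - h z| <= L * enorm (y - z)) ->
  (forall x, enorm (x - x0) < e -> (Om x <-> h (col' i (x *m Q)) < (x *m Q) ord0 i)) ->
  exists c delta rho : R, [/\ 0 < c, 0 < delta, 0 < rho &
    forall x, Om x -> `|x - x0| < delta -> interior_cubes x c rho].
Proof.
move=> QQ e0 hL hOm; have QQ' : Q^T *m Q = 1%:M by exact: mulmx1C.
pose M := `|L|; have M0 : 0 <= M by exact: normr_ge0.
have M1 : 0 < M + 1 by rewrite ltr_wpDl.
(* Makes [d c (M + 1) = 1 / 2], so that the rise of the graph and the downward deviation across the
   cube add up to at most the lift [a = r / 2]. *)
pose c := (2 * d%:R * (M + 1))^-1.
have c0 : 0 < c by rewrite invr_gt0 !mulr_gt0.
have cE : d%:R * c * (M + 1) = 1 / 2.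
  by rewrite /c; field; rewrite !gt_eqF.
have c2 : c <= 1 / 2.
  rewrite -cE -mulrA mulrCA -[leLHS]mulr1 ler_wpM2l ?(ltW c0)//.
  by rewrite -[leLHS]mulr1 ler_pM ?ler1n// lerDr.
(* Points within [r <= dl] of [x] in the sup norm stay within [e / 2] of [x0], where [Om] is an
   epigraph. *)
pose dl := e / (4 * d%:R); have dl0 : 0 < dl by rewrite divr_gt0// mulr_gt0.
exists c, dl, dl; split => // x Ox xx0 r r0 rdl.
(* [w] is the axis of the graph in the original coordinates; the centre of the cube is lifted by [a]
   along it. *)
pose a := r / 2; pose w := delta_mx ord0 i *m Q^T : 'rV[R]_d.
have w1 j : `|w ord0 j| <= 1.
  apply: le_trans (coord_le_enorm _ _) _.
  by rewrite /w enorm_orthogonal ?enorm_delta// trmxK.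
exists (x + a *: w) => y hy.
pose eta := y - (x + a *: w).
have yE : y = x + a *: w + eta by rewrite /eta addrC subrK.
have cr0 : 0 <= c * r by rewrite mulr_ge0// ltW.
have eta_sup j : `|eta ord0 j| < c * r by have := hy j; rewrite /eta !mxE.
have eta_n : enorm (eta *m Q) <= d%:R * (c * r).
  rewrite enorm_orthogonal//; apply: enorm_le_sup => // j; exact: ltW.
have a0 : 0 < a by rewrite divr_gt0.
have xy j : `|y ord0 j - x ord0 j| < r.
  have -> : y ord0 j - x ord0 j = a * w ord0 j + eta ord0 j by rewrite {1}yE !mxE; ring.
  apply: le_lt_trans (ler_normD _ _) _; rewrite normrM (gtr0_norm a0).
  have h1 : a * `|w ord0 j| <= a by rewrite -[leRHS]mulr1 ler_wpM2l// ltW.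
  have h2 : c * r <= a by rewrite /a mulrC; apply: ler_wpM2l; [exact: ltW|rewrite -div1r].
  have := eta_sup j; rewrite /a in h1 h2 *; lra.
split => //.
have xx0c j : `|x ord0 j - x0 ord0 j| < dl.
  by apply: le_lt_trans xx0; have := normr_coord_le (x - x0) j; rewrite !mxE.
have near_ball (z : 'rV[R]_d) : (forall j, `|z ord0 j - x ord0 j| < r) -> enorm (z - x0) < e.
  move=> hz; apply: (@le_lt_trans _ _ (d%:R * (2 * dl))).
    apply: enorm_le_sup; first by rewrite mulr_ge0// ltW.
    move=> j; rewrite !mxE -(subrKA (x ord0 j)); apply: le_trans (ler_normD _ _) _.
    have := hz j; have := xx0c j; lra.
  rewrite /dl (_ : _ * _ = e / 2); first lra.
  by field; rewrite gt_eqF.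
have Hx : h (col' i (x *m Q)) < (x *m Q) ord0 i.
  by apply/(hOm x) => //; apply: near_ball => j; rewrite subrr normr0.
apply/(hOm y); first exact: near_ball.
have yQ : y *m Q = x *m Q + a *: delta_mx ord0 i + eta *m Q.
  by rewrite {1}yE !mulmxDl -scalemxAl /w -mulmxA QQ' mulmx1.
have colE : col' i (y *m Q) - col' i (x *m Q) = col' i (eta *m Q).
  move: (x *m Q) (eta *m Q) (y *m Q) yQ => p q _ ->; apply/rowP => j; rewrite !mxE.
  by rewrite [lift i j == i]eq_sym (negbTE (neq_lift _ _)) andbF mulr0; ring.
have h1 : h (col' i (y *m Q)) <= h (col' i (x *m Q)) + M * (d%:R * (c * r)).
  rewrite -lerBlDl; apply: le_trans (ler_norm _) _; apply: le_trans (hL _ _) _.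
  rewrite colE; apply: (@le_trans _ _ (M * enorm (col' i (eta *m Q)))).
    by rewrite ler_wpM2r ?enorm_ge0// ler_norm.
  by rewrite ler_wpM2l//; apply: le_trans (enorm_col' _ _) eta_n.
have h2 : (y *m Q) ord0 i = (x *m Q) ord0 i + a + (eta *m Q) ord0 i.
  move: (x *m Q) (eta *m Q) (y *m Q) yQ => p q _ ->.
  by rewrite !mxE !eqxx mulr1.
have h3 : - (d%:R * (c * r)) <= (eta *m Q) ord0 i.
  rewrite lerNl; apply: le_trans eta_n; apply: le_trans (coord_le_enorm _ i).
  by rewrite -normrN ler_norm.
(* Equality is enough here: the strict inequality comes from [Hx]. *)
have h4 : d%:R * (c * r) * (M + 1) = a.
  by rewrite /a (_ : _ * _ = d%:R * c * (M + 1) * r); [rewrite cE; lra|ring].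
rewrite h2; move: h1 Hx h3 h4; rewrite mulrDr mulr1 (mulrC (d%:R * (c * r))); lra.
Qed.

(** Interior points satisfy the condition by openness and boundary points by the epigraph
    description, each with its own constants in a neighbourhood; compactness of the closure makes
    them uniform. *)
Lemma lipschitz_interior_cubes : lipschitz_boundary Om ->
  exists n : nat, forall x, Om x -> interior_cubes x n.+1%:R^-1 n.+1%:R^-1.
Proof.
move=> lip.
have bc : bounded_set (closure Om).
  have [M [Mr hM]] := bOm; exists (M + 1); split; first by rewrite num_real.
  move=> y My x cx; apply/ler_addgt0Pr => e e0.
  have [z [Oz]] := cx _ (nbhsx_ballx x _ e0).
  rewrite mx_norm_ball /ball_ /= => zx.
  have hz : `|z| <= y by apply: hM => //; apply: lt_trans My; rewrite ltrDl.
  by rewrite -(subrK z x); apply: le_trans (ler_normD _ _) _; rewrite addrC lerD// ltW.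
have cK : compact (closure Om).
  by apply: bounded_closed_compact => //; exact: closed_closure.
have local x0 : closure Om x0 -> exists c delta rho : R, [/\ 0 < c, 0 < delta, 0 < rho &
    forall x, Om x -> `|x - x0| < delta -> interior_cubes x c rho].
  move=> cx0; have [Ox0|nOx0] := pselect (Om x0); last first.
    have [Q [i [h [L [r [QQ r0 hL hOm]]]]]] := lip x0 cx0 nOx0.
    exact: (epigraph_interior_cubes QQ r0 hL hOm).
  have /nbhs_ballP[e /= e0 eOm] : nbhs x0 Om by apply: open_nbhs_nbhs; split.
  exists 1, (e / 2), (e / 2); split; rewrite ?divr_gt0// => x Ox xx0 r r0 re.
  exists x; rewrite mul1r => y hy; split => //; apply: eOm.
  rewrite mx_norm_ball /ball_ /=; apply: (@le_lt_trans _ _ (`|x0 - x| + `|x - y|)).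
    by rewrite -[leLHS](_ : `|(x0 - x) + (x - y)| = _) ?ler_normD// subrKA.
  rewrite (distrC x0) [e]splitr; apply: ltr_leD => //; apply: le_trans re.
  rewrite [leLHS]/Num.norm/= mx_normrE; apply: bigmax_le => [|[i j] _]; first exact: ltW.
  by rewrite /= (ord1 i) !mxE distrC ltW.
have /compact_near_coveringP cov := cK.
(* The condition weakens as both constants shrink, so a single index replaces them and compactness
   can be used along [n] tending to infinity. *)
pose P (n : nat) x := Om x -> interior_cubes x n.+1%:R^-1 n.+1%:R^-1.
have := cov nat \oo P _.
case.
  move=> x0 cx0; have [c [dl [rho [c0 dl0 rho0 H]]]] := local x0 cx0.
  have m0 : 0 < Num.min c rho by rewrite lt_min c0.
  have [N _ hN] := near_infty_natSinv_lt (PosNum m0).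
  exists (ball x0 dl, [set n | (N <= n)%N]).
    by split; [exact: nbhsx_ballx|exists N].
  move=> [x n] /= [bx Nn] Ox.
  have := hN n Nn; rewrite /= lt_min => /andP[nc nr].
  apply: interior_cubesS (ltW nc) (ltW nr) _; apply: H => //.
  by move: bx; rewrite mx_norm_ball /ball_ /= distrC.
move=> N _ /(_ N (leqnn N)) hN; exists N => x Ox; apply: (hN x) => //.
exact: subset_closure.
Qed.

Lemma lipschitz_measure_density : lipschitz_boundary Om ->
  exists2 c : R, 0 < c & forall x r, Om x -> 0 < r -> r <= c ->
    ((c * r)%:E ^+ d <= leb (Om `&` cube x r))%E.
Proof.
move=> /lipschitz_interior_cubes[n hn]; exists n.+1%:R^-1; first by rewrite invr_gt0.
move=> x r Ox r0 rn; have [z hz] := hn x Ox r r0 rn.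
have cr0 : 0 <= n.+1%:R^-1 * r by rewrite mulr_ge0// ltW.
apply: (@le_trans _ _ (leb (cube z (n.+1%:R^-1 * r)))).
  rewrite [leRHS](lebesgue_cube z cr0) -EFin_expe lee_fin.
  apply: lerXn2r; [by rewrite nnegrE|by rewrite nnegrE mulr_ge0|].
  by rewrite mulr_natl mulr2n lerDl.
apply: le_measure; rewrite ?inE//; first exact: measurable_cube.
by apply: measurableI; [exact: open_measurable_rV|exact: measurable_cube].
Qed.
End lipschitz_density.

(** * Positivity of the normalizing constant of the seminorm *)

Section gamma_function.
Context {R : realType}.
Notation mu := (@lebesgue_measure R).
Variable a : R.
Hypothesis a0 : 0 < a.

Let g (t : R) : R := t `^ (a - 1) * expR (- t).

Let g_ge0 t : 0 <= g t. Proof. by rewrite mulr_ge0 ?powR_ge0 ?expR_ge0. Qed.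

Let measurable_g (D : set R) : measurable_fun D g.
Proof.
apply: measurable_funTS; apply: measurable_funM; first exact: measurable_powR.
by apply: (measurableT_comp (@measurable_expR R)); exact: measurable_funN.
Qed.

Lemma integral_powR_itv (e : R) : 0 < e -> e < 1 ->
  (\int[mu]_(t in `[e, 1%R]) (t `^ (a - 1))%:E <= (a^-1)%:E)%E.
Proof.
move=> e0 e1.
have cont (b : R) (x : R) : 0 < x -> {for x, continuous (fun t : R => t `^ b)}.
  move=> x0; apply: differentiable_continuous; apply/derivable1_diffP.
  by have [] := is_derive1_powR b x0.
have D (x : R) : 0 < x -> is_derive x 1 (fun t : R => a^-1 * t `^ a) (x `^ (a - 1)).
  move=> x0; apply: is_derive_eq (is_deriveZ a^-1 (is_derive1_powR a x0)) _.
  by rewrite /GRing.scale/= mulrA mulVf ?mul1r// gt_eqF.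
have cF (x : R) : 0 < x -> {for x, continuous (fun t : R => a^-1 * t `^ a)}.
  move=> x0; apply: differentiable_continuous; apply/derivable1_diffP.
  by have [] := D x x0.
rewrite (@continuous_FTC2 _ (fun t => t `^ (a - 1)) (fun t => a^-1 * t `^ a))//.
- by rewrite powR1 mulr1 -EFinB lee_fin gerBl mulr_ge0 ?powR_ge0// invr_ge0 ltW.
- apply: continuous_in_subspaceT => x /set_mem; rewrite /= in_itv/= => /andP[ex _].
  by apply: cont; exact: lt_le_trans ex.
- split.
  + by move=> x; rewrite in_itv/= => /andP[ex _]; have [] := D x (lt_trans e0 ex).
  + exact: cvg_at_right_filter (cF e e0).
  + exact: cvg_at_left_filter (cF 1 ltr01).
move=> x; rewrite in_itv/= => /andP[ex _]; rewrite derive1E.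
by have [_ ->] := D x (lt_trans e0 ex).
Qed.

Lemma integral_gamma01 : (\int[mu]_(t in `]0%R, 1%R]) (g t)%:E <= (a^-1)%:E)%E.
Proof.
(* The index [n + 2] keeps the lower endpoint strictly below [1], as [integral_powR_itv] asks. *)
pose F n : set (measurableTypeR R) := `[(n.+2%:R^-1 : R), 1%R]%classic.
have FE : `]0%R, 1%R]%classic = \bigcup_n F n.
  apply/seteqP; split => t; last first.
    case=> n _; rewrite /F /=; rewrite !in_itv/= => /andP[nt ->]; rewrite andbT.
    by apply: lt_le_trans nt; rewrite invr_gt0.
  rewrite /= in_itv/= => /andP[t0 t1].
  have [n _ hn] := near_infty_natSinv_lt (PosNum t0).
  exists n => //; rewrite /F /= in_itv/= t1 andbT; apply: le_trans (ltW (hn n (leqnn n))).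
  by rewrite lef_pV2 ?posrE// ler_nat.
rewrite FE.
have nF : nondecreasing_seq F.
  apply/nondecreasing_seqP => n; apply/subsetPset => t; rewrite /F /= !in_itv/= => /andP[nt ->].
  by rewrite andbT; apply: le_trans nt; rewrite lef_pV2 ?posrE// ler_nat.
have mF n : measurable (F n) by exact: measurable_itv.
have mg n : measurable_fun (F n) (EFin \o g) by apply/measurable_EFinP; exact: measurable_g.
have cv := @ge0_nondecreasing_set_cvg_integral _ (measurableTypeR R) R F (EFin \o g) mu nF mF mg
  (fun n t _ => g_ge0 t).
rewrite -(cvg_lim _ cv)//; apply: lime_le; first by apply/cvg_ex; eexists; exact: cv.
apply: nearW => n.
apply: (@le_trans _ _ (\int[mu]_(t in F n) (t `^ (a - 1))%:E)%E).
  apply: ge0_le_integral; first exact: mF.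
  - by move=> t _; rewrite lee_fin.
  - exact: mg.
  - by apply/measurable_EFinP; apply: measurable_funTS; exact: measurable_powR.
  move=> t; rewrite /F /= in_itv/= => /andP[nt _]; rewrite lee_fin /g ler_piMr ?powR_ge0//.
  by rewrite -expR0 ler_expR lerNl oppr0; apply: le_trans nt; rewrite invr_ge0.
apply: integral_powR_itv; first by rewrite invr_gt0.
by rewrite invf_lt1// ltr1n.
Qed.

(** Half of the exponential absorbs the power: [p ln t = p ln (2 p) + p ln (t / (2 p))], and
    [ln x <= x] bounds the last term by [t / 2]. *)
Lemma gamma_integrand_le : exists2 C : R, 0 <= C &
  forall t, 1 <= t -> g t <= C * expR (- (2^-1) * t).
Proof.
pose p := `|a - 1| + 1; have p0 : 0 < p by rewrite ltr_wpDl.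
have p2 : 0 < 2 * p by rewrite mulr_gt0.
exists (expR (p * ln (2 * p))) => [|t t1]; first exact: expR_ge0.
have t0 : 0 < t by exact: lt_le_trans t1.
rewrite -expRD /g /powR gt_eqF// -expRD ler_expR.
have lnt : 0 <= ln t by rewrite ln_ge0.
have h1 : (a - 1) * ln t <= p * ln t.
  by rewrite ler_wpM2r// /p; have := ler_norm (a - 1); lra.
have h2 : p * ln t <= p * ln (2 * p) + t / 2.
  have -> : ln t = ln (2 * p) + ln (t / (2 * p)).
    by rewrite -lnM ?posrE ?divr_gt0// mulrC divfK// gt_eqF.
  rewrite mulrDr lerD2l.
  have := ler_wpM2l (ltW p0) (ltW (ln_sublinear (divr_gt0 t0 p2))).
  by move=> /le_trans; apply; rewrite le_eqVlt; apply/orP; left; apply/eqP; field; rewrite gt_eqF.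
lra.
Qed.

Lemma integral_gamma1y : (\int[mu]_(t in `]1%R, +oo[) (g t)%:E < +oo)%E.
Proof.
have [C C0 hC] := gamma_integrand_le.
have h20 : 0 < 2^-1 :> R by rewrite invr_gt0.
have mp : measurable_fun setT (fun t : measurableTypeR R => (exponential_pdf (2^-1 : R) t)%:E).
  by apply/measurable_EFinP; exact: measurable_exponential_pdf.
have C20 : 0 <= 2 * C by rewrite mulr_ge0.
have p0 (t : R) : (0 <= (exponential_pdf (2^-1 : R) t)%:E)%E.
  by rewrite lee_fin exponential_pdf_ge0// ltW.
apply: (@le_lt_trans _ _ (\int[mu]_t ((2 * C)%:E * (exponential_pdf (2^-1 : R) t)%:E))%E).
  apply: (@le_trans _ _ (\int[mu]_(t in `]1%R, +oo[) ((2 * C)%:E * (exponential_pdf (2^-1 : R) t)%:E))%E).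
    apply: ge0_le_integral; first exact: measurable_itv.
    - by move=> t _; rewrite lee_fin.
    - by apply/measurable_EFinP; exact: measurable_g.
    - by apply: measurable_funTS; apply: measurable_funeM.
    move=> t; rewrite /= in_itv/= andbT => t1; rewrite -EFinM lee_fin exponential_pdfE; last first.
      by rewrite ltW// (lt_trans _ t1).
    apply: le_trans (hC t (ltW t1)) _.
    by rewrite [leRHS](_ : _ = C * expR (- 2^-1 * t))//; field.
  apply: ge0_subset_integral => //.
    by apply: measurable_funeM.
  by move=> t _; rewrite mule_ge0// lee_fin.
rewrite ge0_integralZl//.
by rewrite integral_exponential_pdf// mule1 ltry.
Qed.

Lemma integral_gamma_lty : (\int[mu]_(t in `]0%R, +oo[) (g t)%:E < +oo)%E.
Proof.
have -> : `]0%R, +oo[%classic = `]0%R, 1%R]%classic `|` `]1%R, +oo[%classic :> set R.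
  by rewrite -itv_bndbnd_setU// bnd_simp.
rewrite ge0_integral_setU//; last 3 first.
- by apply/measurable_EFinP; exact: measurable_g.
- by move=> t _; rewrite lee_fin.
- apply/disj_setPS => t [] /=; rewrite !in_itv/= => /andP[_ t1]; rewrite andbT => t2.
  by have := lt_le_trans t2 t1; rewrite ltxx.
rewrite lte_add_pinfty//; last exact: integral_gamma1y.
exact: le_lt_trans integral_gamma01 (ltry _).
Qed.

(** [Gamma] is a [fine] part and would be [0] for a divergent integral, so positivity needs
    convergence as well as a positive integrand on a set of positive measure. *)
Lemma Gamma_gt0 : 0 < Gamma a.
Proof.
have ge0 : (0 <= \int[mu]_(t in `]0%R, +oo[) (g t)%:E)%E by apply: integral_ge0 => t _; rewrite lee_fin.
rewrite /Gamma /Rintegral fine_gt0// integral_gamma_lty andbT lt_neqAle ge0 andbT.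
apply/eqP => /esym h.
have mg : measurable_fun (`]0%R, +oo[%classic : set R) (EFin \o g).
  by apply/measurable_EFinP; exact: measurable_g.
have /ae_eq_integral_abs : (\int[mu]_(t in `]0%R, +oo[) `|(g t)%:E| = 0)%E.
  by under eq_integral do rewrite gee0_abs ?lee_fin//.
move=> /(_ (measurable_itv _) mg) [N [mN N0 sub]].
have : (mu (`]0%R, 1%R]%classic : set R) <= mu N)%E.
  apply: le_measure; rewrite ?inE//.
  move=> t; rewrite /= in_itv/= => /andP[t0 _]; apply: sub => /= hh.
  have : g t = 0 by apply: EFin_inj; apply: hh; rewrite in_itv/= t0.
  by apply/eqP; rewrite mulf_neq0 ?gt_eqF ?expR_gt0// powR_gt0.
by rewrite N0 lebesgue_measure_itv/= lte_fin ltr01 oppr0 adde0 lee_fin ler10.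
Qed.
End gamma_function.

Lemma frac_const_gt0 {R : realType} {d : nat} (s : R) : 0 < s -> s < 1 ->
  0 < @frac_const R d s.
Proof.
move=> s0 s1; rewrite /frac_const divr_gt0//.
  rewrite mulr_gt0 ?Gamma_gt0//; first by rewrite mulr_gt0// powR_gt0.
  by rewrite ltr_pwDl// divr_ge0.
by rewrite mulr_gt0 ?Gamma_gt0 ?powR_gt0 ?pi_gt0// subr_gt0.
Qed.

Section real_combinations.
Context {R : realType}.

Lemma combine_le_add (c x a b X A B p q : R) : 0 <= c -> x <= p * a + q * b ->
  X <= p * A + q * B -> X + c * x <= p * (A + c * a) + q * (B + c * b).
Proof. by move=> c0 h1 h2; have := ler_wpM2l c0 h1; lra. Qed.

Lemma combine_le_sub (c x a b X A B q : R) : 0 <= c -> x + q * b <= a ->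
  X <= A - q * B -> X + c * x <= (A + c * a) - q * (B + c * b).
Proof. by move=> c0 h1 h2; have := ler_wpM2l c0 h1; lra. Qed.

Lemma fine_le_combine (x a b : \bar R) (q : R) : x \is a fin_num -> a \is a fin_num ->
  b \is a fin_num -> (x + q%:E * b <= a)%E -> fine x + q * fine b <= fine a.
Proof. by move: x a b => [x| |] [a| |] [b| |]. Qed.

Lemma fine_le_combine2 (x a b : \bar R) (p q : R) : x \is a fin_num -> a \is a fin_num ->
  b \is a fin_num -> (x <= p%:E * a + q%:E * b)%E -> fine x <= p * fine a + q * fine b.
Proof. by move: x a b => [x| |] [a| |] [b| |]. Qed.
End real_combinations.

Section L2_truncation.
Context {R : realType} {disp : measure_display} {T : measurableType disp}.
Variables (mu : {measure set T -> \bar R}) (D : set T) (mD : measurable D).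

(** Rests on [(w, v) >= (v, v)]: where [v] is nonzero, [w = v + k] with [k >= 0]. *)
Lemma L2norm_truncation (w : T -> R) (k t : R) : 0 <= k -> 0 <= t -> L2 mu D w ->
  L2norm mu D (fun x => w x - t * pos_above k w x) ^+ 2 <=
    L2norm mu D w ^+ 2 - (2 * t - t ^+ 2) * L2norm mu D (pos_above k w) ^+ 2.
Proof.
move=> k0 t0 hw; set v := pos_above k w.
have hv : L2 mu D v by exact: L2_pos_above.
have key : ip mu D v v <= ip mu D w v.
  apply: le_Rintegral => //; first exact: L2_integrableM.
    exact: L2_integrableM.
  move=> x _; have [->|vx0] := eqVneq (v x) 0; first by rewrite !mulr0.
  rewrite ler_wpM2r ?pos_above_ge0//; move: vx0; rewrite /v /pos_above /= maxEle.
  by case: (leP (w x - k) 0) => h; rewrite ?eqxx// => _; lra.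
have htv := L2Z mD t hv; have hwt := L2B mD hw htv.
rewrite -(ip_norm mD hwt) ipBl// !ipBr// !ipZl// !ipZr// !ip_norm// (ipC _ _ v w).
move: key; rewrite ip_norm//; move: (ip _ _ _ _) => q key.
by have := ler_wpM2l t0 key; lra.
Qed.
End L2_truncation.

(** * Linear combinations and truncation for the squared [H^s] norm *)

Section Hs_algebra.
Context {R : realType} {d : nat}.
Notation leb := (lebesgue_rV d : {measure set 'rV[R]_d -> \bar R}).
Variables (D : set 'rV[R]_d) (s : R).
Hypotheses (mD : measurable D) (d_gt0 : (0 < d)%N) (s0 : 0 < s) (s1 : s < 1).
Implicit Types (u v w : 'rV[R]_d -> R).

Let fc := @frac_const R d s.
Let fc0 : 0 < fc. Proof. exact: frac_const_gt0. Qed.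

Definition hs2 u : R := Hs_inner D s u u.

Lemma hs2E u : L2 leb D u -> hs2 u = L2norm leb D u ^+ 2 + fc / 2 * fine (gagliardo D s u u).
Proof. by move=> hu; rewrite /hs2 /Hs_inner L2innerE ip_norm. Qed.

Lemma fine_gag_ge0 u : 0 <= fine (gagliardo D s u u).
Proof. by rewrite fine_ge0// gagliardo_ge0. Qed.

Lemma hs2_ge_L2 u : L2 leb D u -> L2norm leb D u ^+ 2 <= hs2 u.
Proof. by move=> hu; rewrite hs2E// lerDl mulr_ge0 ?fine_gag_ge0// divr_ge0// ltW. Qed.

Lemma hs2_ge_gag u : L2 leb D u -> fc / 2 * fine (gagliardo D s u u) <= hs2 u.
Proof. by move=> hu; rewrite hs2E// lerDr sqr_ge0. Qed.

Lemma hs2_ge0 u : L2 leb D u -> 0 <= hs2 u.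
Proof. by move=> hu; apply: le_trans (hs2_ge_L2 hu); exact: sqr_ge0. Qed.

Lemma fin_num_gagliardo u : (gagliardo D s u u < +oo)%E ->
  gagliardo D s u u \is a fin_num.
Proof. by move=> h; rewrite ge0_fin_numE; [exact: h|exact: gagliardo_ge0]. Qed.

Lemma gagliardo_lin (a b : R) u v : measurable_fun D u -> measurable_fun D v ->
  (gagliardo D s (fun x => a * u x + b * v x)%R (fun x => a * u x + b * v x)%R <=
   (2 * a ^+ 2)%:E * gagliardo D s u u + (2 * b ^+ 2)%:E * gagliardo D s v v)%E.
Proof.
move=> mu_ mv.
have mR (f : 'rV[R]_d -> R) : measurable_fun D f -> measurable_fun setT (f \_ D).
  by move=> m; exact: ((measurable_restrictT f mD).1 m).
have mc : measurable_fun D (fun x => a * u x + b * v x).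
  by apply: measurable_funD; exact: measurable_funM.
rewrite (gagliardo_restrict D s (fun x => a * u x + b * v x)) (gagliardo_restrict D s u).
rewrite (gagliardo_restrict D s v) !gagliardoE.
have k0 := @gkern_ge0 R d s; have mk := @measurable_gkern R d s.
have m1 := measurable_sqdiff (mR u mu_); have m2 := measurable_sqdiff (mR v mv).
have a0 : 0 <= 2 * a ^+ 2 by rewrite mulr_ge0// sqr_ge0.
have b0 : 0 <= 2 * b ^+ 2 by rewrite mulr_ge0// sqr_ge0.
rewrite -(kintZ mD mk k0 a0 m1 (sqdiff_ge0 _)) -(kintZ mD mk k0 b0 m2 (sqdiff_ge0 _)).
have m3 : measurable_fun setT (fun p => 2 * a ^+ 2 * sqdiff (u \_ D) p) by exact: measurable_funM.
have m4 : measurable_fun setT (fun p => 2 * b ^+ 2 * sqdiff (v \_ D) p) by exact: measurable_funM.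
have g3 p : 0 <= 2 * a ^+ 2 * sqdiff (u \_ D) p by rewrite mulr_ge0 ?sqdiff_ge0.
have g4 p : 0 <= 2 * b ^+ 2 * sqdiff (v \_ D) p by rewrite mulr_ge0 ?sqdiff_ge0.
rewrite -(kintD mD mk k0 m3 m4 g3 g4).
apply: (le_kint mD mk k0).
- exact: measurable_sqdiff (mR _ mc).
- exact: measurable_funD.
- exact: sqdiff_ge0.
- by move=> p; rewrite addr_ge0.
move=> x y Dx Dy; rewrite /sqdiff /patch !mem_set//=.
move: (u x) (u y) (v x) (v y) => p q p' q'.
rewrite -subr_ge0 (_ : _ - _ = (a * (p - q) - b * (p' - q')) ^+ 2) ?sqr_ge0//; ring.
Qed.

(** The inequality [(X + Y)^2 <= 2 X^2 + 2 Y^2] gives finiteness and the bound together, without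
    expanding a mixed seminorm. *)
Lemma Hs_mem_lin (a b : R) u v : Hs_mem D s u -> Hs_mem D s v ->
  Hs_mem D s (fun x => a * u x + b * v x) /\
  hs2 (fun x => a * u x + b * v x) <= 2 * a ^+ 2 * hs2 u + 2 * b ^+ 2 * hs2 v.
Proof.
move=> [hu gu] [hv gv].
have mu_ := L2_measurable mD hu; have mv := L2_measurable mD hv.
have hc := L2D mD (L2Z mD a hu) (L2Z mD b hv).
have hg := gagliardo_lin a b mu_ mv.
have a0 : 0 <= 2 * a ^+ 2 by rewrite mulr_ge0// sqr_ge0.
have b0 : 0 <= 2 * b ^+ 2 by rewrite mulr_ge0// sqr_ge0.
have fu := fin_num_gagliardo gu; have fv := fin_num_gagliardo gv.
have fg : (gagliardo D s (fun x => a * u x + b * v x)%R (fun x => a * u x + b * v x)%R < +oo)%E.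
  by apply: le_lt_trans hg _; rewrite -(fineK fu) -(fineK fv) -!EFinM -EFinD ltry.
split; first by split; [exact: hc|exact: fg].
rewrite (hs2E hu) (hs2E hv) (hs2E hc).
have h1 : fine (gagliardo D s (fun x => a * u x + b * v x) (fun x => a * u x + b * v x)) <=
   2 * a ^+ 2 * fine (gagliardo D s u u) + 2 * b ^+ 2 * fine (gagliardo D s v v).
  exact: fine_le_combine2 (fin_num_gagliardo fg) fu fv hg.
have h2 : L2norm leb D (fun x => a * u x + b * v x) ^+ 2 <=
   2 * a ^+ 2 * L2norm leb D u ^+ 2 + 2 * b ^+ 2 * L2norm leb D v ^+ 2.
  have hau := L2Z mD a hu; have hbv := L2Z mD b hv.
  have := L2normD mD hau hbv; rewrite !L2normZ// => h.
  apply: (@le_trans _ _ ((`|a| * L2norm leb D u + `|b| * L2norm leb D v) ^+ 2)).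
    by rewrite lerXn2r ?nnegrE ?addr_ge0 ?mulr_ge0 ?L2norm_ge0.
  rewrite -(real_normK (num_real a)) -(real_normK (num_real b)).
  move: `|a| `|b| (L2norm leb D u) (L2norm leb D v) => p q p' q'.
  rewrite -subr_ge0 (_ : _ - _ = (p * p' - q * q') ^+ 2) ?sqr_ge0//; ring.
have fc2 : 0 <= fc / 2 by rewrite divr_ge0// ltW.
exact: combine_le_add fc2 h1 h2.
Qed.

Lemma Hs_truncation w k t : 0 <= k -> 0 <= t -> t <= 1 -> Hs_mem D s w ->
  [/\ Hs_mem D s (pos_above k w), Hs_mem D s (fun x => w x - t * pos_above k w x) &
   hs2 (fun x => w x - t * pos_above k w x) <= hs2 w - (2 * t - t ^+ 2) * hs2 (pos_above k w)].
Proof.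
move=> k0 t0 t1 [hw gw]; set v := pos_above k w.
have hv : L2 leb D v by exact: L2_pos_above.
have mw := L2_measurable mD hw.
have gv : (gagliardo D s v v < +oo)%E.
  (* At [t = 1] the coefficient [2 t - t^2] is [1], so the inequality bounds the seminorm of [v] by
     that of [w]. *)
  have := @gagliardo_truncation R d D s mD w k 1 mw ler01 (ler1n _ 2).
  rewrite (_ : 2 * 1 - 1 ^+ 2 = 1 :> R) ?mul1e; last by ring.
  move=> h; apply: le_lt_trans gw; apply: le_trans h; rewrite leeDr// gagliardo_ge0//.
have Hv : Hs_mem D s v by split.
have t2 : t <= 2 by rewrite (le_trans t1)// ler1n.
have hg := @gagliardo_truncation R d D s mD w k t mw t0 t2; rewrite -/v in hg.
have tt0 : 0 <= 2 * t - t ^+ 2 by rewrite expr2 -mulrBl mulr_ge0// subr_ge0.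
have gwt : (gagliardo D s (fun x => w x - t * v x)%R (fun x => w x - t * v x)%R < +oo)%E.
  apply: le_lt_trans gw; apply: le_trans hg; rewrite leeDl// mule_ge0 ?lee_fin// gagliardo_ge0//.
have hwt : L2 leb D (fun x => w x - t * v x) by apply: L2B => //; exact: L2Z.
split; [exact: Hv|by split; [exact: hwt|exact: gwt]|].
rewrite (hs2E hw) (hs2E hv) (hs2E hwt).
have h1 : fine (gagliardo D s (fun x => w x - t * v x) (fun x => w x - t * v x)) +
    (2 * t - t ^+ 2) * fine (gagliardo D s v v) <= fine (gagliardo D s w w).
  exact: fine_le_combine (fin_num_gagliardo gwt) (fin_num_gagliardo gw) (fin_num_gagliardo gv) hg.
have h2 := L2norm_truncation mD k0 t0 hw; rewrite -/v in h2.
have fc2 : 0 <= fc / 2 by rewrite divr_ge0// ltW.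
exact: combine_le_sub fc2 h1 h2.
Qed.

Lemma hs2Z t u : Hs_mem D s u -> hs2 (fun x => t * u x) = t ^+ 2 * hs2 u.
Proof.
move=> [hu gu]; have htu := L2Z mD t hu; rewrite !hs2E// L2normZ// exprMn real_normK ?num_real//.
rewrite mulrDr; congr (_ + _); rewrite mulrCA; congr (_ * _).
have mu_ := L2_measurable mD hu.
have mR (f : 'rV[R]_d -> R) : measurable_fun D f -> measurable_fun setT (f \_ D).
  by move=> m; exact: ((measurable_restrictT f mD).1 m).
have E : (gagliardo D s (fun x => t * u x)%R (fun x => t * u x)%R =
    (t ^+ 2)%:E * gagliardo D s u u)%E.
  rewrite (gagliardo_restrict D s u) !gagliardoE.
  rewrite -(kintZ mD (@measurable_gkern R d s) (@gkern_ge0 R d s) (sqr_ge0 t)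
    (measurable_sqdiff (mR _ mu_)) (sqdiff_ge0 _)).
  apply: eq_kint => x y Dx Dy; rewrite /sqdiff /patch !mem_set//=; ring.
by rewrite E fineM//; exact: fin_num_gagliardo.
Qed.
End Hs_algebra.

(** * Truncation in the closure of the test functions *)

Section test_gagliardo.
Context {R : realType} {d : nat}.
Notation leb := (lebesgue_rV d : {measure set 'rV[R]_d -> \bar R}).
Variables (Om : set 'rV[R]_d) (s : R).
Hypotheses (d_gt0 : (0 < d)%N) (oOm : open Om) (bOm : bounded_set Om).
Hypotheses (s0 : 0 < s) (s1 : s < 1).
Implicit Types (phi u v w : 'rV[R]_d -> R).

Let mOm : measurable Om. Proof. exact: open_measurable_rV. Qed.

(** One passes from [x] to [y] along the coordinate axes and adds up the directional Lipschitz
    constants. *)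
Lemma test_lipschitz phi : test_function Om phi -> exists2 L, 0 <= L &
  forall (x y : 'rV[R]_d) (r : R), 0 <= r -> (forall i, `|y ord0 i - x ord0 i| <= r) ->
    `|phi y - phi x| <= L * r.
Proof.
move=> tphi.
have /choice[M hM] : forall i : 'I_d, exists M : R, 0 <= M /\
    forall (h : R) x, `|phi (x + h *: delta_mx ord0 i) - phi x| <= `|h| * M.
  move=> i; have [M [r H]] := test_compact_C1 i tphi.
  by exists M; split; [exact: cC1_M H|exact: cC1_lipschitz H].
exists (\sum_i M i) => [|x y r r0 hr]; first by apply: sumr_ge0 => i _; have [] := hM i.
have step n (a : 'I_n -> 'rV[R]_d) (b : 'I_n -> R) x' :
    (forall i x, `|phi (x + a i) - phi x| <= b i) ->
    `|phi (x' + \sum_i a i) - phi x'| <= \sum_i b i.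
  elim: n a b => [|n IH] a b hab; first by rewrite !big_ord0 addr0 subrr normr0.
  rewrite !big_ord_recr/= addrA.
  rewrite -(subrKA (phi (x' + \sum_(i < n) a (widen_ord (leqnSn n) i)))) [leRHS]addrC.
  apply: le_trans (ler_normD _ _) _; apply: lerD; first exact: hab.
  by apply: (IH _ (fun i => b (widen_ord (leqnSn n) i))) => i x''; exact: hab.
have -> : y = x + \sum_i (y ord0 i - x ord0 i) *: delta_mx ord0 i.
  apply/rowP => j; rewrite mxE summxE (bigD1 j)//= big1 ?addr0.
    by rewrite !mxE !eqxx mulr1 addrC subrK.
  by move=> i ij; rewrite !mxE eqxx [j == i]eq_sym (negbTE ij) mulr0.
rewrite mulr_suml.
apply: (step _ (fun i => (y ord0 i - x ord0 i) *: delta_mx ord0 i) (fun i => M i * r)).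
move=> i x'; have [M0 /(_ (y ord0 i - x ord0 i) x')] := hM i.
by move=> /le_trans; apply; rewrite mulrC ler_wpM2l.
Qed.

Let p : R := d%:R + 2 * s.

Let p0 : 0 < p. Proof. by rewrite /p ltr_wpDl// mulr_gt0. Qed.

Variables (rho L : R).
Hypotheses (rho0 : 0 < rho) (L0 : 0 <= L).

Let a (j : nat) : R := rho * 2^-1 ^+ j.

Let a_gt0 j : 0 < a j. Proof. by rewrite mulr_gt0// exprn_gt0// invr_gt0. Qed.

Let aS j : a j.+1 = a j / 2. Proof. by rewrite /a exprSr mulrA. Qed.

(* Bounds the difference quotients of an [L]-Lipschitz function on the dyadic shells of sizes
   [a j]; the integrals decay like [q ^+ j] since [d + 2 s < d + 2]. *)
Definition shell_coef (j : nat) : R := (L * a j) ^+ 2 * (a j.+1 `^ p)^-1.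

Definition shell_fun (z : 'rV[R]_d) : \bar R :=
  (\sum_(0 <= j <oo) (shell_coef j * \1_(cube 0 (a j)) z)%:E)%E.

Let shell_coef_ge0 j : 0 <= shell_coef j.
Proof. by rewrite mulr_ge0 ?sqr_ge0// invr_ge0 powR_ge0. Qed.

Let q : R := 2^-1 `^ (2 - 2 * s).

Let q_lt1 : q < 1.
Proof.
have -> : q = expR (- ((2 - 2 * s) * ln 2)).
  by rewrite /q /powR gt_eqF ?invr_gt0// lnV ?posrE// mulrN.
rewrite -[ltRHS]expR0 ltr_expR oppr_lt0 mulr_gt0// ?ln_gt0 ?ltr1n//.
by have := s1; lra.
Qed.

Let q0 : 0 <= q. Proof. exact: powR_ge0. Qed.

Let K : R := L ^+ 2 * 2 ^+ d * (2^-1 `^ p)^-1 * rho `^ (2 - 2 * s).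

(** A coefficient of order [a_j^(2 - p)] times a volume of order [a_j^d] gives [a_j^(2 - 2 s)], a
    geometric sequence. *)
Let shell_term j : shell_coef j * (2 * a j) ^+ d = K * q ^+ j.
Proof.
have apq : a j ^+ 2 * a j ^+ d = a j `^ p * a j `^ (2 - 2 * s).
  rewrite -powRD; last by rewrite (gt_eqF (a_gt0 j)) implybT.
  rewrite -exprD -powR_mulrn ?(ltW (a_gt0 j))//; congr (_ `^ _).
  by rewrite natrD /p; ring.
have ajq : a j `^ (2 - 2 * s) = rho `^ (2 - 2 * s) * q ^+ j.
  rewrite /a powRM ?(ltW rho0) ?exprn_ge0 ?invr_ge0//; congr (_ * _).
  by rewrite /q -[RHS]powR_mulrn ?powR_ge0// -[2^-1 ^+ j]powR_mulrn ?invr_ge0// powRAC.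
have p2 : (2^-1 : R) `^ p != 0 by rewrite gt_eqF// powR_gt0// invr_gt0.
have ap : a j `^ p != 0 by rewrite gt_eqF// powR_gt0.
rewrite /shell_coef aS powRM ?(ltW (a_gt0 j)) ?invr_ge0// invfM (exprMn _ L) (exprMn _ 2).
transitivity (L ^+ 2 * 2 ^+ d * (2^-1 `^ p)^-1 * ((a j ^+ 2 * a j ^+ d) * (a j `^ p)^-1)).
  move: (2 ^+ d) (a j ^+ d) ((a j `^ p)^-1) ((2^-1 `^ p)^-1) => A B C D; ring.
rewrite apq ajq /K [a j `^ p * _]mulrC mulfK//.
by move: (2 ^+ d) (q ^+ j) ((2^-1 `^ p)^-1) => A B C; ring.
Qed.

Definition shell_const : R := L ^+ 2 * 2 ^+ d * (2^-1 `^ p)^-1 / (1 - q).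

Lemma shell_const_ge0 : 0 <= shell_const.
Proof.
have q10 : 0 < 1 - q by rewrite subr_gt0.
by rewrite /shell_const !mulr_ge0 ?sqr_ge0 ?exprn_ge0 ?invr_ge0 ?powR_ge0// ltW.
Qed.

Lemma shell_integral_le :
  (\int[leb]_z shell_fun z <= (shell_const * rho `^ (2 - 2 * s))%:E)%E.
Proof.
have K0 : 0 <= K.
  by rewrite /K !mulr_ge0 ?sqr_ge0 ?exprn_ge0 ?invr_ge0 ?powR_ge0.
rewrite /shell_fun integral_nneseries; last 3 first.
- exact: measurableT.
- move=> j; apply/measurable_EFinP; apply: measurable_funM => //.
  by apply: measurable_indic; exact: measurable_cube.
- by move=> j z _; rewrite lee_fin mulr_ge0.
have E j : (\int[leb]_z (shell_coef j * \1_(cube 0 (a j)) z)%:E = (K * q ^+ j)%:E)%E.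
  under eq_integral do rewrite EFinM.
  rewrite integral_Zindic//; last exact: measurable_cube.
  have r0 : 0 <= a j by exact: ltW.
  by rewrite [leb _](lebesgue_cube 0 r0) -EFinM shell_term.
rewrite (eq_eseriesr (fun j _ => E j)).
rewrite (_ : shell_const * _ = K / (1 - q)); last by rewrite /shell_const /K mulrAC.
apply: lime_le; first by apply: is_cvg_nneseries => j _ _; rewrite lee_fin mulr_ge0 ?exprn_ge0.
apply: nearW => n; rewrite sumEFin lee_fin big_mkord -mulr_sumr ler_wpM2l//.
have q10 : 0 < 1 - q by rewrite subr_gt0.
rewrite -[leRHS]mul1r ler_pdivlMr//.
have -> : (\sum_(i < n) q ^+ i) * (1 - q) = 1 - q ^+ n.
  by rewrite -[RHS]opprB subrX1 -mulNr opprB mulrC.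
by rewrite gerBl exprn_ge0.
Qed.

Lemma measurable_shell_fun : measurable_fun setT shell_fun.
Proof.
apply: ge0_emeasurable_sum => [j z _ _|j _]; first by rewrite lee_fin mulr_ge0.
apply/measurable_EFinP; apply: measurable_funM => //.
by apply: measurable_indic; exact: measurable_cube.
Qed.

Lemma shell_fun_ge0 z : (0 <= shell_fun z)%E.
Proof. by apply: nneseries_ge0 => j _ _; rewrite lee_fin mulr_ge0. Qed.

(** Here [c] stands for [|phi y - phi x|] with [z = y - x]. On the shell that contains [z] one has
    [c <= L a_j] and [|z| >= a_(j+1)], so a single term of the series dominates. *)
Lemma shell_bound (z : 'rV[R]_d) (c : R) : cube 0 rho z -> 0 <= c ->
  (forall r : R, 0 <= r -> (forall i, `|z ord0 i| <= r) -> c <= L * r) ->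
  ((c ^+ 2 / enorm z `^ p)%:E <= shell_fun z)%E.
Proof.
move=> hz c0 hc.
have [z0|zn0] := eqVneq z 0.
  have -> : c = 0.
    apply/eqP; rewrite eq_le c0 andbT -(mulr0 L); apply: hc => // i.
    by rewrite z0 mxE normr0.
  by rewrite expr0n mul0r; exact: shell_fun_ge0.
have [i zi0] : exists i, z ord0 i != 0.
  apply: contrapT => h; move/negP: zn0; apply; apply/eqP/rowP => i; rewrite mxE.
  by apply/eqP/negPn/negP => zi; apply: h; exists i.
have acvg : a @ \oo --> (0 : R).
  rewrite -(mulr0 rho); apply: cvgM; first exact: cvg_cst.
  by apply: cvg_expr; rewrite ger0_norm ?invr_ge0// invf_lt1// ltr1n.
have exj : exists j, ~~ `[< cube 0 (a j.+1) z >].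
  have zi : 0 < `|z ord0 i| by rewrite normr_gt0.
  have /cvgrPdist_lt/(_ _ zi)[n _ /(_ n.+1 (leqnSn n))] := acvg.
  rewrite sub0r normrN gtr0_norm// => hn; exists n; apply/asboolP => /(_ i).
  by rewrite mxE subr0 => /(lt_trans hn); rewrite ltxx.
pose j := ex_minn exj.
have [nj minj] : ~ cube 0 (a j.+1) z /\ cube 0 (a j) z.
  rewrite /j; case: ex_minnP => m /asboolPn nm hmin; split => //.
  case: m nm hmin => [|m] nm hmin; first by rewrite /a expr0 mulr1.
  apply: contrapT => nc; have := hmin m; rewrite ltnn => H.
  suff : false by []; by apply: H; apply/asboolPn.
apply: (@le_trans _ _ ((shell_coef j * \1_(cube 0 (a j)) z)%:E)); last first.
  rewrite /shell_fun (@nneseriesD1 _ _ j xpredT)//; last first.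
    by move=> m _; rewrite lee_fin mulr_ge0.
  by apply: leeDl; apply: nneseries_ge0 => m _ _; rewrite lee_fin mulr_ge0.
rewrite lee_fin indicE mem_set// mulr1 /shell_coef.
have [k ka] : exists k, a j.+1 <= `|z ord0 k|.
  apply: contrapT => h; apply: nj => k; rewrite mxE subr0 ltNge; apply/negP => hk.
  by apply: h; exists k.
have ez : a j.+1 <= enorm z by apply: le_trans ka (coord_le_enorm _ _).
have ez0 : 0 < enorm z by exact: lt_le_trans ez.
apply: ler_pM; rewrite ?sqr_ge0 ?invr_ge0 ?powR_ge0//.
  rewrite lerXn2r ?nnegrE ?mulr_ge0 ?(ltW (a_gt0 j)) ?(ltW rho0)//; apply: hc; first exact: ltW.
  by move=> m; have := minj m; rewrite mxE subr0 => /ltW.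
have A1 : 0 < enorm z `^ p by rewrite powR_gt0.
have A2 : 0 < a j.+1 `^ p by rewrite powR_gt0.
by rewrite (lef_pV2 A1 A2) (ge0_ler_powR (ltW p0)) ?nnegrE// ltW.
Qed.

End test_gagliardo.

(** * Pairs of points near the diagonal *)

Section near_diagonal.
Context {R : realType} {d : nat}.
Notation leb := (lebesgue_rV d : {measure set 'rV[R]_d -> \bar R}).
Variables (Om : set 'rV[R]_d) (s : R).
Hypotheses (d_gt0 : (0 < d)%N) (oOm : open Om) (bOm : bounded_set Om).
Hypotheses (s0 : 0 < s) (s1 : s < 1).

Let mOm : measurable Om. Proof. exact: open_measurable_rV. Qed.

Definition near_diag (r : R) (p : 'rV[R]_d * 'rV[R]_d) : R := \1_(cube 0 r) (p.2 - p.1).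

Lemma near_diag_ge0 r p : 0 <= near_diag r p. Proof. by rewrite /near_diag indicE. Qed.

Lemma measurable_near_diag r : measurable_fun setT (near_diag r).
Proof.
have m1 : measurable_fun setT (\1_(cube 0 r) : 'rV[R]_d -> R).
  by apply: measurable_indic; exact: measurable_cube.
exact: (measurableT_comp m1 (measurableT_comp (@measurable_subrV R d) (@measurable_swap _ _ _ _))).
Qed.

(** After a shift by [x] the inner integral is dominated by that of [shell_fun], which does not
    depend on [x]; the positive power [2 - 2 s] of [r] makes it small near the diagonal. *)
Lemma near_diag_integral (phi : 'rV[R]_d -> R) (L r : R) :
  measurable_fun setT phi -> 0 < r -> 0 <= L ->
  (forall (x y : 'rV[R]_d) (t : R), 0 <= t -> (forall i, `|y ord0 i - x ord0 i| <= t) ->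
    `|phi y - phi x| <= L * t) ->
  (kint Om (gkern s) (fun p => sqdiff phi p * near_diag r p)%R <=
   (shell_const (d := d) s L * r `^ (2 - 2 * s))%:E * leb Om)%E.
Proof.
move=> mphi r0 L0 hL.
have G0 z := @shell_fun_ge0 R d s r L z.
have mG := @measurable_shell_fun R d s r L.
have IG := @shell_integral_le R d s s1 r L r0 L0.
have mF : measurable_fun setT (fun p => sqdiff phi p * near_diag r p).
  by apply: measurable_funM; [exact: measurable_sqdiff|exact: measurable_near_diag].
have F0 p : 0 <= sqdiff phi p * near_diag r p by rewrite mulr_ge0 ?sqdiff_ge0 ?near_diag_ge0.
have k0 := @gkern_ge0 R d s; have mk := @measurable_gkern R d s.
rewrite -integral_cst; last exact: mOm.
apply: ge0_le_integral; first exact: mOm.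
- by move=> x _; apply: integral_ge0 => y _; rewrite lee_fin mulr_ge0.
- exact: (measurable_kint_inner mOm mk k0 mF F0).
- exact: measurable_cst.
move=> x _.
rewrite [cst _ _]/cst; apply: le_trans IG; rewrite -(ge0_integral_shift (- x)); first last.
- exact: G0.
- exact: mG.
have mGx : measurable_fun setT (fun y : 'rV[R]_d => shell_fun (d := d) s r L (y + - x)%R).
  exact: (measurableT_comp mG (measurable_shift _)).
apply: (@le_trans _ _ (\int[leb]_(y in Om) shell_fun (d := d) s r L (y + - x)%R)%E); last first.
  by apply: ge0_subset_integral => // y _; exact: G0.
apply: ge0_le_integral; first exact: mOm.
- by move=> y _; rewrite lee_fin mulr_ge0.
- by apply: (measurable_kint_section mk x mF).
- exact: measurable_funTS.
move=> y _; rewrite /near_diag /sqdiff /= indicE.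
have [/set_mem h|_] := boolP (y - x \in _); last by rewrite mulr0 mul0r; exact: G0.
rewrite mulr1 /gkern /=.
have -> : enorm (x - y) = enorm (y - x).
  by rewrite /enorm; congr Num.sqrt; apply: eq_bigr => i _; rewrite !mxE -opprB sqrrN.
have -> : (phi x - phi y) ^+ 2 = `|phi y - phi x| ^+ 2.
  by rewrite real_normK ?num_real// -opprB sqrrN.
apply: shell_bound => //.
by move=> t t0 ht; apply: hL => // i; have := ht i; rewrite !mxE.
Qed.

(* Rules out the junk value [fine +oo = 0] in [Hs_inner]. *)
Lemma test_gagliardo_lty phi : test_function Om phi -> (gagliardo Om s phi phi < +oo)%E.
Proof.
move=> tphi; have [L L0 hL] := test_lipschitz tphi.
have [M [Mr hM]] := bOm.
(* Exceeds the diameter of [Om] in the sup norm, so that [near_diag rho] is [1] on all pairs of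
   points of [Om]. *)
pose rho := 2 * (`|M| + 1) + 1.
have M0 : 0 <= `|M| by exact: normr_ge0.
have rho0 : 0 < rho by rewrite /rho; lra.
have hrho x y : Om x -> Om y -> cube 0 rho (y - x).
  move=> Ox Oy i; rewrite !mxE subr0; apply: le_lt_trans (ler_normB _ _) _.
  have hb z : Om z -> `|z ord0 i| <= `|M| + 1.
    move=> Oz; apply: le_trans (normr_coord_le _ _) _; apply: hM => //.
    by rewrite (le_lt_trans (ler_norm _))// ltrDl.
  by have := hb x Ox; have := hb y Oy; rewrite /rho; lra.
have mphi : measurable_fun setT phi.
  by apply: continuous_measurable_rV; apply: smooth_continuous; case: tphi.
rewrite gagliardoE (_ : kint _ _ _ = kint Om (gkern s) (fun p => sqdiff phi p * near_diag rho p)).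
  apply: le_lt_trans (near_diag_integral mphi rho0 L0 hL) _.
  by apply: lte_mul_pinfty => //; [rewrite lee_fin mulr_ge0 ?powR_ge0 ?shell_const_ge0|
    exact: bounded_lebesgue_rV].
apply: eq_kint => x y Ox Oy; rewrite /near_diag indicE mem_set ?mulr1//.
exact: hrho.
Qed.

Lemma near_diag_small (phi : 'rV[R]_d -> R) (e : R) : test_function Om phi -> 0 < e ->
  exists2 r, 0 < r & (kint Om (gkern s) (fun p => sqdiff phi p * near_diag r p)%R <= e%:E)%E.
Proof.
move=> tphi e0; have [L L0 hL] := test_lipschitz tphi.
have mphi : measurable_fun setT phi.
  by apply: continuous_measurable_rV; apply: smooth_continuous; case: tphi.
have lOm : leb Om \is a fin_num by rewrite ge0_fin_numE; [exact: bounded_lebesgue_rV|].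
have l0 : 0 <= fine (leb Om) by rewrite fine_ge0.
have c0 : 0 <= shell_const (d := d) s L by exact: shell_const_ge0.
have ts : 0 < 2 - 2 * s by have := s1; lra.
pose N := shell_const (d := d) s L * fine (leb Om) + 1.
have N0 : 0 < N by rewrite ltr_wpDl// mulr_ge0.
exists ((e / N) `^ (2 - 2 * s)^-1); first by rewrite powR_gt0 ?divr_gt0.
apply: le_trans (near_diag_integral mphi _ L0 hL) _; first by rewrite powR_gt0 ?divr_gt0.
rewrite -(fineK lOm) -EFinM lee_fin -powRrM mulVf ?gt_eqF// powRr1; last by rewrite divr_ge0// ltW.
rewrite mulrAC mulrA ler_pdivrMr// mulrC ler_wpM2l ?ltW//.
by rewrite /N ltrDl.
Qed.
End near_diagonal.

(** * Approximation of truncated functions by truncated test functions *)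

Section closure_truncation.
Context {R : realType} {d : nat}.
Notation leb := (lebesgue_rV d : {measure set 'rV[R]_d -> \bar R}).
Variables (Om : set 'rV[R]_d) (s : R).
Hypotheses (d_gt0 : (0 < d)%N) (oOm : open Om) (bOm : bounded_set Om).
Hypotheses (s0 : 0 < s) (s1 : s < 1).
Implicit Types (phi u v w z : 'rV[R]_d -> R) (k e r : R).

Let mOm : measurable Om. Proof. exact: open_measurable_rV. Qed.

Let p : R := d%:R + 2 * s.

Let p0 : 0 < p. Proof. by rewrite /p ltr_wpDl// mulr_gt0. Qed.

(* Its product with the kernel is [2 r^-p (z x^2 + z y^2)] off the diagonal. *)
Definition far_diag r z (q : 'rV[R]_d * 'rV[R]_d) : R :=
  2 * (r `^ p)^-1 * (z q.1 ^+ 2 + z q.2 ^+ 2) * enorm (q.1 - q.2) `^ p.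

Lemma far_diag_ge0 r z q : 0 <= far_diag r z q.
Proof.
by rewrite /far_diag !mulr_ge0 ?powR_ge0 ?invr_ge0 ?powR_ge0// addr_ge0 ?sqr_ge0.
Qed.

Lemma measurable_far_diag r z : measurable_fun setT z -> measurable_fun setT (far_diag r z).
Proof.
move=> mz; apply: measurable_funM.
  apply: measurable_funM; first exact: measurable_cst.
  apply: measurable_funD; apply: measurable_funX.
    exact: (measurableT_comp mz measurable_fst).
  exact: (measurableT_comp mz measurable_snd).
apply: (measurableT_comp (measurable_powR p)).
exact: (measurableT_comp (@measurable_enorm R d) (@measurable_subrV R d)).
Qed.

Lemma far_diag_integral r z : 0 < r -> measurable_fun setT z ->
  (kint Om (gkern s) (far_diag r z) <=
   (4 * (r `^ p)^-1)%:E * (leb Om * sqint leb Om z))%E.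
Proof.
move=> r0 mz; have k0 := @gkern_ge0 R d s; have mk := @measurable_gkern R d s.
have F0 := far_diag_ge0 r z; have mF := measurable_far_diag r mz.
have c0 : 0 <= 2 * (r `^ p)^-1 by rewrite mulr_ge0 ?invr_ge0 ?powR_ge0.
have z2 x : (0 <= (z x ^+ 2)%:E)%E by rewrite lee_fin sqr_ge0.
have mz2 : measurable_fun Om (fun x => (z x ^+ 2)%:E).
  by apply: measurable_sqr; exact: measurable_funTS.
have I0 := sqint_ge0 leb Om z.
apply: (@le_trans _ _ (\int[leb]_(x in Om)
    ((2 * (r `^ p)^-1)%:E * ((z x ^+ 2)%:E * leb Om + sqint leb Om z)))%E).
  apply: ge0_le_integral; first exact: mOm.
  - by move=> x _; apply: integral_ge0 => y _; rewrite lee_fin mulr_ge0.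
  - exact: (measurable_kint_inner mOm mk k0 mF F0).
  - apply: measurable_funeM; apply: emeasurable_funD; last exact: measurable_cst.
    by under eq_fun do rewrite muleC; exact: measurable_funeM.
  move=> x _.
  apply: (@le_trans _ _ (\int[leb]_(y in Om)
      ((2 * (r `^ p)^-1)%:E * ((z x ^+ 2)%:E + (z y ^+ 2)%:E)))%E).
    apply: ge0_le_integral; first exact: mOm.
    - by move=> y _; rewrite lee_fin mulr_ge0.
    - exact: (measurable_kint_section mk x mF).
    - by apply: measurable_funeM; apply: emeasurable_funD.
    move=> y _; rewrite -EFinD -EFinM lee_fin /far_diag /gkern /= -[leLHS]mulrA ler_piMr//.
      by rewrite mulr_ge0 ?addr_ge0 ?sqr_ge0.
    have := powR_ge0 (enorm (x - y)) p; rewrite -/p le0r => /predU1P[->|h].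
      by rewrite mul0r.
    by rewrite divff ?gt_eqF.
  rewrite ge0_integralZl_EFin//; first last.
  - exact: emeasurable_funD.
  - by move=> y _; rewrite adde_ge0.
  rewrite ge0_integralD// integral_cst//.
rewrite ge0_integralZl_EFin//; first last.
- apply: emeasurable_funD => //.
  by under eq_fun do rewrite muleC; exact: measurable_funeM.
- by move=> x _; rewrite adde_ge0// mule_ge0.
rewrite ge0_integralD//; first last.
- by under eq_fun do rewrite muleC; exact: measurable_funeM.
- by move=> x _; rewrite mule_ge0.
rewrite integral_cst// ge0_integralZr// -/(sqint leb Om z) (muleC (leb Om)).
rewrite (_ : 4 * (r `^ p)^-1 = 2 * (r `^ p)^-1 + 2 * (r `^ p)^-1); last by ring.
have X0 : (0 <= sqint leb Om z * leb Om)%E by rewrite mule_ge0.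
move: (sqint leb Om z * leb Om)%E X0 => X X0.
rewrite (ge0_muleDr _ X0 X0) EFinD ge0_muleDl ?lee_fin//; exact: lexx.
Qed.

(** Near the diagonal the first bound on [F] is used; away from it [|x - y| >= r] makes the last
    summand at least [2 (z1 + z2)]. *)
Lemma near_far_split r (x y : 'rV[R]_d) (F w1 w0 f0 z1 z2 : R) : 0 < r ->
  F <= 4 * w1 + 12 * w0 + 12 * f0 -> F <= 2 * (z1 + z2) ->
  0 <= w1 -> 0 <= w0 -> 0 <= f0 -> 0 <= z1 + z2 ->
  F <= 4 * w1 + 12 * w0 + 12 * (f0 * near_diag r (x, y)) +
    2 * (r `^ p)^-1 * (z1 + z2) * enorm (x - y) `^ p.
Proof.
move=> r0 h1 h2 w10 w00 f00 zz; rewrite /near_diag indicE /=.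
have rp : 0 < r `^ p by rewrite powR_gt0.
have e0 := powR_ge0 (enorm (x - y)) p.
have [/set_mem _|/negP nc] := boolP (y - x \in _).
  rewrite mulr1; apply: le_trans h1 _; rewrite lerDl.
  by rewrite !mulr_ge0// invr_ge0 ltW.
rewrite mulr0 mulr0 addr0; apply: le_trans h2 _.
apply: (@le_trans _ _ (2 * (r `^ p)^-1 * (z1 + z2) * enorm (x - y) `^ p)); last first.
  by rewrite lerDr addr_ge0// mulr_ge0.
have [i hi] : exists i, r <= `|(x - y) ord0 i|.
  apply: contrapT => h; apply: nc; apply/mem_set => i; rewrite !mxE subr0 ltNge.
  by apply/negP => hi; apply: h; exists i; rewrite !mxE distrC.
have re : r `^ p <= enorm (x - y) `^ p.
  apply: (ge0_ler_powR (ltW p0)); rewrite ?nnegrE ?(ltW r0) ?enorm_ge0//.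
  exact: le_trans hi (coord_le_enorm _ _).
rewrite (_ : _ * enorm _ `^ p = 2 * (z1 + z2) * ((r `^ p)^-1 * enorm (x - y) `^ p)).
  by rewrite ler_peMr ?mulr_ge0// mulrC ler_pdivlMr// mul1r.
by move: (enorm _ `^ p) ((r `^ p)^-1) => a b; ring.
Qed.

(** [V] and [Z] are differences at two points of the truncations of [w] and [phi]; [W], [P], [P0]
    are those of [w], [phi], [phi0]. As [|V - Z|] is not bounded by [|W - P|], both truncated
    differences are bounded by the untruncated ones, which are close to [P0]. The constants come
    from three uses of [(x + y)^2 <= 2 x^2 + 2 y^2]. *)
Lemma near_estimate (V Z W P P0 : R) : `|V| <= `|W| -> `|Z| <= `|P| ->
  (V - Z) ^+ 2 <= 4 * (W - P) ^+ 2 + 12 * (W - P0) ^+ 2 + 12 * P0 ^+ 2.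
Proof.
have sq (a b : R) : `|a| <= `|b| -> a ^+ 2 <= b ^+ 2.
  by move=> h; rewrite -(real_normK (num_real a)) -(real_normK (num_real b)) lerXn2r ?nnegrE.
move=> /sq VW /sq ZP.
have h1 : (V - Z) ^+ 2 <= 2 * V ^+ 2 + 2 * Z ^+ 2.
  by rewrite -subr_ge0 (_ : _ - _ = (V + Z) ^+ 2) ?sqr_ge0//; ring.
have h2 : P ^+ 2 <= 2 * W ^+ 2 + 2 * (W - P) ^+ 2.
  by rewrite -subr_ge0 (_ : _ - _ = (P - 2 * W) ^+ 2) ?sqr_ge0//; ring.
have h3 : W ^+ 2 <= 2 * (W - P0) ^+ 2 + 2 * P0 ^+ 2.
  by rewrite -subr_ge0 (_ : _ - _ = (W - 2 * P0) ^+ 2) ?sqr_ge0//; ring.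
lra.
Qed.

(** The [29] is [4 + 12 + 12 + 1]: the weights of the three seminorm errors, and one share for the
    [L^2] terms. *)
Lemma closure_arith (c e tau b l Z : R) (G G1 G0 K : \bar R) :
  0 < c -> 0 <= b * l -> 0 <= Z -> Z <= tau -> tau ^+ 2 * (c * (b * l) + 1) = e / 29 ->
  G \is a fin_num -> G1 \is a fin_num -> G0 \is a fin_num -> K \is a fin_num ->
  (G <= 4%:E * G1 + 12%:E * G0 + 12%:E * K + b%:E * (l%:E * (Z ^+ 2)%:E))%E ->
  c * fine G1 <= e / 29 -> c * fine G0 <= e / 29 -> (K <= (e / 29 / c)%:E)%E ->
  Z ^+ 2 + c * fine G <= e.
Proof.
move: G G1 G0 K => [G| |] [G1| |] [G0| |] [K| |]// c0 B0 Z0 Zt te _ _ _ _.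
rewrite -!EFinM -!EFinD !lee_fin /= mulrA => hG h1 h0; rewrite ler_pdivlMr// => hK.
have Z2 : Z ^+ 2 * (c * (b * l) + 1) <= e / 29.
  rewrite -te ler_wpM2r ?addr_ge0//; first by rewrite mulr_ge0// ltW.
  by rewrite lerXn2r ?nnegrE//; exact: le_trans Zt.
have := ler_wpM2l (ltW c0) hG; lra.
Qed.

Lemma gagliardo_smooth_pos k e r w phi phi0 : 0 < e -> 0 < r ->
  measurable_fun setT w -> measurable_fun setT phi -> measurable_fun setT phi0 ->
  let z x := pos_above k w x - smooth_pos e k (phi x) in
  (gagliardo Om s z z <=
   4%:E * gagliardo Om s (w \- phi)%R (w \- phi)%R +
   12%:E * gagliardo Om s (w \- phi0)%R (w \- phi0)%R +
   12%:E * kint Om (gkern s) (fun q => sqdiff phi0 q * near_diag r q)%R +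
   (4 * (r `^ p)^-1)%:E * (leb Om * sqint leb Om z))%E : Prop.
Proof.
move=> e0 r0 mw mphi mphi0 z.
set w1 := w \- phi; set w0 := w \- phi0.
have k0 := @gkern_ge0 R d s; have mk := @measurable_gkern R d s.
have mz : measurable_fun setT z.
  apply: measurable_funB; first exact: measurable_pos_above.
  apply: (measurableT_comp (f := smooth_pos e k)) => //.
  by apply: continuous_measurable_fun; exact: continuous_smooth_pos.
have mw1 : measurable_fun setT w1 by exact: measurable_funB.
have mw0 : measurable_fun setT w0 by exact: measurable_funB.
have c4 : 0 <= 4 :> R by []. have c12 : 0 <= 12 :> R by [].
have mF4 := measurable_far_diag r mz; have F40 := far_diag_ge0 r z.
pose F1 q := 4 * sqdiff w1 q; pose F2 q := 12 * sqdiff w0 q.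
pose F3 q := 12 * (sqdiff phi0 q * near_diag r q).
have g3 q : 0 <= sqdiff phi0 q * near_diag r q by rewrite mulr_ge0 ?sqdiff_ge0 ?near_diag_ge0.
have m3 : measurable_fun setT (fun q => sqdiff phi0 q * near_diag r q).
  by apply: measurable_funM; [exact: measurable_sqdiff|exact: measurable_near_diag].
have F10 q : 0 <= F1 q by rewrite mulr_ge0 ?sqdiff_ge0.
have F20 q : 0 <= F2 q by rewrite mulr_ge0 ?sqdiff_ge0.
have F30 q : 0 <= F3 q by rewrite mulr_ge0.
have mF1 : measurable_fun setT F1.
  by apply: measurable_funM; [exact: measurable_cst|exact: measurable_sqdiff].
have mF2 : measurable_fun setT F2.
  by apply: measurable_funM; [exact: measurable_cst|exact: measurable_sqdiff].
have mF3 : measurable_fun setT F3.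
  by apply: measurable_funM; [exact: measurable_cst|exact: m3].
have F120 q : 0 <= F1 q + F2 q by rewrite addr_ge0.
have mF12 : measurable_fun setT (fun q => F1 q + F2 q) by exact: measurable_funD.
have F1230 q : 0 <= F1 q + F2 q + F3 q by rewrite addr_ge0.
have mF123 : measurable_fun setT (fun q => F1 q + F2 q + F3 q) by exact: measurable_funD.
have I4 := far_diag_integral r0 mz.
apply: le_trans (leeD2l _ I4).
rewrite !gagliardoE -(kintZ mOm mk k0 c4 (measurable_sqdiff mw1) (sqdiff_ge0 _)).
rewrite -(kintZ mOm mk k0 c12 (measurable_sqdiff mw0) (sqdiff_ge0 _)).
rewrite -(kintZ mOm mk k0 c12 m3 g3).
rewrite -(kintD mOm mk k0 mF1 mF2 F10 F20) -(kintD mOm mk k0 mF12 mF3 F120 F30).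
rewrite -(kintD mOm mk k0 mF123 mF4 F1230 F40).
apply: (le_kint mOm mk k0).
- exact: measurable_sqdiff.
- exact: measurable_funD.
- exact: sqdiff_ge0.
- by move=> q; rewrite addr_ge0.
move=> x y _ _; apply: near_far_split => //=.
- rewrite /sqdiff /z /w1 /w0 /=.
  have E (a b c c' : R) : a - b - (c - c') = (a - c) - (b - c') by ring.
  rewrite (E (pos_above k w x)) (E (w x) (phi x)) (E (w x) (phi0 x));
  apply: near_estimate; first exact: pos_above_lip.
  exact: smooth_pos_lipschitz.
- rewrite /sqdiff /=; move: (z x) (z y) => a b.
  by rewrite -subr_ge0 (_ : _ - _ = (a + b) ^+ 2) ?sqr_ge0//; ring.
- exact: sqdiff_ge0.
- exact: sqdiff_ge0.
- exact: sqdiff_ge0.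
- by rewrite addr_ge0 ?sqr_ge0.
Qed.

Let Hs0 := W_mem s (Hs0Om Om).

Lemma Hs0_approx w : Hs0 w <-> Hs_mem Om s w /\ forall e, 0 < e ->
  exists2 phi, test_function Om phi & hs2 Om s (w \- phi) <= e.
Proof.
split=> [[hw happ]|[hw happ]]; split => // e e0.
  have se : 0 < Num.sqrt e by rewrite sqrtr_gt0.
  have [phi tphi h] := happ _ se; exists phi => //.
  by move: h; rewrite ler_sqrt ?(ltW e0).
have [phi tphi h] := happ _ (exprn_gt0 2 e0); exists phi => //.
by apply: le_trans (ler_wsqrtr h) _; rewrite sqrtr_sqr gtr0_norm.
Qed.

Let test_Hs phi : test_function Om phi -> Hs_mem Om s phi.
Proof. by move=> t; split; [exact: test_L2|exact: test_gagliardo_lty]. Qed.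

Let Hs_memB u v : Hs_mem Om s u -> Hs_mem Om s v -> Hs_mem Om s (u \- v).
Proof.
move=> hu hv; rewrite (_ : u \- v = fun x => 1 * u x + -1 * v x); last first.
  by apply/funext => x /=; ring.
by have [] := Hs_mem_lin mOm s0 s1 1 (-1) hu hv.
Qed.

Lemma Hs0_lin (a b : R) u v : Hs0 u -> Hs0 v -> Hs0 (fun x => a * u x + b * v x).
Proof.
move=> /Hs0_approx[hu uapp] /Hs0_approx[hv vapp]; apply/Hs0_approx; split.
  by have [] := Hs_mem_lin mOm s0 s1 a b hu hv.
move=> e e0; pose N := 2 * a ^+ 2 + 2 * b ^+ 2 + 1.
have N0 : 0 < N by rewrite /N ltr_wpDl// addr_ge0// mulr_ge0// sqr_ge0.
have eN : 0 < e / N by rewrite divr_gt0.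
have [phi tphi hphi] := uapp _ eN; have [psi tpsi hpsi] := vapp _ eN.
exists (fun x => a * phi x + b * psi x); first exact: test_function_lin.
have [_] := Hs_mem_lin mOm s0 s1 a b (Hs_memB hu (test_Hs tphi)) (Hs_memB hv (test_Hs tpsi)).
have -> : (fun x => a * u x + b * v x) \- (fun x => a * phi x + b * psi x) =
    (fun x => a * (u \- phi) x + b * (v \- psi) x).
  by apply/funext => x /=; ring.
move=> /le_trans; apply.
apply: (@le_trans _ _ (2 * a ^+ 2 * (e / N) + 2 * b ^+ 2 * (e / N))).
  have ab c : 0 <= 2 * c ^+ 2 :> R by rewrite mulr_ge0// sqr_ge0.
  by apply: lerD; [exact: ler_wpM2l (ab a) _ _ hphi|exact: ler_wpM2l (ab b) _ _ hpsi].
rewrite -mulrDl mulrCA ler_piMr ?(ltW e0)// ler_pdivrMr// mul1r /N lerDl//.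
Qed.

Lemma eq_gagliardo u v : (forall x, Om x -> u x = v x) ->
  gagliardo Om s u u = gagliardo Om s v v.
Proof.
move=> uv; apply: eq_integral => x /set_mem/uv ->.
by apply: eq_integral => y /set_mem/uv ->.
Qed.

(** Closeness of [phi] to [w] in the seminorm does not directly pass to their truncations. Near the
    diagonal these oscillate no more than [w] and [phi], which are close to [phi0]; elsewhere the
    kernel is bounded and the [L^2] distance suffices. *)
Lemma Hs0_pos_above k w : 0 <= k -> Hs0 w -> Hs0 (pos_above k w).
Proof.
move=> k0 /Hs0_approx[hw happ]; apply/Hs0_approx.
have hwL2 : L2 leb Om w by case: hw.
have hv : Hs_mem Om s (pos_above k w).
  by have [] := Hs_truncation mOm s0 s1 k0 (lexx 0) ler01 hw.
split=> [|e e0]; first exact: hv.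
pose c := @frac_const R d s / 2.
have c0 : 0 < c by rewrite divr_gt0// frac_const_gt0.
pose eta := e / 29.
have eta0 : 0 < eta by rewrite divr_gt0.
(* [phi0] fixes the distance [r] to the diagonal; only then is [phi] chosen close to [w]. *)
have [phi0 tphi0 h0] := happ _ eta0.
have [r r0 hr] := near_diag_small oOm bOm s0 s1 tphi0 (divr_gt0 eta0 c0).
have lOm : leb Om \is a fin_num by rewrite ge0_fin_numE; [exact: bounded_lebesgue_rV|].
pose l := fine (leb Om).
have l0 : 0 <= l by rewrite fine_ge0.
pose A := c * (4 * (r `^ p)^-1 * l) + 1.
have A1 : 0 < A.
  rewrite ltr_wpDl//; apply: mulr_ge0; first exact: ltW.
  by apply: mulr_ge0 => //; apply: mulr_ge0 => //; rewrite invr_ge0 powR_ge0.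
(* Absorbs the factor that the kernel away from the diagonal puts in front of the squared [L^2]
   distance. *)
pose tau := Num.sqrt (eta / A).
have tau0 : 0 < tau by rewrite sqrtr_gt0 divr_gt0.
have tauE : tau ^+ 2 * A = eta.
  by rewrite sqr_sqrtr ?divr_ge0 ?ltW// divfK// gt_eqF.
have h1 : L2 leb Om (fun=> 1).
  apply/(L2P _ mOm); split; first exact: measurable_cst.
  rewrite /sqint expr1n integral_cst// mul1e.
  exact: bounded_lebesgue_rV.
pose m := L2norm leb Om (fun=> 1).
have m0 : 0 <= m := L2norm_ge0 _ _ _.
(* Half of [tau] is reserved for smoothing, the other half for the distance from [phi] to [w]. *)
pose eps := tau / 2 / (m + 1).
have eps0 : 0 < eps by rewrite !divr_gt0// ltr_wpDl.
have mn0 : 0 < Num.min eta ((tau / 2) ^+ 2).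
  by rewrite lt_min eta0 exprn_gt0// divr_gt0.
have [phi tphi hphi] := happ _ mn0.
have hz : test_function Om (smooth_pos eps k \o phi) := test_function_comp k eps0 tphi.
exists (smooth_pos eps k \o phi) => //.
have hd := Hs_memB hw (test_Hs tphi); have hd0 := Hs_memB hw (test_Hs tphi0).
have hvz := Hs_memB hv (test_Hs hz).
have hvzL2 : L2 leb Om (pos_above k w \- (smooth_pos eps k \o phi)) by case: hvz.
have zb : L2norm leb Om (pos_above k w \- (smooth_pos eps k \o phi)) <= tau.
  apply: le_trans (L2norm_smooth_pos mOm k0 eps0 h1 hwL2 (test_L2 d_gt0 oOm tphi)) _.
  rewrite (splitr tau); apply: lerD.
    rewrite -(@ler_pXn2r _ 2) ?nnegrE ?L2norm_ge0 ?divr_ge0 ?(ltW tau0)//.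
    apply: le_trans (le_trans hphi _); last by rewrite ge_min lexx orbT.
    by apply: hs2_ge_L2; case: hd.
  rewrite /eps mulrAC ler_pdivrMr ?ltr_wpDl// ler_wpM2l// ?divr_ge0 ?(ltW tau0)//.
  by rewrite lerDl.
have g1 : c * fine (gagliardo Om s (w \- phi) (w \- phi)) <= eta.
  apply: le_trans (hs2_ge_gag s mOm (proj1 hd)) _; apply: le_trans hphi _.
  by rewrite ge_min lexx.
have g0 : c * fine (gagliardo Om s (w \- phi0) (w \- phi0)) <= eta.
  exact: le_trans (hs2_ge_gag s mOm (proj1 hd0)) h0.
have key : (gagliardo Om s (pos_above k w \- (smooth_pos eps k \o phi))%R
      (pos_above k w \- (smooth_pos eps k \o phi))%R <=
   4%:E * gagliardo Om s (w \- phi)%R (w \- phi)%R +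
   12%:E * gagliardo Om s (w \- phi0)%R (w \- phi0)%R +
   12%:E * kint Om (gkern s) (fun q => sqdiff phi0 q * near_diag r q)%R +
   (4 * (r `^ p)^-1)%:E * (leb Om * sqint leb Om (pos_above k w \- (smooth_pos eps k \o phi))%R))%E.
  (* [w] is measurable on [Om] only; its extension by zero changes none of the integrals over
     [Om]. *)
  pose w' := w \_ Om.
  have w'E x : Om x -> w' x = w x by move=> Ox; rewrite /w' /patch mem_set.
  have mw' : measurable_fun setT w'.
    exact: ((measurable_restrictT w mOm).1 (L2_measurable mOm hwL2)).
  have mtest psi : test_function Om psi -> measurable_fun setT psi.
    by move=> [sp _ _]; apply: continuous_measurable_rV; exact: smooth_continuous.
  have := gagliardo_smooth_pos k eps0 r0 mw' (mtest _ tphi) (mtest _ tphi0).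
  rewrite /= (@eq_gagliardo _ (pos_above k w \- (smooth_pos eps k \o phi))); last first.
    by move=> x /w'E E; rewrite /pos_above E.
  rewrite (@eq_gagliardo (w' \- phi) (w \- phi)); last by move=> x /w'E E /=; rewrite E.
  rewrite (@eq_gagliardo (w' \- phi0) (w \- phi0)); last by move=> x /w'E E /=; rewrite E.
  congr (is_true (_ <= _ + _ * (_ * _))%E).
  by apply: eq_integral => x /set_mem /w'E E; rewrite /pos_above E.
rewrite (hs2E s mOm hvzL2) -/c.
have fK : kint Om (gkern s) (fun q => sqdiff phi0 q * near_diag r q)%R \is a fin_num.
  rewrite ge0_fin_numE; first exact: le_lt_trans hr (ltry _).
  apply: kint_ge0 => q; first exact: gkern_ge0.
  by rewrite mulr_ge0 ?sqdiff_ge0 ?near_diag_ge0.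
have f1 := fin_num_gagliardo (proj2 hd); have f0 := fin_num_gagliardo (proj2 hd0).
have fz := fin_num_gagliardo (proj2 hvz).
rewrite (L2_sqint hvzL2) -(fineK lOm) in key.
have B0 : 0 <= 4 * (r `^ p)^-1 * l.
  by apply: mulr_ge0 => //; apply: mulr_ge0 => //; rewrite invr_ge0 powR_ge0.
exact: (closure_arith c0 B0 (L2norm_ge0 _ _ _) zb tauE fz f1 f0 fK key g1 g0 hr).
Qed.

End closure_truncation.

(** * The four fractional spaces *)

Section spectral_norm.
Context {R : realType} {d : nat}.
Notation leb := (lebesgue_rV d : {measure set 'rV[R]_d -> \bar R}).
Variables (Om : set 'rV[R]_d) (s : R).
Hypotheses (d_gt0 : (0 < d)%N) (oOm : open Om) (bOm : bounded_set Om).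
Hypotheses (s0 : 0 < s) (s1 : s < 1).
Variable E : dirichlet_eigensystem Om.
Implicit Types (u v w : 'rV[R]_d -> R).

Let mOm : measurable Om. Proof. exact: open_measurable_rV. Qed.

(** The limit of the real partial sums agrees with the extended sum because the latter is finite. *)
Lemma spectral_inner_fine w : (spectral_form E s w < +oo)%E ->
  W_inner s (HspectralOm E) w w = fine (spectral_form E s w).
Proof.
move=> wfin; rewrite /=.
pose a n := eigval E n `^ s * coef E w n ^+ 2.
have -> : (fun n => eigval E n `^ s * L2inner Om w (eigfun E n) * L2inner Om w (eigfun E n)) = a.
  by apply/funext => n; rewrite /a expr2 mulrA.
have a0 n : (0 <= (a n)%:E)%E by rewrite lee_fin mulr_ge0 ?powR_ge0 ?sqr_ge0.
have fw : spectral_form E s w \is a fin_num by rewrite ge0_fin_numE// spectral_form_ge0.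
have cv : (\sum_(0 <= i < n) (a i)%:E)%E @[n --> \oo] --> (fine (spectral_form E s w))%:E.
  rewrite fineK//; exact: (is_cvg_nneseries (fun n _ _ => a0 n)).
apply: cvg_lim => //; have /fine_cvgP[_] := cv; apply: cvg_trans.
apply: near_eq_cvg; apply: nearW => n /=.
by rewrite sumEFin /series.
Qed.

Lemma spectral_formZ t u : L2 leb Om u ->
  (spectral_form E s u < +oo)%E ->
  (spectral_form E s (fun x => t * u x)%R < +oo)%E /\
  fine (spectral_form E s (fun x => t * u x)%R) = t ^+ 2 * fine (spectral_form E s u).
Proof.
move=> hu ufin.
have a0 n : (0 <= (eigval E n `^ s * coef E u n ^+ 2)%:E)%E.
  by rewrite lee_fin mulr_ge0 ?powR_ge0 ?sqr_ge0.
have -> : (spectral_form E s (fun x => t * u x)%R = (t ^+ 2)%:E * spectral_form E s u)%E.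
  rewrite /spectral_form -nneseriesZl//; apply: eq_eseriesr => n _.
  have [f2 _ _ _] := eigfun_H10 E n.
  by rewrite -EFinM; congr EFin; rewrite /coef ipZl// exprMn mulrCA.
have fu : spectral_form E s u \is a fin_num by rewrite ge0_fin_numE// spectral_form_ge0.
split; last by rewrite fineM.
by rewrite -(fineK fu) -EFinM ltry.
Qed.

Lemma spectral_truncation_real k t w : 0 <= k -> 0 <= t -> t <= 1 -> L2 leb Om w ->
  (spectral_form E s w < +oo)%E ->
  [/\ (spectral_form E s (pos_above k w) < +oo)%E,
      (spectral_form E s (fun x => w x - t * pos_above k w x)%R < +oo)%E &
      fine (spectral_form E s (fun x => w x - t * pos_above k w x)%R) <=
      fine (spectral_form E s w) - (2 * t - t ^+ 2) * fine (spectral_form E s (pos_above k w))].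
Proof.
move=> k0 t0 t1 hw wfin.
have main t' (t'0 : 0 <= t') (t'2 : t' <= 2) :=
  @spectral_truncation_le R d Om d_gt0 oOm bOm E s s0 s1 w k t' k0 t'0 hw t'2.
have g0 u := spectral_form_ge0 E s u.
have vfin : (spectral_form E s (pos_above k w) < +oo)%E.
  have := main 1 ler01 (ler1n _ 2); rewrite (_ : 2 * 1 - 1 ^+ 2 = 1 :> R) ?mul1e; last by ring.
  by move=> h; apply: le_lt_trans wfin; apply: le_trans h; rewrite leeDr.
have t2 : t <= 2 by rewrite (le_trans t1)// ler1n.
have ht := main t t0 t2.
have tt0 : 0 <= 2 * t - t ^+ 2 by rewrite expr2 -mulrBl mulr_ge0// subr_ge0.
have wtfin : (spectral_form E s (fun x => w x - t * pos_above k w x)%R < +oo)%E.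
  by apply: le_lt_trans wfin; apply: le_trans ht; rewrite leeDl// mule_ge0.
split => //.
have fin u : (spectral_form E s u < +oo)%E -> spectral_form E s u \is a fin_num.
  by move=> h; rewrite ge0_fin_numE.
rewrite lerBrDr; exact: fine_le_combine (fin _ wtfin) (fin _ wfin) (fin _ vfin) ht.
Qed.

End spectral_norm.

Section fractional_space.
Context {R : realType} {d : nat}.
Notation leb := (lebesgue_rV d : {measure set 'rV[R]_d -> \bar R}).
Variables (Om : set 'rV[R]_d) (s : R).
Hypotheses (d_gt0 : (0 < d)%N) (OmP : bounded_lipschitz_domain Om).
Hypotheses (s0 : 0 < s) (s1 : s < 1).
Implicit Types (u v w : 'rV[R]_d -> R) (k t m : R) (W : frac_space Om).

Let oOm : open Om. Proof. by case: OmP. Qed.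
Let bOm : bounded_set Om. Proof. by case: OmP. Qed.
Let mOm : measurable Om. Proof. exact: open_measurable_rV. Qed.

Lemma Wmem_L2 W w : W_mem s W w -> L2 leb Om w.
Proof.
case: W => [[]//|[[]//]|[[hw _] _]|E []//].
exact: L2S.
Qed.

Lemma W_norm_hs2 W D w : measurable D -> L2 leb D w -> W_inner s W w w = hs2 D s w ->
  W_norm s W w ^+ 2 = hs2 D s w.
Proof. by move=> mD hw WE; rewrite /W_norm WE sqr_sqrtr// hs2_ge0. Qed.

Lemma truncation_diff k t w :
  (fun x => w x - t * pos_above k w x) \- w = (fun x => - t * pos_above k w x).
Proof. by apply/funext => x /=; ring. Qed.

(** The last identity keeps the competitor in the neighbourhood of the local solution: its distance
    to [w] is linear in [t]. *)
Lemma W_truncation W k t w : 0 <= k -> 0 <= t -> t <= 1 -> W_mem s W w ->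
  [/\ W_mem s W (fun x => w x - t * pos_above k w x),
      W_norm s W (fun x => w x - t * pos_above k w x) ^+ 2 <=
        W_norm s W w ^+ 2 - (2 * t - t ^+ 2) * W_norm s W (pos_above k w) ^+ 2 &
      W_norm s W ((fun x => w x - t * pos_above k w x) \- w) = t * W_norm s W (pos_above k w)].
Proof.
move=> k0 t0 t1; rewrite truncation_diff.
have gag D : measurable D -> Hs_mem D s w -> forall W',
    (forall u, W_inner s W' u u = hs2 D s u) ->
    W_norm s W' (fun x => w x - t * pos_above k w x) ^+ 2 <=
      W_norm s W' w ^+ 2 - (2 * t - t ^+ 2) * W_norm s W' (pos_above k w) ^+ 2 /\
    W_norm s W' (fun x => - t * pos_above k w x) = t * W_norm s W' (pos_above k w).
  move=> mD hw W' WE.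
  have [hv hwt le_] := Hs_truncation mD s0 s1 k0 t0 t1 hw.
  rewrite (W_norm_hs2 mD (proj1 hv) (WE _)) (W_norm_hs2 mD (proj1 hw) (WE _)).
  rewrite (W_norm_hs2 mD (proj1 hwt) (WE _)).
  split; first exact: le_.
  rewrite /W_norm !WE hs2Z// sqrrN sqrtrM ?sqr_ge0// sqrtr_sqr ger0_norm//.
case: W => [||[[hw gw] w0]|E].
- move=> hw; have [h1 h2] := gag Om mOm hw (HsOm Om) (fun=> erefl).
  have [_ hwt _] := Hs_truncation mOm s0 s1 k0 t0 t1 hw.
  by split; [exact: hwt|exact: h1|exact: h2].
- move=> hw0; have hw : Hs_mem Om s w by exact: (proj1 hw0).
  have [h1 h2] := gag Om mOm hw (Hs0Om Om) (fun=> erefl).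
  have h := Hs0_lin d_gt0 oOm bOm s0 s1 1 (- t) hw0 (Hs0_pos_above d_gt0 oOm bOm s0 s1 k0 hw0).
  split; [|exact: h1|exact: h2].
  rewrite (_ : (fun x => _) = fun x => 1 * w x + - t * pos_above k w x); first exact: h.
  by apply/funext => x; ring.
- have hw' : Hs_mem setT s w by split.
  have [h1 h2] := gag setT measurableT hw' (HstildeOm Om) (fun=> erefl).
  have [_ hwt _] := Hs_truncation measurableT s0 s1 k0 t0 t1 hw'.
  split; [split; first exact: hwt|exact: h1|exact: h2].
  (* Outside [Om] the truncation is almost everywhere [max (- k) 0 = 0], as [k >= 0]. *)
  apply: filterS w0 => x h /h wx; rewrite /pos_above wx !sub0r.
  by rewrite max_r ?oppr_le0// mulr0 oppr0.
move=> [hw wfin].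
have [vfin wtfin le_] :=
  @spectral_truncation_real R d Om s d_gt0 oOm bOm s0 s1 E k t w k0 t0 t1 hw wfin.
have hv := L2_pos_above mOm k0 hw.
have hwt := L2B mOm hw (L2Z mOm t hv).
have nE u : (spectral_form E s u < +oo)%E ->
    W_norm s (HspectralOm E) u ^+ 2 = fine (spectral_form E s u).
  by move=> h; rewrite /W_norm spectral_inner_fine// sqr_sqrtr// fine_ge0// spectral_form_ge0.
split; first by split.
  by rewrite (nE _ wtfin) (nE _ wfin) (nE _ vfin); exact: le_.
have [tvfin tvE] := spectral_formZ oOm (- t) hv vfin.
rewrite /W_norm !spectral_inner_fine// tvE sqrrN sqrtrM ?sqr_ge0// sqrtr_sqr ger0_norm//.
Qed.

Lemma Hs_faber_krahn (D : set 'rV[R]_d) : measurable D ->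
  (exists2 c, 0 < c & forall x r, D x -> 0 < r -> r <= c ->
    ((c * r)%:E ^+ d <= leb (D `&` cube x r))%E) ->
  exists C delta, [/\ 0 < C, 0 < delta & forall u m, Hs_mem D s u -> 0 < m -> m <= delta ->
    (leb (D `&` [set x | u x != 0%R]) <= m%:E)%E ->
    L2norm leb D u ^+ 2 <= C * m `^ (2 * s / d%:R) * hs2 D s u].
Proof.
move=> mD [c c0 hc].
pose fc := @frac_const R d s.
have fc0 : 0 < fc by exact: frac_const_gt0.
have d0 : 0 < d%:R :> R by rewrite ltr0n.
pose q := d%:R + 2 * s.
have q0 : 0 < q by rewrite /q addr_gt0// mulr_gt0.
pose C0 := (d%:R / c) `^ q * 2 `^ (q / d%:R).
have C00 : 0 < C0 by rewrite mulr_gt0// powR_gt0// divr_gt0.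
(* The bound on [m] is what makes the radius [r] below at most [c]. *)
exists (C0 * (2 / fc)), ((c ^+ 2) ^+ d / 2); split.
- by rewrite mulr_gt0// divr_gt0.
- by rewrite divr_gt0// !exprn_gt0.
move=> u m hu m0 md um.
have m20 : 0 < 2 * m by rewrite mulr_gt0.
(* Chosen so that the density bound [(c r)^d] is [2 m]; then [r^(d + 2 s) / m] is a multiple of
   [m^(2 s / d)]. *)
pose r := (2 * m) `^ (d%:R^-1) / c.
have r0 : 0 < r by rewrite divr_gt0// powR_gt0.
have crd : (c * r) ^+ d = 2 * m.
  rewrite /r mulrCA divff ?gt_eqF// mulr1 -powR_mulrn ?powR_ge0// -powRrM mulVf ?gt_eqF//.
  by rewrite powRr1// ltW.
have rc : r <= c.
  rewrite ler_pdivrMr// -expr2 -(@ler_pXn2r _ d) ?nnegrE ?powR_ge0 ?sqr_ge0//.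
  rewrite -powR_mulrn ?powR_ge0// -powRrM mulVf ?gt_eqF// powRr1 ?(ltW m20)//.
  by rewrite mulrC -ler_pdivlMr.
have dens x : D x -> ((2 * m)%:E <= leb (D `&` cube x r))%E.
  by move=> Dx; rewrite -crd EFin_expe; exact: hc.
have mu_ := L2_measurable mD (proj1 hu).
have := @gagliardo_faber_krahn R d D s mD d_gt0 s0 u m r mu_ m0 r0 um dens.
have fg := fin_num_gagliardo (proj2 hu).
rewrite (L2_sqint (proj1 hu)) -(fineK fg) -EFinM lee_fin => /le_trans; apply.
have E : (d%:R * r) `^ q / m = C0 * m `^ (2 * s / d%:R).
  have -> : d%:R * r = d%:R / c * (2 * m) `^ (d%:R^-1) by rewrite /r mulrAC mulrA.
  have dc0 : 0 <= d%:R / c by rewrite divr_ge0 ?(ltW c0).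
  rewrite (powRM _ dc0 (powR_ge0 _ _)).
  rewrite -powRrM powRM ?(ltW m0)// /C0.
  have -> : d%:R^-1 * q = 1 + 2 * s / d%:R by rewrite /q; field; rewrite gt_eqF.
  have -> : q / d%:R = 1 + 2 * s / d%:R by rewrite /q; field; rewrite gt_eqF.
  rewrite [m `^ (1 + _)]powRD; last by rewrite (gt_eqF m0) implybT.
  rewrite powRr1 ?(ltW m0)//.
  move: (2 `^ _) (m `^ _) (_ `^ q) => a b e; field; rewrite gt_eqF//.
have hg : fine (gagliardo D s u u) <= 2 / fc * hs2 D s u.
  have h := hs2_ge_gag s mD (proj1 hu); rewrite -/fc in h.
  rewrite (_ : 2 / fc = (fc / 2)^-1); last by rewrite [RHS]invf_div.
  by rewrite ler_pdivlMl; [exact: h|exact: divr_gt0 fc0 (ltr0Sn _ 1)].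
rewrite E (mulrAC C0 (2 / fc)) -[leRHS]mulrA; apply: ler_wpM2l; last exact: hg.
by rewrite mulr_ge0 ?powR_ge0// ltW.
Qed.

Lemma W_faber_krahn W : exists C delta, [/\ 0 < C, 0 < delta & forall k w m, 0 <= k ->
    W_mem s W w -> 0 < m -> m <= delta ->
    (leb (Om `&` [set x | pos_above k w x != 0%R]) <= m%:E)%E ->
    L2norm leb Om (pos_above k w) ^+ 2 <=
      C * m `^ (2 * s / d%:R) * W_norm s W (pos_above k w) ^+ 2].
Proof.
have density := lipschitz_measure_density d_gt0 oOm bOm.
have densityT : exists2 c : R, 0 < c & forall (x : 'rV[R]_d) r, setT x -> 0 < r -> r <= c ->
    ((c * r)%:E ^+ d <= leb (setT `&` cube x r))%E.
  exists 1 => // x r _ r0 _; rewrite setTI [leb _](lebesgue_cube x (ltW r0)).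
  rewrite -EFin_expe lee_fin mul1r lerXn2r ?nnegrE ?mulr_ge0 ?(ltW r0)//.
  by rewrite ler_peMl ?(ltW r0)// ler1n.
have Om_case W' : (forall u, W_inner s W' u u = hs2 Om s u) ->
    (forall w, W_mem s W' w -> Hs_mem Om s w) ->
  exists C delta, [/\ 0 < C, 0 < delta & forall k w m, 0 <= k ->
    W_mem s W' w -> 0 < m -> m <= delta ->
    (leb (Om `&` [set x | pos_above k w x != 0%R]) <= m%:E)%E ->
    L2norm leb Om (pos_above k w) ^+ 2 <=
      C * m `^ (2 * s / d%:R) * W_norm s W' (pos_above k w) ^+ 2].
  move=> WE Wm; have lip : lipschitz_boundary Om by case: OmP.
  have [C [delta [C0 delta0 H]]] := Hs_faber_krahn mOm (density lip).
  exists C, delta; split => // k w m k0 /Wm hw m0 md hm.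
  have [hv _ _] := Hs_truncation mOm s0 s1 k0 (lexx 0) ler01 hw.
  rewrite (W_norm_hs2 mOm (proj1 hv) (WE _)); exact: H.
case: W => [|||E].
- by apply: Om_case.
- by apply: Om_case => // w [].
- have [C [delta [C0 delta0 H]]] := Hs_faber_krahn measurableT densityT.
  exists C, delta; split => // k w m k0 [hw w0] m0 md hm.
  have [hv _ _] := Hs_truncation measurableT s0 s1 k0 (lexx 0) ler01 hw.
  rewrite (@W_norm_hs2 (HstildeOm Om) setT _ measurableT (proj1 hv) erefl).
  have mv := L2_measurable measurableT (proj1 hv).
  pose S := [set x | pos_above k w x != 0%R].
  have mS : measurable S.
    rewrite [S](_ : _ = setT `&` (pos_above k w @^-1` (~` [set 0]))).
      by apply: mv => //; exact: measurableC.
    by rewrite setTI; apply/seteqP; split => x /= /eqP.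
  have hm' : (leb (setT `&` S) <= m%:E)%E.
    (* Since [w] vanishes almost everywhere outside [Om], the measure bound on [Om] extends to the
       whole space. *)
    have [N [mN N0 hN]] := w0.
    have mOS : measurable (Om `&` S) by exact: measurableI.
    apply: (@le_trans _ _ (leb (Om `&` S))); last exact: hm.
    rewrite setTI -[leRHS]adde0 -N0.
    apply: (@le_trans _ _ (leb ((Om `&` S) `|` N))); last exact: measureU2.
    apply: le_measure; rewrite ?inE//; first exact: measurableU.
    move=> x Sx; have [Ox|nOx] := pselect (Om x); [by left|right].
    apply: hN => /= /(_ nOx) wx; move: Sx; rewrite /S /= /pos_above wx sub0r.
    by rewrite max_r ?oppr_le0// eqxx.
  apply: le_trans (H _ _ hv m0 md hm').
  rewrite -[L2norm leb Om _]L2norm_restrict lerXn2r ?nnegrE ?L2norm_ge0//.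
  apply: (L2norm_le measurableT _ (proj1 hv)).
    by apply/(measurable_restrictT _ mOm); exact: measurable_funTS.
  by move=> x _; rewrite /patch; case: ifPn; rewrite ?normr0.
(* The constant of [spectral_faber_krahn], which holds for every [m > 0]; the threshold [1] is
   arbitrary. *)
exists (2 * (2 * d%:R ^+ 2 + 8)), 1; split; [|exact: ltr01|].
  by apply: mulr_gt0 => //; apply: ltr_wpDl => //; rewrite mulr_ge0// sqr_ge0.
move=> k w m k0 [hw wfin] m0 _ hm.
have [vfin _ _] :=
  @spectral_truncation_real R d Om s d_gt0 oOm bOm s0 s1 E k 0 w k0 (lexx 0) ler01 hw wfin.
have hv := L2_pos_above mOm k0 hw.
have := spectral_faber_krahn d_gt0 oOm s0 s1 hv vfin m0 hm.
rewrite /W_norm sqr_sqrtr (spectral_inner_fine vfin)//.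
by rewrite fine_ge0// spectral_form_ge0.
Qed.

End fractional_space.

(** * Boundedness *)

(* Stampacchia's iteration along the levels [k0 + 1 - 2^-n]. *)
Lemma stampacchia {R : realType} (phi : R -> R) (K delta q : R) :
  0 < K -> 0 < delta -> 1 < q ->
  (forall k, 0 <= phi k) -> (forall k h, k <= h -> phi h <= phi k) ->
  (forall M, 0 < M -> exists2 k, 0 < k & phi k <= M) ->
  (forall k h m, 0 < k -> k < h -> 0 < m -> m <= delta -> phi k <= m ->
    (h - k) ^+ 2 * phi h <= K * m `^ q) ->
  exists2 k, 0 < k & phi k = 0.
Proof.
move=> K0 delta0 q1 phi0 phimono phismall H.
have q10 : 0 < q - 1 by rewrite subr_gt0.
(* Makes [r^(q - 1) = 1 / 4], which offsets the squares of the shrinking gaps between the levels. *)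
pose r : R := 4^-1 `^ (q - 1)^-1.
have r0 : 0 < r by rewrite powR_gt0// invr_gt0.
have rE : r `^ (q - 1) = 4^-1.
  by rewrite /r -powRrM mulVf ?gt_eqF// powRr1// invr_ge0.
have r1 : r < 1.
  rewrite ltNge; apply/negP => r1.
  have := @ge0_ler_powR _ (q - 1) (ltW q10) 1 r; rewrite !nnegrE ler01 (ltW r0) powR1 rE.
  by move=> /(_ isT isT r1); rewrite invf_ge1// lern1.
(* The second entry ensures [4 K M^(q - 1) <= r], so that each step of the induction gains the
   factor [r]. *)
pose M : R := Num.min delta ((r / (4 * K)) `^ (q - 1)^-1).
have rK0 : 0 < r / (4 * K) by rewrite divr_gt0// mulr_gt0.
have M0 : 0 < M by rewrite lt_min delta0 powR_gt0.
have Md : M <= delta by rewrite ge_min lexx.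
have MK : 4 * K * M `^ (q - 1) <= r.
  rewrite mulrC -ler_pdivlMr ?mulr_gt0//.
  have := @ge0_ler_powR _ (q - 1) (ltW q10) M ((r / (4 * K)) `^ (q - 1)^-1).
  rewrite !nnegrE (ltW M0) powR_ge0 -powRrM mulVf ?gt_eqF// powRr1 ?(ltW rK0)//.
  by apply=> //; rewrite ge_min lexx orbT.
have [k0 k00 hk0] := phismall M M0.
pose e n : R := 2^-1 ^+ n.
have e0 n : 0 < e n by rewrite exprn_gt0// invr_gt0.
have eS n : e n - e n.+1 = e n.+1.
  by rewrite /e exprS; move: (2^-1 ^+ n) => x; lra.
have e1 n : e n <= 1 by rewrite exprn_ile1// ?invr_ge0// invf_le1// ler1n.
pose k n := k0 + 1 - e n.
have step n : phi (k n) <= M * r ^+ n.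
  elim: n => [|n IH]; first by rewrite /k /e !expr0 mulr1 addrK.
  have kn0 : 0 < k n by rewrite /k -addrA ltr_pwDl// subr_ge0.
  have kS : k n < k n.+1 by rewrite ltrD2l ltrN2 -subr_gt0 eS.
  have rn1 : r ^+ n <= 1 by rewrite exprn_ile1// ltW.
  have m0 : 0 < M * r ^+ n by rewrite mulr_gt0// exprn_gt0.
  have md : M * r ^+ n <= delta by apply: le_trans Md; rewrite ler_piMr// ltW.
  have := H _ _ _ kn0 kS m0 md IH.
  have -> : k n.+1 - k n = e n.+1 by rewrite -(eS n) /k; ring.
  rewrite -mulr_powRB1 ?(ltW m0) ?(lt_trans ltr01)//.
  rewrite powRM ?(ltW M0) ?exprn_ge0 ?(ltW r0)//.
  have -> : (r ^+ n) `^ (q - 1) = e n ^+ 2.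
    rewrite -powR_mulrn ?(ltW r0)// powRAC rE powR_mulrn ?invr_ge0// /e.
    by rewrite -exprM mulnC exprM; congr (_ ^+ n); field.
  have -> : e n.+1 ^+ 2 = e n ^+ 2 / 4 by rewrite /e [2^-1 ^+ n.+1]exprS; move: (2^-1 ^+ n) => x; field.
  have en2 : 0 < e n ^+ 2 by rewrite exprn_gt0.
  rewrite [r ^+ n.+1]exprSr; move: (e n ^+ 2) en2 (r ^+ n) m0 => x x0 y m0 h.
  have {}h : phi (k n.+1) <= 4 * K * M `^ (q - 1) * (M * y).
    rewrite -(ler_pM2l x0); move: (M `^ _) h => z h. lra.
  apply: le_trans h _; rewrite (_ : M * (y * r) = r * (M * y)); last by rewrite mulrA mulrC.
  by rewrite ler_pM2r.
exists (k0 + 1); first by rewrite addr_gt0.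
apply/eqP; rewrite eq_le phi0 andbT leNgt; apply/negP => p0.
have cv : (fun n => M * r ^+ n) @ \oo --> (0 : R).
  rewrite -(mulr0 M); apply: cvgM; first exact: cvg_cst.
  by apply: cvg_expr; rewrite ger0_norm// ltW.
have /cvgrPdist_lt/(_ _ p0)[n _ /(_ n (leqnn n))] := cv.
rewrite sub0r normrN gtr0_norm ?mulr_gt0 ?exprn_gt0// => hn.
have kn : k n <= k0 + 1 by rewrite /k lerBlDr lerDl ltW.
by have := le_lt_trans (le_trans (phimono _ _ kn) (step n)) hn; rewrite ltxx.
Qed.

Section essentially_bounded.
Context {R : realType} {disp : measure_display} {T : measurableType disp}.
Variables (mu : {measure set T -> \bar R}) (D : set T) (mD : measurable D).

Lemma Linfty_ae_bound (u : T -> R) k : measurable_fun D u ->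
  {ae mu, forall x, D x -> `|u x| <= k} -> Linfty mu D u.
Proof.
move=> mu_ uk; rewrite /Linfty/= inE; apply/andP; split; rewrite inE/=.
  exact: ((measurable_restrictT u mD).1 mu_).
rewrite /finite_norm unlock; case: ifPn => // _.
(* The maximum with [0] accounts for the extension by zero outside [D]. *)
apply: (@le_lt_trans _ _ (Num.max k 0)%:E); last exact: ltry.
apply/ess_supP; apply: filterS uk => x h /=; rewrite lee_fin /patch le_max.
by case: ifPn => [/set_mem/h ->//|_]; rewrite normr0 lexx orbT.
Qed.
End essentially_bounded.

(** * Functions on the space-time cylinder *)

Section cylinder.
Context {R : realType} {d : nat}.
Notation leb := (lebesgue_rV d : {measure set 'rV[R]_d -> \bar R}).
Variables (Om : set 'rV[R]_d) (T : R).
Hypotheses (mOm : measurable Om) (T0 : 0 < T).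

Let I : set (measurableTypeR R) := [set` `]0, T[].
Let mI : measurable I. Proof. exact: measurable_itv. Qed.

Let lI : lebesgue_measure I = T%:E.
Proof. by rewrite /I lebesgue_measure_itv /= lte_fin T0 oppr0 adde0. Qed.

Lemma measurable_cylinder : measurable (cylinder Om T).
Proof. exact: measurableX. Qed.

Lemma leb_cylinder (A : set 'rV[R]_d) : measurable A ->
  leb_spacetime (cylinder A T) = (T%:E * leb A)%E.
Proof.
by move=> mA; rewrite -lI; exact: product_measure1E mI mA.
Qed.

Lemma measurable_snd_cylinder (v : 'rV[R]_d -> R) : measurable_fun Om v ->
  measurable_fun (cylinder Om T) (fun tx : measurableTypeR R * 'rV[R]_d => v tx.2).
Proof.
move=> mv _ B mB.
rewrite (_ : _ `&` _ = I `*` (Om `&` v @^-1` B)); last first.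
  by apply/seteqP; split => [[t x] [[]]|[t x] [? []]].
by apply: measurableX => //; exact: mv.
Qed.

Lemma sqint_snd_cylinder (v : 'rV[R]_d -> R) : measurable_fun Om v ->
  sqint leb_spacetime (cylinder Om T) (fun tx => v tx.2) = (T%:E * sqint leb Om v)%E.
Proof.
move=> mv; rewrite /sqint integral_mkcond.
pose V : 'rV[R]_d -> \bar R := (fun x => (v x ^+ 2)%:E) \_ Om.
have mV : measurable_fun setT V.
  by apply/(measurable_restrictT _ mOm); exact: measurable_sqr.
have V0 x : (0 <= V x)%E by rewrite /V /patch; case: ifPn => // _; rewrite lee_fin sqr_ge0.
have m1 : measurable_fun setT (fun t : measurableTypeR R => (\1_I t)%:E : \bar R).
  by apply/measurable_EFinP; exact: measurable_indic.
rewrite (_ : _ \_ _ = fun z => ((\1_I z.1)%:E * V z.2)%E); last first.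
  apply/funext => -[t x]; rewrite /V /patch /= indicE.
  case: (boolP (t \in I)) => tI; case: (boolP (x \in Om)) => xO; rewrite ?mul1e ?mul0e ?mule0//.
  - by rewrite mem_set//; split; exact: set_mem.
  - by rewrite memNset// => -[_ /mem_set]; rewrite (negbTE xO).
  - by rewrite memNset// => -[/mem_set]; rewrite (negbTE tI).
  - by rewrite memNset// => -[/mem_set]; rewrite (negbTE tI).
rewrite /leb_spacetime fubini_tonelli1; last 2 first.
- apply: emeasurable_funM; first exact: (measurableT_comp m1 measurable_fst).
  exact: (measurableT_comp mV measurable_snd).
- by move=> z; rewrite mule_ge0// lee_fin.
have IV : (\int[leb]_x V x = \int[leb]_(x in Om) (v x ^+ 2)%:E)%E.
  by rewrite [RHS]integral_mkcond.
have inner t : (\int[leb]_x ((\1_I t)%:E * V x) = (\1_I t)%:E * \int[leb]_x V x)%E.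
  by rewrite ge0_integralZl_EFin//.
transitivity (\int[lebesgue_measure]_t ((\1_I t)%:E * \int[leb]_x V x))%E.
  by apply: eq_integral => t _; exact: inner.
rewrite ge0_integralZr//; [|exact: integral_ge0].
rewrite integral_indic// setIT IV; congr (_ * _)%E; exact: lI.
Qed.

End cylinder.

(** For [k >= 0], [u - excess k u] is [u] clipped to [[-k, k]]; the two one-sided truncations make
    measurability immediate. *)
Definition excess {R : realType} {T : Type} (k : R) (u : T -> R) : T -> R :=
  fun z => pos_above k u z - pos_above k (fun z => - u z) z.

Section excess_theory.
Context {R : realType}.

Lemma normr_excess (T : Type) (k : R) (u : T -> R) z : 0 <= k ->
  `|excess k u z| = Num.max (`|u z| - k) 0.
Proof.
rewrite /excess /pos_above !maxEle => k0.
case: (ger0P (u z)) => h.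
  have -> : (- u z - k <= 0) = true by lra.
  rewrite subr0; case: (leP (u z - k) 0) => h'; first exact: normr0.
  by rewrite gtr0_norm.
have -> : (u z - k <= 0) = true by lra.
rewrite sub0r normrN; case: (leP (- u z - k) 0) => h'; first exact: normr0.
by rewrite gtr0_norm.
Qed.

(** For [t <= 1] the subtraction does not reverse the sign of [u], so [|u|] is transformed by the
    same function as the bound [w]. *)
Lemma normr_sub_excess (T : Type) (k t : R) (u : T -> R) z : 0 <= k -> 0 <= t -> t <= 1 ->
  `|u z - t * excess k u z| = `|u z| - t * Num.max (`|u z| - k) 0.
Proof.
move=> k0 t0 t1; rewrite /excess /pos_above; move: (u z) => a.
have main b : 0 <= b -> `|b - t * Num.max (b - k) 0| = b - t * Num.max (b - k) 0.
  move=> b0; rewrite ger0_norm// subr_ge0 maxEle.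
  case: (leP (b - k) 0) => h; first by rewrite mulr0.
  apply: (@le_trans _ _ (1 * (b - k))); first by rewrite ler_wpM2r// ltW.
  by rewrite mul1r; lra.
case: (ger0P a) => h.
  rewrite (max_r (_ : - a - k <= 0)); last by lra.
  by rewrite subr0 main.
rewrite (max_r (_ : a - k <= 0)); last by lra.
rewrite -main; last by rewrite oppr_ge0 ltW.
by move: (Num.max _ _) => M; rewrite -normrN; congr `|_|; ring.
Qed.

(** The map has slopes [1] and [1 - t]; its monotonicity carries the constraint [|u| <= w] over to
    the truncated pair. *)
Lemma sub_trunc_mono (k t a b : R) : 0 <= t -> t <= 1 -> a <= b ->
  a - t * Num.max (a - k) 0 <= b - t * Num.max (b - k) 0.
Proof.
move=> t0 t1 ab; rewrite -subr_ge0.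
have : 0 <= (1 - t) * (b - a) by rewrite mulr_ge0// subr_ge0.
have := mulr_ge0 t0 t0.
rewrite !maxEle; case: (leP (a - k) 0); case: (leP (b - k) 0) => h1 h2 _ h3; [lra| |lra|lra].
have : 0 <= t * (k - a) by rewrite mulr_ge0//; lra.
lra.
Qed.

End excess_theory.

Section power_integral.
Context {R : realType} {d : nat}.
Notation leb := (lebesgue_rV d : {measure set 'rV[R]_d -> \bar R}).
Variables (Om : set 'rV[R]_d) (p : R).
Hypotheses (mOm : measurable Om) (bOm : bounded_set Om) (p0 : 0 < p) (p1 : p < 1).

(** By [|w|^p <= 1 + w^2] on a set of finite measure; integrability excludes the default value of a
    divergent real integral. *)
Lemma integrable_powR_L2 (w : 'rV[R]_d -> R) : L2 leb Om w ->
  leb.-integrable Om (fun x => (`|w x| `^ p)%:E).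
Proof.
move=> hw.
have h1 : L2 leb Om (fun=> 1).
  apply/(L2P _ mOm); split; first exact: measurable_cst.
  rewrite /sqint expr1n integral_cst// mul1e; exact: bounded_lebesgue_rV.
have i := integrableD mOm (L2_integrableM mOm h1 h1) (L2_integrableM mOm hw hw).
have mw := L2_measurable mOm hw.
apply: le_integrable i => //.
  apply/measurable_EFinP; apply: (measurableT_comp (measurable_powR p)).
  exact: measurableT_comp.
move=> x _ /=; rewrite lee_fin mul1r ger0_norm ?powR_ge0//.
rewrite [leRHS]ger0_norm; last by rewrite addr_ge0// -expr2 sqr_ge0.
rewrite -expr2 -real_normK ?num_real//; case: (leP `|w x| 1) => h.
  apply: (@le_trans _ _ 1); last by rewrite lerDl sqr_ge0.
  have := @ge0_ler_powR _ p (ltW p0) `|w x| 1; rewrite !nnegrE normr_ge0 ler01 powR1.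
  by apply.
apply: (@le_trans _ _ (`|w x| ^+ 2)); last by rewrite lerDr.
rewrite -powR_mulrn// ler_powR// ?(ltW h)//.
by apply: (le_trans (ltW p1)); rewrite ler1n.
Qed.

Lemma power_integral_truncation (w : 'rV[R]_d -> R) k t : 0 <= k -> 0 <= t -> t <= 1 ->
  L2 leb Om w -> L2 leb Om (fun x => w x - t * pos_above k w x) ->
  \int[leb]_(x in Om) (`|w x - t * pos_above k w x| `^ p) <=
    \int[leb]_(x in Om) (`|w x| `^ p).
Proof.
move=> k0 t0 t1 hw hwt; apply: le_Rintegral => //.
- exact: integrable_powR_L2 hwt.
- exact: integrable_powR_L2.
move=> x _; apply: (ge0_ler_powR (ltW p0)); rewrite ?nnegrE//.
rewrite /pos_above maxEle; case: (leP (w x - k) 0) => h; first by rewrite mulr0 subr0.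
have a0 : 0 <= w x by lra.
have h1 : 0 <= t * (w x - k) by rewrite mulr_ge0// ltW.
have h2 : t * (w x - k) <= 1 * (w x - k) by rewrite ler_wpM2r// ltW.
by rewrite !ger0_norm//; lra.
Qed.
End power_integral.

(** * Measure of the superlevel sets *)

Section level_sets.
Context {R : realType} {d : nat}.
Notation leb := (lebesgue_rV d : {measure set 'rV[R]_d -> \bar R}).
Variables (Om : set 'rV[R]_d) (w : 'rV[R]_d -> R).
Hypotheses (mOm : measurable Om) (bOm : bounded_set Om) (hw : L2 leb Om w).

Definition level_measure (k : R) : R := fine (leb (Om `&` [set x | k < w x])).

Lemma pos_above_neq0 k : [set x | pos_above k w x != 0%R] = [set x | k < w x].
Proof.
apply/seteqP; split => x /=; rewrite /pos_above maxEle.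
  by case: (leP (w x - k) 0) => [|h _]; [rewrite eqxx|rewrite -subr_gt0].
by rewrite -subr_gt0 => h; rewrite leNgt h /= gt_eqF.
Qed.

Lemma measurable_level k : measurable (Om `&` [set x | k < w x]).
Proof.
rewrite (_ : [set x | k < w x] = w @^-1` (`]k, +oo[ : set R)).
  by apply: (L2_measurable mOm hw) => //; exact: measurable_itv.
by apply/seteqP; split => x /=; rewrite in_itv/= andbT.
Qed.

Lemma level_measureE k : leb (Om `&` [set x | k < w x]) = (level_measure k)%:E.
Proof.
rewrite /level_measure fineK// ge0_fin_numE//.
apply: le_lt_trans (bounded_lebesgue_rV mOm bOm).
by apply: le_measure; rewrite ?inE//; exact: measurable_level.
Qed.

Lemma level_measure_ge0 k : 0 <= level_measure k.
Proof. by rewrite fine_ge0. Qed.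

Lemma level_measure_mono k h : k <= h -> level_measure h <= level_measure k.
Proof.
move=> kh; rewrite -lee_fin -!level_measureE.
apply: le_measure; rewrite ?inE; [exact: measurable_level|exact: measurable_level|].
by move=> x [Ox /=] /(le_lt_trans kh).
Qed.

Lemma level_chebyshev k h : 0 <= k -> k < h ->
  (h - k) ^+ 2 * level_measure h <= L2norm leb Om (pos_above k w) ^+ 2.
Proof.
move=> k0 kh; have hv := L2_pos_above mOm k0 hw.
rewrite -lee_fin EFinM -level_measureE -(L2_sqint hv) /sqint.
have mA := measurable_level h.
rewrite -integral_cst//.
apply: (@le_trans _ _ (\int[leb]_(x in Om `&` [set x | (h < w x)%R]) (pos_above k w x ^+ 2)%:E)%E).
  apply: ge0_le_integral => //; first by move=> x _; rewrite lee_fin sqr_ge0.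
    apply: measurable_funS (measurable_sqr (L2_measurable mOm hv)) => //.
  move=> x [_ /= hx]; rewrite lee_fin lerXn2r ?nnegrE ?pos_above_ge0 ?subr_ge0 ?(ltW kh)//.
  by rewrite /pos_above le_max lerD2r (ltW hx).
apply: ge0_subset_integral => //; first exact: measurable_sqr (L2_measurable mOm hv).
by move=> x _; rewrite lee_fin sqr_ge0.
Qed.

Lemma level_measure_small M : 0 < M -> exists2 k, 0 < k & level_measure k <= M.
Proof.
move=> M0; pose N := L2norm leb Om (pos_above 0 w) ^+ 2.
have N0 : 0 <= N by exact: sqr_ge0.
(* Then [h >= 1], hence [h^2 M >= h M >= N]. *)
pose h := N / M + 1.
have h1 : 1 <= h by rewrite lerDr divr_ge0// ltW.
exists h; first exact: lt_le_trans h1.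
have := level_chebyshev (lexx 0) (lt_le_trans ltr01 h1); rewrite subr0 -/N => hN.
have h0 : 0 < h ^+ 2 by rewrite exprn_gt0// (lt_le_trans _ h1).
rewrite -(ler_pM2l h0); apply: le_trans hN _.
apply: (@le_trans _ _ (h * M)); first by rewrite /h mulrDl divfK ?gt_eqF// lerDl mul1r ltW.
by rewrite ler_wpM2r ?(ltW M0)// expr2 ler_peMr// (le_trans ler01).
Qed.

End level_sets.

(** [fu] and [fg] are the values of [f] before and after a perturbation of norm [t H], [Lg] is the
    derivative along it, and [V2] is the norm of the truncation in [W]. The terms in [alpha] and
    [gamma] do not increase and drop out; what is left compares [(2 t - t^2) V2^2 >= t V2^2] with an
    error linear in [t], so [t] cancels. *)
Lemma optimality_arith {R : realType}
    (alpha beta gamma t fu fg Lg CL H S v V2 U Ug Wn2 Wt2 P Pt : R) :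
  0 < alpha -> 0 < beta -> 0 < gamma -> 0 < t -> t <= 1 -> 0 <= H ->
  0 <= Ug -> Ug <= U -> Pt <= P -> Wt2 <= Wn2 - (2 * t - t ^+ 2) * V2 ^+ 2 ->
  `|fg - fu - Lg| <= t * H -> `|Lg| <= CL * (t * H) -> H <= S * v ->
  fu + alpha / 2 * U ^+ 2 + beta / 2 * Wn2 + gamma * P <=
    fg + alpha / 2 * Ug ^+ 2 + beta / 2 * Wt2 + gamma * Pt ->
  V2 ^+ 2 <= 2 / beta * (`|CL| + 1) * S * v.
Proof.
move=> a0 b0 c0 t0 t1 H0 Ug0 UgU PtP Wt hf hL hH fopt.
have h1 : Ug ^+ 2 <= U ^+ 2 by rewrite lerXn2r ?nnegrE// (le_trans Ug0).
have {}h1 := ler_wpM2l (ltW (divr_gt0 a0 (ltr0Sn R 1))) h1.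
have {}PtP := ler_wpM2l (ltW c0) PtP.
have b2 : 0 < beta / 2 by rewrite divr_gt0.
have {}Wt := ler_wpM2l (ltW b2) Wt.
have tH0 : 0 <= t * H by rewrite mulr_ge0// ltW.
have hf' := le_trans (ler_norm _) hf.
have hL' : Lg <= `|CL| * (t * H).
  apply: le_trans (ler_norm _) (le_trans hL _); rewrite ler_wpM2r//; exact: ler_norm.
have h2 : beta / 2 * ((2 * t - t ^+ 2) * V2 ^+ 2) <= (`|CL| + 1) * (t * H) by lra.
have h3 : t * V2 ^+ 2 <= (2 * t - t ^+ 2) * V2 ^+ 2.
  rewrite ler_wpM2r ?sqr_ge0// expr2 -mulrBl -[leLHS]mul1r ler_wpM2r ?(ltW t0)//; lra.
have {}h3 := ler_wpM2l (ltW b2) h3.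
have h4 : beta / 2 * V2 ^+ 2 <= (`|CL| + 1) * (S * v).
  apply: (@le_trans _ _ ((`|CL| + 1) * H)); last by rewrite ler_wpM2l// addr_ge0.
  rewrite -(ler_pM2l t0) mulrCA; apply: le_trans h3 (le_trans h2 _).
  by rewrite mulrCA.
have -> : 2 / beta * (`|CL| + 1) * S * v = (beta / 2)^-1 * ((`|CL| + 1) * (S * v)).
  by rewrite invf_div; ring.
by rewrite ler_pdivlMl.
Qed.

(** * Comparison of the local solution with the truncated pair *)

Section optimality.
Context {R : realType} {d : nat}.
Notation leb := (lebesgue_rV d : {measure set 'rV[R]_d -> \bar R}).
Notation leb_st := (@leb_spacetime R d).
Variables (Om : set 'rV[R]_d) (T s alpha beta gamma p : R) (W : frac_space Om).
Variable f : (measurableTypeR R * 'rV[R]_d -> R) -> R.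
Variables (u : measurableTypeR R * 'rV[R]_d -> R) (w : 'rV[R]_d -> R).
Hypotheses (d_gt0 : (0 < d)%N) (OmP : bounded_lipschitz_domain Om) (T0 : 0 < T).
Hypotheses (s0 : 0 < s) (s1 : s < 1).
Hypotheses (alpha0 : 0 < alpha) (beta0 : 0 < beta) (gamma0 : 0 < gamma).
Hypotheses (p0 : 0 < p) (p1 : p < 1).
Hypothesis f_diff : exists L, frechet_derivative leb_st (cylinder Om T) f u L.
Hypothesis uwP : local_solution T s W (Phi0 T s W f alpha beta gamma p) u w.

Let oOm : open Om. Proof. by case: OmP. Qed.
Let bOm : bounded_set Om. Proof. by case: OmP. Qed.
Let mOm : measurable Om. Proof. exact: open_measurable_rV. Qed.
Let mC : measurable (cylinder Om T). Proof. exact: measurable_cylinder. Qed.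

Let hu : L2 leb_st (cylinder Om T) u. Proof. by case: uwP => -[]. Qed.
Let Ww : W_mem s W w. Proof. by case: uwP => -[]. Qed.
Let hw : L2 leb Om w. Proof. exact: Wmem_L2 Ww. Qed.
Let uw : {ae leb_st, forall tx, cylinder Om T tx -> `|u tx| <= w tx.2}.
Proof. by case: uwP => -[]. Qed.

Lemma measurable_excess k : measurable_fun (cylinder Om T) (excess k u).
Proof.
have mu_ := L2_measurable mC hu.
apply: measurable_funB; apply: measurable_pos_above => //.
exact: measurable_funN.
Qed.

Lemma L2_excess k : 0 <= k -> L2 leb_st (cylinder Om T) (excess k u).
Proof.
move=> k0; apply: (L2_le mC (measurable_excess k) hu) => z _.
by rewrite normr_excess// ge_max normr_ge0 andbT lerBlDr lerDl.
Qed.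

(** Almost everywhere [|u| <= w], so the excess is at most [(w - k)^+]; integration in time gives
    the factor [sqrt T]. *)
Lemma L2norm_excess k : 0 <= k ->
  U_norm Om T (excess k u) <= Num.sqrt T * L2norm leb Om (pos_above k w).
Proof.
move=> k0; have hv := L2_pos_above mOm k0 hw.
rewrite -(@ler_pXn2r _ 2) ?nnegrE ?L2norm_ge0 ?mulr_ge0 ?sqrtr_ge0 ?L2norm_ge0//.
rewrite exprMn sqr_sqrtr ?(ltW T0)// -lee_fin -(L2_sqint (L2_excess k0)) EFinM -(L2_sqint hv).
have mv := L2_measurable mOm hv.
rewrite -(sqint_snd_cylinder mOm T0 mv).
apply: ae_ge0_le_integral => //.
- by move=> z _; rewrite lee_fin sqr_ge0.
- exact: measurable_sqr (measurable_excess k).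
- by move=> z _; rewrite lee_fin sqr_ge0.
- exact: measurable_sqr (@measurable_snd_cylinder R d Om T mOm _ mv).
apply: filterS uw => z hz /hz uz; rewrite lee_fin -real_normK ?num_real//.
rewrite lerXn2r ?nnegrE ?pos_above_ge0// normr_excess//.
by rewrite /pos_above ge_max !le_max lexx orbT andbT lerD2r uz.
Qed.

Lemma admissible_truncation k t : 0 <= k -> 0 <= t -> t <= 1 ->
  admissible T s W (u \+ (fun z => - t * excess k u z)) (fun x => w x - t * pos_above k w x).
Proof.
move=> k0 t0 t1; have [Wt _ _] := W_truncation d_gt0 OmP s0 s1 k0 t0 t1 Ww.
have he := L2Z mC (- t) (L2_excess k0).
split; [exact: (L2D mC hu he)|exact: Wt|].
apply: filterS uw => z hz /hz uz /=.
rewrite mulNr normr_sub_excess//; exact: sub_trunc_mono.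
Qed.

Lemma U_norm_truncation k t : 0 <= k -> 0 <= t -> t <= 1 ->
  U_norm Om T (u \+ (fun z => - t * excess k u z)) <= U_norm Om T u.
Proof.
move=> k0 t0 t1; have he := L2Z mC (- t) (L2_excess k0).
have m := L2_measurable mC (L2D mC hu he).
apply: (L2norm_le mC _ hu); first exact: m.
move=> z _ /=; rewrite mulNr normr_sub_excess// lerBlDr lerDl mulr_ge0//.
by rewrite le_max lexx orbT.
Qed.

Lemma optimality_truncation : exists2 C, 0 < C & forall k, 0 < k ->
  W_norm s W (pos_above k w) ^+ 2 <= C * L2norm leb Om (pos_above k w).
Proof.
have [L [[Llin [CL LC]] Ldiff]] := f_diff.
(* Any fixed precision would do; with [1] the linearization error is at most the norm of the
   perturbation. *)
have [r r0 hr] := Ldiff 1 ltr01.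
have [_ [rho rho0 hrho]] := uwP.
pose C1 := `|CL| + 1.
have C10 : 0 < C1 by rewrite ltr_wpDl.
exists (2 / beta * C1 * Num.sqrt T).
  by rewrite !mulr_gt0 ?sqrtr_gt0// invr_gt0.
move=> k k0; have k0' := ltW k0.
pose H := U_norm Om T (excess k u); pose V := W_norm s W (pos_above k w).
have H0 : 0 <= H by exact: L2norm_ge0.
have V0 : 0 <= V by exact: sqrtr_ge0.
(* Dividing both radii by [N] keeps the perturbation of [u] within [r] and [rho], and that of [w]
   within [rho]; [t] depends on [k], the final constant does not. *)
pose N := H + V + 1.
have N0 : 0 < N by rewrite ltr_wpDl// addr_ge0.
pose t := Num.min 1 (Num.min (rho / N) (r / N)).
have t0 : 0 < t by rewrite !lt_min ltr01 !divr_gt0.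
have t1 : t <= 1 by rewrite ge_min lexx.
have trho : t * N <= rho by rewrite -ler_pdivlMr// !ge_min lexx orbT.
have tr : t * N <= r by rewrite -ler_pdivlMr// !ge_min lexx !orbT.
have tH : t * H <= t * N by rewrite ler_pM2l// /N; lra.
have tV : t * V <= t * N by rewrite ler_pM2l// /N; lra.
have t0' := ltW t0.
pose g := fun z => - t * excess k u z.
have hg : L2 leb_st (cylinder Om T) g := L2Z mC (- t) (L2_excess k0').
have gn : L2norm leb_st (cylinder Om T) g = t * H.
  by rewrite /g (L2normZ mC (- t) (L2_excess k0')) normrN gtr0_norm.
have [Wt Wn Wd] := W_truncation d_gt0 OmP s0 s1 k0' t0' t1 Ww.
pose wt := fun x => w x - t * pos_above k w x.
have ug : (u \+ g) \- u = g by apply/funext => z /=; rewrite addrC addKr.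
have fopt := hrho (u \+ g) wt (admissible_truncation k0' t0' t1).
rewrite ug in fopt.
have {}fopt := fopt (le_trans _ (le_trans tH trho)) (le_trans _ (le_trans tV trho)).
have {fopt} : Phi0 T s W f alpha beta gamma p u w <= Phi0 T s W f alpha beta gamma p (u \+ g) wt.
  by apply: fopt; [rewrite /U_norm gn|rewrite Wd].
have Pint := power_integral_truncation mOm bOm p0 p1 k0' t0' t1 hw (Wmem_L2 OmP Wt).
have Un := U_norm_truncation k0' t0' t1.
have fd := hr g hg; rewrite gn mul1r in fd.
have {}fd := fd (le_trans tH tr).
have Lg := LC g hg; rewrite gn in Lg.
have Hk := L2norm_excess k0'.
rewrite /Phi0 => fopt.
exact: (optimality_arith alpha0 beta0 gamma0 t0 t1 H0 (L2norm_ge0 _ _ _) Un Pint Wn fd Lg Hk fopt).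
Qed.

End optimality.

(** The two estimates combine to [v^2 <= C D x v]; cancelling [v] and squaring yields [x^2], which
    doubles the exponent [2 s / d]. *)
Lemma self_bound {R : realType} (A v x V2 C D : R) : 0 < C -> 0 < D -> 0 <= x -> 0 <= v ->
  A <= v ^+ 2 -> v ^+ 2 <= C * x * V2 -> V2 <= D * v -> A <= (C * D) ^+ 2 * x ^+ 2.
Proof.
move=> C0 D0 x0 v0 Av h1 h2; apply: le_trans Av _; rewrite -exprMn.
rewrite lerXn2r ?nnegrE ?mulr_ge0 ?(ltW C0) ?(ltW D0)//.
have h : v * v <= C * D * x * v.
  rewrite -expr2; apply: le_trans h1 _.
  rewrite (_ : C * D * x * v = C * x * (D * v)); last by ring.
  by apply: ler_wpM2l h2; rewrite mulr_ge0// ltW.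
have [v1|v1] := leP v 0; last by rewrite ler_pM2r in h.
by apply: le_trans v1 _; rewrite mulr_ge0// mulr_ge0// ltW.
Qed.

Theorem corollary4p12 (R : realType) (d : nat) (Om : set 'rV[R]_d)
    (T s alpha beta gamma p : R) (W : frac_space Om)
    (f : (measurableTypeR R * 'rV[R]_d -> R) -> R)
    (ubar : measurableTypeR R * 'rV[R]_d -> R) (wbar : 'rV[R]_d -> R)
    (d_gt0 : (0 < d)%N)
    (OmP : bounded_lipschitz_domain Om)
    (T_gt0 : 0 < T)
    (s_gt0 : 0 < s) (s_lt1 : s < 1)
    (alpha_gt0 : 0 < alpha) (beta_gt0 : 0 < beta) (gamma_gt0 : 0 < gamma)
    (p_gt0 : 0 < p) (p_lt1 : p < 1)
    (f_U : on_L2 leb_spacetime (cylinder Om T) f)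
    (f_wlsc : weakly_lsc leb_spacetime (cylinder Om T) f)
    (f_bound : affinely_bounded_below leb_spacetime (cylinder Om T) f)
    (f_C1 : continuously_frechet_differentiable leb_spacetime (cylinder Om T) f)
    (ds : d%:R <= 2 * s \/
          2 * s < d%:R /\ 4 < 2 * d%:R / (d%:R - 2 * s))
    (uwP : local_solution T s W (Phi0 T s W f alpha beta gamma p) ubar wbar) :
  Linfty (lebesgue_rV d) Om wbar /\
  Linfty leb_spacetime (cylinder Om T) ubar.
Proof.
have [oOm _ _ bOm _] := OmP.
have mOm : measurable Om by exact: open_measurable_rV.
have mC : measurable (cylinder Om T) by exact: measurable_cylinder.
have [[hu Ww uw] _] := uwP.
have hw : L2 (lebesgue_rV d) Om wbar := Wmem_L2 OmP Ww.
have f_diff : exists L, frechet_derivative leb_spacetime (cylinder Om T) f ubar L.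
  by have [df [hdf _]] := f_C1; exists (df ubar); exact: hdf.
have [C C0 hC] := optimality_truncation d_gt0 OmP T_gt0 s_gt0 s_lt1 alpha_gt0 beta_gt0
  gamma_gt0 p_gt0 p_lt1 f_diff uwP.
have [C2 [delta [C20 delta0 FK]]] := W_faber_krahn d_gt0 OmP s_gt0 s_lt1 W.
have d0 : 0 < d%:R :> R by rewrite ltr0n.
(* The first alternative gives [d <= 2 s < 4 s]; the second multiplies out to [4 d - 8 s < 2 d]. *)
have d4s : d%:R < 4 * s.
  case: ds => [h|[h1]]; first by apply: le_lt_trans h _; lra.
  by rewrite ltr_pdivlMr ?subr_gt0//; lra.
have q1 : 1 < 4 * s / d%:R by rewrite ltr_pdivlMr// mul1r.
have K0 : 0 < (C2 * C) ^+ 2 by rewrite exprn_gt0// mulr_gt0.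
have decay k h m : 0 < k -> k < h -> 0 < m -> m <= delta -> level_measure Om wbar k <= m ->
    (h - k) ^+ 2 * level_measure Om wbar h <= (C2 * C) ^+ 2 * m `^ (4 * s / d%:R).
  move=> k0 kh m0 md km.
  have lm : (lebesgue_rV d (Om `&` [set x | pos_above k wbar x != 0%R]) <= m%:E)%E.
    by rewrite pos_above_neq0 (level_measureE mOm bOm hw) lee_fin.
  have h1 := FK k wbar m (ltW k0) Ww m0 md lm.
  have h2 := level_chebyshev mOm bOm hw (ltW k0) kh.
  have -> : m `^ (4 * s / d%:R) = (m `^ (2 * s / d%:R)) ^+ 2.
    rewrite -powR_mulrn ?powR_ge0// -powRrM; congr (_ `^ _); ring.
  exact: self_bound C20 C0 (powR_ge0 _ _) (L2norm_ge0 _ _ _) h2 h1 (hC k k0).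
have [k k0 phik] := stampacchia K0 delta0 q1 (level_measure_ge0 Om wbar)
  (level_measure_mono mOm bOm hw) (level_measure_small mOm bOm hw) decay.
pose A := Om `&` [set x | k < wbar x]; pose B := Om `&` [set x | wbar x < 0].
have mA : measurable A := measurable_level mOm hw k.
have A0 : lebesgue_rV d A = 0 by rewrite /A (level_measureE mOm bOm hw) phik.
have mB : measurable B.
  rewrite /B (_ : [set x | wbar x < 0] = wbar @^-1` (`]-oo, 0[ : set R)).
    by apply: (L2_measurable mOm hw) => //; exact: measurable_itv.
  by apply/seteqP; split => x /=; rewrite in_itv.
have [N [mN N0 hN]] := uw.
(* The constraint [|u| <= w] fails on the whole cylinder over [B], where [w < 0]; as [T > 0], [B]
   itself is null. *)
have B0 : lebesgue_rV d B = 0.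
  have : (leb_spacetime (cylinder B T) <= leb_spacetime N)%E.
    apply: le_measure; rewrite ?inE//; first exact: measurable_cylinder.
    move=> [t x] [/= It [Ox wx]]; apply: hN => /= h.
    have := le_lt_trans (le_trans (normr_ge0 _) (h (conj It Ox))) wx.
    by rewrite ltxx.
  rewrite N0 leb_cylinder// => h; apply/eqP; rewrite eq_le measure_ge0 andbT.
  by move: h; rewrite -[leRHS](mule0 T%:E) lee_pmul2l.
split.
  apply: (@Linfty_ae_bound _ _ _ _ _ mOm _ k); first exact: L2_measurable hw.
  exists (A `|` B); split; first exact: measurableU.
    by apply/eqP; rewrite eq_le measure_ge0 andbT -(adde0 0%E) -{1}A0 -B0 measureU2.
  move=> x /= nx; apply: contrapT => nAB; apply: nx => Ox.
  rewrite ger0_norm; rewrite leNgt; apply/negP => h; apply: nAB; [by left|by right].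
apply: (@Linfty_ae_bound _ _ _ _ _ mC _ k); first exact: L2_measurable hu.
(* Off this null cylinder [w <= k], and the constraint passes the bound on to [u]. *)
have cA0 : leb_spacetime (cylinder A T) = 0.
  by rewrite -(mule0 T%:E) -A0; exact: leb_cylinder.
have mcA : measurable (cylinder A T) by exact: measurable_cylinder.
exists (N `|` cylinder A T); split; first exact: measurableU.
  by apply/eqP; rewrite eq_le measure_ge0 andbT -(adde0 0%E) -{1}N0 -cA0 measureU2.
move=> [t x] /= nx; apply: contrapT => nNA; apply: nx => -[It Ox].
have h1 : `|ubar (t, x)| <= wbar x.
  by apply: contrapT => h; apply: nNA; left; apply: hN => /= h'; apply: h; exact: h'.
apply: le_trans h1 _; rewrite leNgt; apply/negP => h2; apply: nNA; right.
by split.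
Qed.
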